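(* Let $q\ge2$ be an integer and $k$ a positive integer. Assume the Generalized Riemann Hypothesis. Then for every $\varepsilon>0$, \[\sum_{\substack{\chi\bmod q\\ \chi\neq\chi_0}}\frac{1}{|L(1,\chi)|^{2k}}=C(k)\,\varphi(q)\prod_{p\mid q}\left(1+\frac{\binom{k}{1}^2}{p^2}+\dots+\frac{\binom{k}{k}^2}{p^{2k}}\right)^{-1}\left(1+O\!\left(q^{-1+\varepsilon}\right)\right),\] where the sum runs over all non-principal Dirichlet characters modulo $q$ and \[C(k)=\prod_p\left(1+\frac{\binom{k}{1}^2}{p^2}+\dots+\frac{\binom{k}{k}^2}{p^{2k}}\right),\] the products being over primes $p$.
   Context: $\chi_0$ is the principal character modulo $q$, $L(s,\chi)$ the Dirichlet $L$-function, $\varphi$ Euler's totient function. GRH asserts all nontrivial zeros of all Dirichlet $L$-functions have real part $1/2$. The implied constant may depend on $k$ and $\varepsilon$. *)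

(* Defs.v *)
From Stdlib Require Import Reals Lra Lia ZArith Znumtheory List ClassicalEpsilon.
From Coquelicot Require Import Coquelicot.
Import ListNotations.
Open Scope R_scope.

Fixpoint binom (n k : nat) : nat :=
  match n, k with
  | _, O => 1%nat
  | O, S _ => 0%nat
  | S n', S k' => (binom n' k' + binom n' k)%nat
  end.

Definition primeb (p : nat) : bool :=
  if prime_dec (Z.of_nat p) then true else false.

Definition totient (q : nat) : nat :=
  length (filter (fun n => Nat.eqb (Nat.gcd n q) 1) (seq 1 q)).

Fixpoint prod_primes_le (f : nat -> R) (N : nat) : R :=
  match N with
  | O => 1
  | S n => prod_primes_le f n * (if primeb (S n) then f (S n) else 1)
  end.

Definition prod_primes_dvd (f : nat -> R) (q : nat) : R :=
  prod_primes_le (fun p => if Nat.eqb (q mod p) 0 then f p else 1) q.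

Definition local_factor (k p : nat) : R :=
  sum_f_R0 (fun j => (INR (binom k j)) ^ 2 / (INR p) ^ (2 * j)) k.

Definition Cconst (k : nat) : R :=
  real (Lim_seq (fun N => prod_primes_le (local_factor k) N)).

Definition main_term (k q : nat) : R :=
  Cconst k * INR (totient q) * prod_primes_dvd (fun p => / local_factor k p) q.

Definition is_dirichlet_char (q : nat) (chi : nat -> C) : Prop :=
  (forall m n : nat, chi (m * n)%nat = Cmult (chi m) (chi n)) /\
  (forall n : nat, chi (n + q)%nat = chi n) /\
  (forall n : nat, chi n = RtoC 0 <-> Nat.gcd n q <> 1%nat) /\
  chi 1%nat = RtoC 1.

Definition is_principal_char (q : nat) (chi : nat -> C) : Prop :=
  forall n : nat, Nat.gcd n q = 1%nat -> chi n = RtoC 1.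

Definition is_nonprincipal_char (q : nat) (chi : nat -> C) : Prop :=
  is_dirichlet_char q chi /\ ~ is_principal_char q chi.

(** A duplicate-free enumeration of the non-principal characters mod q
    (chosen by Hilbert's epsilon; such an enumeration exists since there are
    exactly phi(q) - 1 of them). *)
Definition nonprincipal_chars (q : nat) : list (nat -> C) :=
  epsilon (inhabits nil)
    (fun l => NoDup l /\ forall chi, In chi l <-> is_nonprincipal_char q chi).

Definition sum_nonprincipal (q : nat) (F : (nat -> C) -> R) : R :=
  fold_right (fun chi acc => F chi + acc) 0 (nonprincipal_chars q).

Definition npow_neg (n : nat) (s : C) : C :=
  (exp (- Re s * ln (INR n)) * cos (Im s * ln (INR n)),
   - (exp (- Re s * ln (INR n)) * sin (Im s * ln (INR n)))).

Fixpoint dirichlet_partial (a : nat -> C) (s : C) (N : nat) : C :=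
  match N with
  | O => RtoC 0
  | S n => Cplus (dirichlet_partial a s n) (Cmult (a (S n)) (npow_neg (S n) s))
  end.

Definition Ccv (u : nat -> C) (l : C) : Prop :=
  forall eps : R, 0 < eps -> exists N : nat, forall n : nat, (N <= n)%nat ->
    Cmod (Cminus (u n) l) < eps.

(** L(s, chi) as the (limit of the) Dirichlet series; for non-principal chi
    this converges for Re s > 0, in particular at s = 1. *)
Definition Lfun (chi : nat -> C) (s : C) : C :=
  (real (Lim_seq (fun N => Re (dirichlet_partial chi s N))),
   real (Lim_seq (fun N => Im (dirichlet_partial chi s N)))).

Definition eta_coef (n : nat) : C := RtoC ((-1) ^ (S n)).

(** GRH.  Nontrivial zeros of Dirichlet L-functions are exactly their zeros in
    the open strip 0 < Re s < 1.  For a principal character mod m,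
    L(s,chi_0) = zeta(s) prod_{p|m} (1 - p^(-s)), whose zeros in the strip are
    those of zeta, which there coincide with the zeros of
    eta(s) = (1 - 2^(1-s)) zeta(s) = sum (-1)^(n+1) n^(-s) (convergent for
    Re s > 0).  For non-principal chi the Dirichlet series converges in the
    strip and is L(s,chi). *)
Definition GRH : Prop :=
  (forall s : C, 0 < Re s < 1 ->
     Ccv (dirichlet_partial eta_coef s) (RtoC 0) -> Re s = 1 / 2) /\
  (forall (m : nat) (chi : nat -> C), (1 <= m)%nat -> is_nonprincipal_char m chi ->
     forall s : C, 0 < Re s < 1 ->
     Ccv (dirichlet_partial chi s) (RtoC 0) -> Re s = 1 / 2).

(* Main.v *)
(* Expand [f(z) = L(2 - z, chi)] at [0]. Under GRH, Landau's theorem on the line [Re s = 1] and the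
   Euler product for [Re s > 1], [f] has no zero in [|z| <= 5/4], so Borel-Caratheodory bounds the
   Taylor coefficients of [f^-k] by [q^O(1) (8/9)^j]. Cutting this expansion after [J] of order [ln q]
   terms approximates [L(1, chi)^-k] within [O(q^-2)] by an absolutely convergent series
   [sum b_n chi(n)], where [b_n] is [mu_k(n) / n] times the smooth weight
   [n^-1 sum_(j < J) (ln n)^j / j!]. Orthogonality over all characters then gives [phi(q)] times
   [sum |b_n|^2] over [n] coprime to [q], up to pairs [m = n mod q], [m <> n], and the principal
   character, which together contribute only [O(q^eps)]; finally the sum of [mu_k(n)^2 / n^2] over
   [n] coprime to [q] is the Euler product of the main term. *)
Require Import Defs.
From Stdlib Require Import Reals.
From Coquelicot Require Import Coquelicot.
From Stdlib Require Permutation FinFun Znumtheory ZArith Factorial Lra Lia.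
From Stdlib Require Classical ClassicalEpsilon FunctionalExtensionality.
From HB Require structures.
From mathcomp Require all_boot ssralg Rstruct complex all_algebra all_fingroup all_field all_character.
Open Scope R_scope.

Module Development.

Import Factorial Lra Lia Classical ClassicalEpsilon FunctionalExtensionality.
Import HB.structures.
Import mathcomp.boot.all_boot.
Set Implicit Arguments.
Unset Strict Implicit.
Unset Printing Implicit Defensive.
Local Open Scope R_scope.

(** The complex analysis takes place on coefficient sequences: a function near [s = 2] is the
    sequence of its Taylor coefficients, products are Cauchy products, and no logarithm of a
    nonvanishing function is chosen. A truncation of [f] is a polynomial with roots outside
    [|z| <= 5/4]; the coefficients of its logarithm are, up to [-1/m], the power sums of the inverse
    roots, and Newton's identity leads from these to the [k]-th inverse power. Truncation at degree
    [N >= j] leaves the coefficients up to [j] unchanged, and the bounds do not depend on [N].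

    The radii are nested around [z = 1], the point [s = 1]. Bounded partial sums of [chi] give decay
    [(4/7)^j]; the Dirichlet series itself is summed on [|z| <= 3/2]; [|z| <= 5/4] stays in
    [Re s >= 3/4], away from the line [1/2]; the ratio [8/9] is what the losses leave at [z = 1].

    It is the Taylor expansion that is cut, not the Dirichlet series: all [n] remain, with weights
    [O(q^eps n^(-1-delta))], and so the sum over congruent pairs converges absolutely. *)

HB.instance Definition _ := Monoid.isComLaw.Build R 0 Rplus
  (fun x y z => esym (Rplus_assoc x y z)) Rplus_comm Rplus_0_l.
HB.instance Definition _ := Monoid.isComLaw.Build R 1 Rmult
  (fun x y z => esym (Rmult_assoc x y z)) Rmult_comm Rmult_1_l.
HB.instance Definition _ := Monoid.isMulLaw.Build R 0 Rmult Rmult_0_l Rmult_0_r.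
HB.instance Definition _ := Monoid.isAddLaw.Build R Rmult Rplus
  Rmult_plus_distr_r Rmult_plus_distr_l.
HB.instance Definition _ := Monoid.isComLaw.Build C (RtoC 0) Cplus
  Cplus_assoc Cplus_comm Cplus_0_l.
HB.instance Definition _ := Monoid.isComLaw.Build C (RtoC 1) Cmult
  Cmult_assoc Cmult_comm Cmult_1_l.
HB.instance Definition _ := Monoid.isMulLaw.Build C (RtoC 0) Cmult Cmult_0_l Cmult_0_r.
HB.instance Definition _ := Monoid.isAddLaw.Build C Cmult Cplus
  Cmult_plus_distr_r Cmult_plus_distr_l.

Notation "\rs_ ( i <- r ) F" := (\big[Rplus/0]_(i <- r) F)
  (at level 41, F at level 41, i, r at level 50).
Notation "\rs_ ( i <- r | P ) F" := (\big[Rplus/0]_(i <- r | P) F)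
  (at level 41, F at level 41, i, r at level 50).
Notation "\rs_ ( i < n ) F" := (\big[Rplus/0]_(i < n) F)
  (at level 41, F at level 41, i, n at level 50).
Notation "\cs_ ( i <- r ) F" := (\big[Cplus/RtoC 0]_(i <- r) F)
  (at level 41, F at level 41, i, r at level 50).
Notation "\cs_ ( i <- r | P ) F" := (\big[Cplus/RtoC 0]_(i <- r | P) F)
  (at level 41, F at level 41, i, r at level 50).
Notation "\cs_ ( i < n ) F" := (\big[Cplus/RtoC 0]_(i < n) F)
  (at level 41, F at level 41, i, n at level 50).

(** * Finite sums in [R] and [C] *)

Section FiniteSums.

Lemma rsum_le_cond (I : Type) (r : seq I) (P : pred I) (F G : I -> R) :
  (forall i, P i -> F i <= G i) -> \rs_(i <- r | P i) F i <= \rs_(i <- r | P i) G i.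
Proof. by move=> H; elim/big_rec2: _ => [|i x y Pi]; [lra | have := H i Pi; lra]. Qed.

Lemma rsum_le (I : Type) (r : seq I) (F G : I -> R) :
  (forall i, F i <= G i) -> \rs_(i <- r) F i <= \rs_(i <- r) G i.
Proof. by move=> H; apply: rsum_le_cond. Qed.

Lemma rsum_le_in (I : eqType) (r : seq I) (F G : I -> R) :
  (forall i, i \in r -> F i <= G i) -> \rs_(i <- r) F i <= \rs_(i <- r) G i.
Proof. by move=> H; rewrite big_seq [X in _ <= X]big_seq; apply: rsum_le_cond. Qed.

Lemma rsum_ge0 (I : Type) (r : seq I) (P : pred I) (F : I -> R) :
  (forall i, P i -> 0 <= F i) -> 0 <= \rs_(i <- r | P i) F i.
Proof. by move=> H; elim/big_rec: _ => [|i x Pi]; [lra | have := H i Pi; lra]. Qed.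

Lemma Cmod_csum (I : Type) (r : seq I) (P : pred I) (F : I -> C) :
  Cmod (\cs_(i <- r | P i) F i) <= \rs_(i <- r | P i) Cmod (F i).
Proof.
elim/big_rec2: _ => [|i x y _ H]; first by rewrite Cmod_0; lra.
by have := Cmod_triangle (F i) y; lra.
Qed.

Lemma RtoC_rsum (I : Type) (r : seq I) (P : pred I) (F : I -> R) :
  RtoC (\rs_(i <- r | P i) F i) = \cs_(i <- r | P i) RtoC (F i).
Proof. by elim/big_rec2: _ => [|i x y _ <-] //; rewrite RtoC_plus. Qed.

Lemma Re_csum (I : Type) (r : seq I) (P : pred I) (F : I -> C) :
  Re (\cs_(i <- r | P i) F i) = \rs_(i <- r | P i) Re (F i).
Proof. by elim/big_rec2: _ => [|i x y _ <-]. Qed.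

Lemma Im_csum (I : Type) (r : seq I) (P : pred I) (F : I -> C) :
  Im (\cs_(i <- r | P i) F i) = \rs_(i <- r | P i) Im (F i).
Proof. by elim/big_rec2: _ => [|i x y _ <-]. Qed.

Lemma csum_opp (I : Type) (r : seq I) (P : pred I) (F : I -> C) :
  Copp (\cs_(i <- r | P i) F i) = \cs_(i <- r | P i) Copp (F i).
Proof.
elim: r => [|i r IH]; first by rewrite !big_nil; apply: injective_projections => /=; ring.
by rewrite !big_cons -IH; case: ifP => _ //=; ring.
Qed.

Lemma csum_minus (I : Type) (r : seq I) (P : pred I) (F G : I -> C) :
  (\cs_(i <- r | P i) (F i - G i) = \cs_(i <- r | P i) F i - \cs_(i <- r | P i) G i)%C.
Proof. by rewrite {2}/Cminus csum_opp -big_split. Qed.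

Lemma rsum_minus (I : Type) (r : seq I) (P : pred I) (F G : I -> R) :
  \rs_(i <- r | P i) (F i - G i) = \rs_(i <- r | P i) F i - \rs_(i <- r | P i) G i.
Proof.
elim: r => [|i r IH]; first by rewrite !big_nil; ring.
by rewrite !big_cons; case: ifP => _; rewrite IH; ring.
Qed.

Lemma rsum_const (I : Type) (r : seq I) (c : R) : \rs_(i <- r) c = INR (size r) * c.
Proof.
elim: r => [|i r IH]; first by rewrite big_nil /=; ring.
by rewrite big_cons IH -[size (i :: r)]/(size r).+1 S_INR /=; ring.
Qed.

Lemma csum_const (I : Type) (r : seq I) (c : C) : \cs_(i <- r) c = (RtoC (INR (size r)) * c)%C.
Proof.
elim: r => [|i r IH]; first by rewrite big_nil /=; ring.
by rewrite big_cons IH -[size (i :: r)]/(size r).+1 S_INR RtoC_plus /=; ring.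
Qed.

Lemma big_subset_split (I : eqType) (T : Type) (idx : T) (op : Monoid.com_law idx)
    (s0 s : seq I) (F : I -> T) : uniq s0 -> uniq s -> {subset s0 <= s} ->
  \big[op/idx]_(i <- s) F i =
  op (\big[op/idx]_(i <- s0) F i) (\big[op/idx]_(i <- [seq i <- s | i \notin s0]) F i).
Proof.
move=> u0 u sub; rewrite (bigID (fun i => i \in s0)) /= -big_filter -[X in op _ X]big_filter.
congr (op _ _); apply: perm_big; apply: uniq_perm => //; first exact: filter_uniq.
by move=> i; rewrite mem_filter; case: (boolP (i \in s0)) => //= /sub.
Qed.

Lemma rsum_subset (I : eqType) (s0 s : seq I) (F : I -> R) :
  uniq s0 -> uniq s -> {subset s0 <= s} -> (forall i, 0 <= F i) ->
  \rs_(i <- s0) F i <= \rs_(i <- s) F i.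
Proof.
move=> u0 u sub F0; rewrite (big_subset_split _ F u0 u sub) /=.
by have := @rsum_ge0 _ [seq i <- s | i \notin s0] xpredT F (fun i _ => F0 i); lra.
Qed.

End FiniteSums.

Lemma Csub_eq0 (a b : C) : (a - b)%C = 0%C -> a = b.
Proof. by move=> H; have -> : a = ((a - b) + b)%C; [ring | rewrite H; ring]. Qed.

Lemma im_le_Cmod (z : C) : Rabs (Im z) <= Cmod z.
Proof. by apply: Rle_trans (Rmax_Cmod z); apply: Rmax_r. Qed.

(** * Unconditional summation over arbitrary index types *)

Section UnconditionalSums.

(** Absolute summability as a uniform bound over duplicate-free finite lists. No enumeration of [I]
    is fixed, so that pairs, fibres and subfamilies are all handled alike. *)
Definition summ_by (I : eqType) (f : I -> C) (M : R) : Prop :=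
  forall s : seq I, uniq s -> \rs_(i <- s) Cmod (f i) <= M.

Definition summ (I : eqType) (f : I -> C) : Prop := exists M, summ_by f M.

Definition usum (I : eqType) (f : I -> C) (S : C) : Prop :=
  forall eps, 0 < eps -> exists2 s0 : seq I, uniq s0 &
    forall s, uniq s -> {subset s0 <= s} -> Cmod (\cs_(i <- s) f i - S)%C < eps.

(** Total, so that a sum can be written before its convergence is known; the value is meaningful
    once [summ f] holds. *)
Definition tot (I : eqType) (f : I -> C) : C := epsilon (inhabits (RtoC 0)) (usum f).

Variable I : eqType.
Implicit Types f g : I -> C.

Lemma summ_by_ge0 f M : summ_by f M -> 0 <= M.
Proof. by move=> /(_ [::] isT); rewrite big_nil. Qed.

Lemma summ_by_le f g M : summ_by g M -> (forall i, Cmod (f i) <= Cmod (g i)) -> summ_by f M.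
Proof. by move=> H le s us; apply: Rle_trans (H s us); apply: rsum_le. Qed.

Lemma summ_le f g : summ g -> (forall i, Cmod (f i) <= Cmod (g i)) -> summ f.
Proof. by case=> M H le; exists M; apply: summ_by_le H le. Qed.

Lemma summ_add f g : summ f -> summ g -> summ (fun i => f i + g i)%C.
Proof.
case=> M Hf [N Hg]; exists (M + N) => s us.
apply: Rle_trans (_ : \rs_(i <- s) (Cmod (f i) + Cmod (g i)) <= _).
  by apply: rsum_le => i; apply: Cmod_triangle.
by rewrite big_split /=; have := Hf s us; have := Hg s us; lra.
Qed.

Lemma summ_scal c f : summ f -> summ (fun i => c * f i)%C.
Proof.
case=> M Hf; exists (Cmod c * M) => s us.
under eq_bigr => i _ do rewrite Cmod_mult.
rewrite -big_distrr /=; apply: Rmult_le_compat_l; [exact: Cmod_ge_0 | exact: Hf].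
Qed.

Lemma summ_bdd_mul B f g : (forall i, Cmod (g i) <= B) -> summ f -> summ (fun i => g i * f i)%C.
Proof.
move=> gB Hf; apply: summ_le (summ_scal (RtoC B) Hf) _ => i.
rewrite !Cmod_mult Cmod_R; apply: Rmult_le_compat_r; first exact: Cmod_ge_0.
exact: Rle_trans (gB i) (Rle_abs _).
Qed.

Lemma summ_abs f : summ f -> summ (fun i => RtoC (Cmod (f i))).
Proof. by move/summ_le; apply=> i; rewrite Cmod_R Rabs_pos_eq; [lra | exact: Cmod_ge_0]. Qed.

Lemma summ_cond (P : pred I) f : summ f -> summ (fun i => if P i then f i else 0)%C.
Proof.
move/summ_le; apply=> i; case: (P i); first lra.
by rewrite Cmod_0; exact: Cmod_ge_0.
Qed.

Lemma usum_unique f S T : usum f S -> usum f T -> S = T.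
Proof.
move=> HS HT; apply: NNPP => neq.
have pos : 0 < Cmod (S - T)%C by apply/Cmod_gt_0 => /Csub_eq0.
have [s1 u1 H1] := HS (Cmod (S - T)%C / 2) ltac:(lra).
have [s2 u2 H2] := HT (Cmod (S - T)%C / 2) ltac:(lra).
pose s := undup (s1 ++ s2).
have := H1 s (undup_uniq _) _; have := H2 s (undup_uniq _) _.
move=> A B.
have /A {}A : {subset s2 <= s} by move=> i; rewrite mem_undup mem_cat orbC => ->.
have /B {}B : {subset s1 <= s} by move=> i; rewrite mem_undup mem_cat => ->.
set t := (\big[_/_]_(i <- s) _) in A B.
have := Cmod_triangle (t - T)%C (- (t - S))%C; rewrite Cmod_opp.
have -> : ((t - T) + - (t - S) = S - T)%C by ring.
by lra.
Qed.

Lemma usum_add f g S T : usum f S -> usum g T -> usum (fun i => f i + g i)%C (S + T)%C.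
Proof.
move=> HS HT eps e0.
have [s1 u1 H1] := HS (eps / 2) ltac:(lra).
have [s2 u2 H2] := HT (eps / 2) ltac:(lra).
exists (undup (s1 ++ s2)); first exact: undup_uniq.
move=> s us sub; rewrite big_split /=.
have A := H1 s us; have B := H2 s us.
set x := (\big[_/_]_(i <- s) f i) in A *; set y := (\big[_/_]_(i <- s) g i) in B *.
have -> : (x + y - (S + T) = (x - S) + (y - T))%C by ring.
have := Cmod_triangle (x - S)%C (y - T)%C.
suff [] : Cmod (x - S)%C < eps / 2 /\ Cmod (y - T)%C < eps / 2 by lra.
by split; [apply: A => i Hi | apply: B => i Hi]; apply: sub; rewrite mem_undup mem_cat Hi ?orbT.
Qed.

Lemma usum_scal c f S : usum f S -> usum (fun i => c * f i)%C (c * S)%C.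
Proof.
move=> H eps e0.
have cp : 0 < Cmod c + 1 by have := Cmod_ge_0 c; lra.
have [s0 u0 H0] := H (eps / (Cmod c + 1)) (Rdiv_lt_0_compat _ _ e0 cp).
exists s0 => // s us sub; rewrite -big_distrr /=.
set x := (\big[_/_]_(i <- s) f i).
have -> : (c * x - c * S = c * (x - S))%C by ring.
rewrite Cmod_mult; have {H0} := H0 s us sub; rewrite -/x => H0.
apply: Rle_lt_trans (_ : (Cmod c + 1) * Cmod (x - S)%C < _).
  by have := Cmod_ge_0 (x - S)%C; nra.
have -> : eps = (Cmod c + 1) * (eps / (Cmod c + 1)) by field; lra.
exact: Rmult_lt_compat_l.
Qed.

Lemma usum_ext f g S : (forall i, f i = g i) -> usum f S -> usum g S.
Proof. by move=> /functional_extensionality <-. Qed.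

(** The supremum of the finite subsums is the sum: nonnegativity makes them grow with the list, so
    one nearly optimal list controls every larger one. *)
Lemma usum_pos_ex f (F : I -> R) M : (forall i, 0 <= F i) -> (forall i, f i = RtoC (F i)) ->
  (forall s, uniq s -> \rs_(i <- s) F i <= M) -> exists S, usum f S.
Proof.
move=> F0 /functional_extensionality -> HM.
pose E x := exists2 s : seq I, uniq s & x = \rs_(i <- s) F i.
have bE : bound E by exists M => x [s us ->]; apply: HM.
have nE : exists x, E x by exists 0, [::]; rewrite ?big_nil.
have [S [ub lub]] := completeness E bE nE.
exists (RtoC S) => eps e0.
have [s0 [u0 H0]] : exists s0, uniq s0 /\ S - eps < \rs_(i <- s0) F i.
  apply: NNPP => nex.
  have : S <= S - eps.
    apply: lub => x [s us ->]; apply: Rnot_lt_le => lt; apply: nex; by exists s.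
  lra.
exists s0 => // s us sub; rewrite -RtoC_rsum -RtoC_minus Cmod_R.
have := rsum_subset u0 us sub F0.
have : \rs_(i <- s) F i <= S by apply: ub; exists s.
by move=> h1 h2; apply: Rabs_def1; lra.
Qed.

Lemma usum_ex f : summ f -> exists S, usum f S.
Proof.
case=> M HM.
have [S0 H0] := @usum_pos_ex (fun i => RtoC (Cmod (f i))) _ M (fun i => Cmod_ge_0 _) (fun=> erefl) HM.
(* [g (f i)] is [Cmod (f i)] minus the nonnegative summable term [Cmod (f i) - g (f i)]; this serves
   for both [Re] and [Im]. *)
have key (g : C -> R) : (forall z, Rabs (g z) <= Cmod z) ->
    exists S, usum (fun i => RtoC (g (f i))) S.
  move=> gz.
  have [S1 H1] : exists S, usum (fun i => RtoC (Cmod (f i) - g (f i))) S.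
    apply: (@usum_pos_ex _ (fun i => Cmod (f i) - g (f i)) (2 * M)) => // [i|s us].
      by have := gz (f i); have := Rle_abs (g (f i)); lra.
    apply: Rle_trans (_ : \rs_(i <- s) (2 * Cmod (f i)) <= _).
      apply: rsum_le => i; have := gz (f i).
      by have := Rle_abs (- g (f i)); rewrite Rabs_Ropp; lra.
    by rewrite -big_distrr /=; have := HM s us; lra.
  exists (S0 + (RtoC (-1)) * S1)%C.
  apply: usum_ext (usum_add H0 (usum_scal (RtoC (-1)) H1)) => i /=.
  by rewrite -RtoC_mult -RtoC_plus; congr RtoC; ring.
have [S1 H1] := key Re re_le_Cmod.
have [S2 H2] := key Im im_le_Cmod.
exists (S1 + Ci * S2)%C.
apply: usum_ext (usum_add H1 (usum_scal Ci H2)) => i.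
by case: (f i) => x y; apply: injective_projections => /=; ring.
Qed.

Lemma totP f : summ f -> usum f (tot f).
Proof. by move/usum_ex=> H; apply: epsilon_spec. Qed.

Lemma usum_tot f S : usum f S -> tot f = S.
Proof. by move=> H; apply: (@usum_unique f _ S _ H); apply: epsilon_spec; exists S. Qed.

Lemma usum_norm f S M : usum f S -> summ_by f M -> Cmod S <= M.
Proof.
move=> HS HM; apply: le_epsilon => eps e0.
have [s us /(_ s us (fun=> id)) H] := HS eps e0.
have := Cmod_triangle (\cs_(i <- s) f i)%C (- (\cs_(i <- s) f i - S))%C.
rewrite Cmod_opp; set x := (\big[_/_]_(i <- s) f i) in H *.
have -> : (x + - (x - S) = S)%C by ring.
by have := @Cmod_csum _ s xpredT f; rewrite -/x; have := HM s us; lra.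
Qed.

Lemma tot_norm f M : summ_by f M -> Cmod (tot f) <= M.
Proof. by move=> H; apply: usum_norm (H); apply: totP; exists M. Qed.

Lemma usum_fin f (s0 : seq I) : uniq s0 -> (forall i, i \notin s0 -> f i = 0%C) ->
  usum f (\cs_(i <- s0) f i).
Proof.
move=> u0 H eps e0; exists s0 => // s us sub.
rewrite (big_subset_split _ f u0 us sub) /=.
rewrite [X in (_ + X)%C]big1_seq; last first.
  by move=> i /=; rewrite mem_filter => /andP[/H].
have -> : (\cs_(i <- s0) f i + 0 - \cs_(i <- s0) f i = 0)%C by ring.
by rewrite Cmod_0.
Qed.

Lemma summ_fin f (s0 : seq I) : uniq s0 -> (forall i, i \notin s0 -> f i = 0%C) -> summ f.
Proof.
move=> u0 H; exists (\rs_(i <- s0) Cmod (f i)) => s us.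
rewrite (bigID (fun i => i \in s0)) /= [X in _ + X]big1 ?Rplus_0_r; last first.
  by move=> i /H ->; rewrite Cmod_0.
rewrite -big_filter; apply: rsum_subset => //; first exact: filter_uniq.
  by move=> i; rewrite mem_filter => /andP[].
by move=> i; apply: Cmod_ge_0.
Qed.

Lemma tot_fin f (s0 : seq I) : uniq s0 -> (forall i, i \notin s0 -> f i = 0%C) ->
  tot f = \cs_(i <- s0) f i.
Proof. by move=> u H; apply: usum_tot; apply: usum_fin. Qed.

Lemma tot_add f g : summ f -> summ g -> tot (fun i => f i + g i)%C = (tot f + tot g)%C.
Proof. by move=> Hf Hg; apply: usum_tot; apply: usum_add; apply: totP. Qed.

Lemma tot_scal c f : summ f -> tot (fun i => c * f i)%C = (c * tot f)%C.
Proof. by move=> Hf; apply: usum_tot; apply: usum_scal; apply: totP. Qed.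

Lemma tot_ext f g : (forall i, f i = g i) -> tot f = tot g.
Proof. by move=> /functional_extensionality ->. Qed.

Lemma summ_ext f g : (forall i, f i = g i) -> summ f -> summ g.
Proof. by move=> /functional_extensionality ->. Qed.

Lemma summ_opp f : summ f -> summ (fun i => - f i)%C.
Proof. by move/summ_le; apply=> i; rewrite Cmod_opp; lra. Qed.

Lemma summ_sub f g : summ f -> summ g -> summ (fun i => f i - g i)%C.
Proof. by move=> Hf Hg; apply: summ_add => //; apply: summ_opp. Qed.

Lemma tot_sub f g : summ f -> summ g -> tot (fun i => f i - g i)%C = (tot f - tot g)%C.
Proof.
move=> Hf Hg.
rewrite (@tot_ext _ (fun i => f i + RtoC (- (1)) * g i)%C) => [|i].
  rewrite tot_add ?tot_scal //; last exact: summ_scal.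
  by rewrite RtoC_opp; ring.
by rewrite RtoC_opp; ring.
Qed.

Lemma summ_sum (J : Type) (r : seq J) (F : J -> I -> C) :
  (forall j, summ (F j)) -> summ (fun i => \cs_(j <- r) F j i).
Proof.
move=> H; elim: r => [|j r IH].
  by apply: (@summ_fin _ [::]) => // i _; rewrite big_nil.
by apply: summ_ext (summ_add (H j) IH) => i; rewrite big_cons.
Qed.

Lemma tot_sum (J : Type) (r : seq J) (F : J -> I -> C) :
  (forall j, summ (F j)) -> tot (fun i => \cs_(j <- r) F j i) = \cs_(j <- r) tot (F j).
Proof.
move=> H; elim: r => [|j r IH].
  rewrite (@tot_fin _ [::]) ?big_nil // => i _; by rewrite big_nil.
rewrite big_cons -IH -tot_add //; last exact: summ_sum.
by apply: tot_ext => i; rewrite big_cons.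
Qed.

(** A list [s] disjoint from [s0] is the difference of the two nearly complete lists [s0 ++ s] and
    [s0]. *)
Lemma summ_tail f eps : summ f -> 0 < eps -> exists2 s0 : seq I, uniq s0 &
  forall s, uniq s -> (forall i, i \in s -> i \notin s0) -> \rs_(i <- s) Cmod (f i) <= eps.
Proof.
move=> /summ_abs/totP H e0; have [s0 u0 H0] := H (eps / 2) ltac:(lra).
exists s0 => // s us dis.
have us' : uniq (s0 ++ s).
  rewrite cat_uniq u0 us andbT /=; apply/hasPn => i /dis; exact.
have A : Cmod (\cs_(i <- s0 ++ s) RtoC (Cmod (f i)) - tot (fun i => RtoC (Cmod (f i))))%C < eps / 2.
  by apply: H0 => // i h; rewrite mem_cat h.
have B := H0 _ u0 (fun i => id).
rewrite big_cat /= in A; set x := (\big[_/_]_(i <- s0) _) in A B.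
rewrite -!RtoC_rsum in A; set y := (\big[_/_]_(i <- s) _) in A *.
set T := tot _ in A B.
have := Cmod_triangle (x + RtoC y - T)%C (- (x - T))%C; rewrite Cmod_opp.
have -> : (x + RtoC y - T + - (x - T) = RtoC y)%C by ring.
by rewrite Cmod_R; have := Rle_abs y; lra.
Qed.

Lemma RtoC_inj (x y : R) : RtoC x = RtoC y -> x = y. Proof. by case. Qed.

Lemma tot_real (F : I -> R) : summ (fun i => RtoC (F i)) ->
  tot (fun i => RtoC (F i)) = RtoC (Re (tot (fun i => RtoC (F i)))).
Proof.
move=> H.
suff : tot (fun i => RtoC (F i)) = Cconj (tot (fun i => RtoC (F i))).
  by case: (tot _) => x y [E]; apply: injective_projections => /=; lra.
apply: usum_unique (totP H) _ => eps e0; have [s0 u0 H0] := totP H e0.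
exists s0 => // s us sub; have := H0 s us sub.
rewrite -RtoC_rsum; set T := tot _ => A.
suff -> : (RtoC (\rs_(i <- s) F i) - Cconj T = Cconj (RtoC (\rs_(i <- s) F i) - T))%C.
  by rewrite Cmod_conj.
by apply: injective_projections => /=; ring.
Qed.

Definition rtot (F : I -> R) : R := Re (tot (fun i => RtoC (F i))).

Lemma tot_le_rtot f (F : I -> R) : summ (fun i => RtoC (F i)) ->
  (forall i, Cmod (f i) <= F i) -> Cmod (tot f) <= rtot F.
Proof.
move=> HF le; apply: le_epsilon => eps e0.
have Hf : summ f.
  by apply: summ_le HF _ => i; rewrite Cmod_R; apply: Rle_trans (le i) (Rle_abs _).
have [s1 u1 H1] := totP Hf (eps := eps / 2) ltac:(lra).
have [s2 u2 H2] := totP HF (eps := eps / 2) ltac:(lra).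
pose s := undup (s1 ++ s2).
have us : uniq s by apply: undup_uniq.
have {}H1 : Cmod (\cs_(i <- s) f i - tot f)%C < eps / 2.
  by apply: H1 => // i hi; rewrite mem_undup mem_cat hi.
have {}H2 : Cmod (\cs_(i <- s) RtoC (F i) - tot (fun i => RtoC (F i)))%C < eps / 2.
  by apply: H2 => // i hi; rewrite mem_undup mem_cat hi orbT.
rewrite tot_real // -RtoC_rsum -RtoC_minus Cmod_R -/(rtot F) in H2.
have A : Cmod (\cs_(i <- s) f i) <= \rs_(i <- s) F i.
  by apply: Rle_trans (Cmod_csum _ _ _) _; apply: rsum_le.
set x := (\big[_/_]_(i <- s) f i) in H1 A; set y := (\big[_/_]_(i <- s) F i) in H2 A.
have := Cmod_triangle x (- (x - tot f))%C; rewrite Cmod_opp.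
have -> : (x + - (x - tot f) = tot f)%C by ring.
by have := Rle_abs (y - rtot F); lra.
Qed.

Lemma rtot_ge0 (F : I -> R) : summ (fun i => RtoC (F i)) -> (forall i, 0 <= F i) -> 0 <= rtot F.
Proof.
move=> HF F0; have := @tot_le_rtot (fun=> 0%C) F HF; rewrite Cmod_0 => /(_ F0).
by have := Cmod_ge_0 (tot (fun _ : I => 0%C)); lra.
Qed.

Lemma rtot_sub (F G : I -> R) : summ (fun i => RtoC (F i)) -> summ (fun i => RtoC (G i)) ->
  rtot (fun i => F i - G i) = rtot F - rtot G.
Proof.
move=> HF HG; rewrite /rtot.
rewrite (@tot_ext _ (fun i => RtoC (F i) - RtoC (G i))%C) => [|i]; last by rewrite RtoC_minus.
by rewrite tot_sub.
Qed.

Lemma rtot_le (F G : I -> R) : summ (fun i => RtoC (F i)) -> summ (fun i => RtoC (G i)) ->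
  (forall i, F i <= G i) -> rtot F <= rtot G.
Proof.
move=> HF HG le; suff : 0 <= rtot (fun i => G i - F i) by rewrite rtot_sub //; lra.
apply: rtot_ge0 => [|i]; last by have := le i; lra.
by apply: summ_ext (summ_sub HG HF) => i; rewrite RtoC_minus.
Qed.

Lemma rtot_ge_fin (F : I -> R) (s : seq I) : summ (fun i => RtoC (F i)) ->
  (forall i, 0 <= F i) -> uniq s -> \rs_(i <- s) F i <= rtot F.
Proof.
move=> HF F0 us.
have HG : summ (fun i => RtoC (if i \in s then F i else 0)).
  by apply: summ_ext (summ_cond (mem s) HF) => i /=; case: ifP.
suff -> : \rs_(i <- s) F i = rtot (fun i => if i \in s then F i else 0).
  by apply: rtot_le => // i; case: ifP => _; [lra | apply: F0].
rewrite /rtot (@tot_fin _ s) // => [|i /negbTE ->] //.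
by rewrite -RtoC_rsum /= big_seq [RHS]big_seq; apply: eq_bigr => i ->.
Qed.

End UnconditionalSums.

(** * Summation by fibres, reindexing, products and Fubini *)

Section Rearrangement.

Definition fiber_sum (I J : eqType) (g : I -> J) (f : I -> C) (j : J) : C :=
  tot (fun i => if g i == j then f i else RtoC 0).

Lemma csum_fiber (I J : eqType) (g : I -> J) (f : I -> C) (s : seq J) i : uniq s ->
  \cs_(j <- s) (if g i == j then f i else RtoC 0) = if g i \in s then f i else RtoC 0.
Proof.
elim: s => [|j s IH]; first by rewrite big_nil.
rewrite /= big_cons in_cons => /andP[jn us]; rewrite IH //=.
case: (boolP (g i == j)) => [/eqP ->|_] /=; last by rewrite Cplus_0_l.
by rewrite (negbTE jn) Cplus_0_r.
Qed.

Lemma csum_fiber_sum (I J : eqType) (g : I -> J) (f : I -> C) (s : seq J) : summ f -> uniq s ->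
  \cs_(j <- s) fiber_sum g f j = tot (fun i => if g i \in s then f i else RtoC 0).
Proof.
move=> Hf us; rewrite /fiber_sum -(@tot_sum _ _ s (fun j i => if g i == j then f i else RtoC 0)).
  by apply: tot_ext => i; apply: csum_fiber.
by move=> j; apply: (summ_cond (fun i => g i == j)).
Qed.

(** A fibre sum is dominated by the fibre sum of the moduli, and finitely many of those add up to
    the total over a union of disjoint fibres, still at most [M]. *)
Lemma summ_by_fiber (I J : eqType) (g : I -> J) (f : I -> C) M :
  summ_by f M -> summ_by (fiber_sum g f) M.
Proof.
move=> HM s us.
have Hf : summ f by exists M.
have Ha := summ_abs Hf.
pose h i := RtoC (Cmod (f i)).
have le j : Cmod (fiber_sum g f j) <= Re (fiber_sum g h j).
  rewrite /fiber_sum.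
  rewrite [X in Re X](@tot_ext _ _ (fun i => RtoC (if g i == j then Cmod (f i) else 0))); last first.
    by move=> i; rewrite /h; case: ifP.
  apply: tot_le_rtot => [|i]; last by case: ifP => _; [lra | rewrite Cmod_0; lra].
  by apply: summ_ext (summ_cond (fun i => g i == j) Ha) => i /=; case: ifP.
apply: Rle_trans (rsum_le _ le) _; rewrite -Re_csum csum_fiber_sum //.
apply: Rle_trans (Rle_abs _) _; apply: Rle_trans (re_le_Cmod _) _; apply: tot_norm => t ut.
apply: Rle_trans (HM t ut); apply: rsum_le => i; case: ifP => _.
  by rewrite /h Cmod_R Rabs_pos_eq; [lra | apply: Cmod_ge_0].
by rewrite Cmod_0; apply: Cmod_ge_0.
Qed.

Lemma summ_fiber (I J : eqType) (g : I -> J) (f : I -> C) : summ f -> summ (fiber_sum g f).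
Proof. by case=> M HM; exists M; apply: summ_by_fiber. Qed.

(** Take [s0] carrying all but [eps / 2] of the mass. A list of fibres that contains the image of
    [s0] omits only indices outside [s0]. *)
Lemma usum_fiber (I J : eqType) (g : I -> J) (f : I -> C) :
  summ f -> usum (fiber_sum g f) (tot f).
Proof.
move=> Hf eps e0; have [s0 u0 H0] := summ_tail Hf (eps := eps / 2) ltac:(lra).
exists (undup (map g s0)); first exact: undup_uniq.
move=> t ut sub; rewrite csum_fiber_sum // -tot_sub //; last exact: (summ_cond (fun i => g i \in t)).
apply: Rle_lt_trans (_ : eps / 2 < eps); last lra.
apply: tot_norm => s us.
apply: Rle_trans (H0 [seq i <- s | g i \notin t] _ _).
- rewrite big_filter [X in _ <= X]big_mkcond /=; apply: rsum_le => i.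
  case: ifP => _ /=.
    have -> : (f i - f i = 0)%C by ring.
    by rewrite Cmod_0; lra.
  have -> : (0 - f i = - f i)%C by ring.
  by rewrite Cmod_opp; lra.
- exact: filter_uniq.
move=> i; rewrite mem_filter => /andP[gi _]; apply: contra gi => i0.
by apply: sub; rewrite mem_undup map_f.
Qed.

Lemma tot_fiber (I J : eqType) (g : I -> J) (f : I -> C) : summ f ->
  tot f = tot (fiber_sum g f).
Proof. by move=> Hf; symmetry; apply: usum_tot; apply: usum_fiber. Qed.

(** Along an injection every fibre has at most one point; reindexing thus becomes a case of
    summation by fibres. *)
Lemma fiber_sum_inj (K I : eqType) (h : K -> I) (f : I -> C) : injective h ->
  (forall i, (forall k, h k != i) -> f i = RtoC 0) ->
  fiber_sum h (fun k => f (h k)) = f.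
Proof.
move=> hi f0; apply: functional_extensionality => i; rewrite /fiber_sum.
case: (classic (exists k, h k = i)) => [[k <-]|no].
  rewrite (@tot_fin _ _ [:: k]) ?big_seq1 ?eqxx // => k'.
  by rewrite inE (inj_eq hi) => /negbTE ->.
have nk k : h k != i by apply/eqP => E; apply: no; exists k.
rewrite f0 // (@tot_fin _ _ [::]) ?big_nil // => k _.
by rewrite (negbTE (nk k)).
Qed.

Lemma summ_inj (K I : eqType) (h : K -> I) (f : I -> C) : injective h ->
  (forall i, (forall k, h k != i) -> f i = RtoC 0) ->
  summ (fun k => f (h k)) -> summ f.
Proof. by move=> hi f0 /(summ_fiber h); rewrite fiber_sum_inj. Qed.

Lemma tot_inj (K I : eqType) (h : K -> I) (f : I -> C) : injective h ->
  (forall i, (forall k, h k != i) -> f i = RtoC 0) ->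
  summ (fun k => f (h k)) -> tot f = tot (fun k => f (h k)).
Proof. by move=> hi f0 H; rewrite [RHS](tot_fiber h) ?fiber_sum_inj. Qed.

Lemma summ_by_comp (K I : eqType) (h : K -> I) (f : I -> C) M : injective h ->
  summ_by f M -> summ_by (fun k => f (h k)) M.
Proof.
move=> hi HM s us.
by have := HM (map h s); rewrite map_inj_uniq // big_map => /(_ us).
Qed.

Lemma summ_comp (K I : eqType) (h : K -> I) (f : I -> C) : injective h ->
  summ f -> summ (fun k => f (h k)).
Proof. by move=> hi [M HM]; exists M; apply: summ_by_comp. Qed.

(** A finite set of pairs lies in the rectangle of its two projections, where the sum factors. *)
Lemma summ_by_prod (I J : eqType) (f : I -> C) (g : J -> C) M N : summ_by f M -> summ_by g N ->
  summ_by (fun p : I * J => f p.1 * g p.2)%C (M * N).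
Proof.
move=> Hf Hg s us.
pose s1 := undup (map fst s); pose s2 := undup (map snd s).
have u1 : uniq s1 by apply: undup_uniq.
have u2 : uniq s2 by apply: undup_uniq.
apply: Rle_trans (_ : \rs_(p <- [seq (i, j) | i <- s1, j <- s2]) Cmod (f p.1 * g p.2)%C <= _).
  apply: rsum_subset => //; first by apply: allpairs_uniq => // -[a b] [c d] _ _.
  - case=> a b ab; apply/allpairsP; exists (a, b) => /=; split=> //; rewrite mem_undup.
      by apply/mapP; exists (a, b).
    by apply/mapP; exists (a, b).
  - by move=> p; apply: Cmod_ge_0.
rewrite big_allpairs /=.
rewrite (eq_bigr (fun i => Cmod (f i) * \rs_(j <- s2) Cmod (g j))); last first.
  by move=> i _; rewrite big_distrr /=; apply: eq_bigr => j _; rewrite Cmod_mult.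
rewrite -big_distrl /=; apply: Rmult_le_compat; [| |exact: Hf|exact: Hg];
  by apply: rsum_ge0 => *; apply: Cmod_ge_0.
Qed.

Lemma summ_prod (I J : eqType) (f : I -> C) (g : J -> C) : summ f -> summ g ->
  summ (fun p : I * J => f p.1 * g p.2)%C.
Proof. by case=> M Hf [N Hg]; exists (M * N); apply: summ_by_prod. Qed.

Lemma fiber_sum_fst (I J : eqType) (F : I * J -> C) i : summ F ->
  fiber_sum fst F i = tot (fun j => F (i, j)).
Proof.
move=> HF; rewrite /fiber_sum (@tot_inj _ _ (fun j => (i, j))) /=.
- by apply: tot_ext => j; rewrite eqxx.
- by move=> a b [].
- move=> [a b] /= H; case: eqP => // E; have := H b; by rewrite E eqxx.
apply: (summ_comp (h := fun j => (i, j)) (f := fun p => if p.1 == i then F p else RtoC 0)).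
  by move=> a b [].
exact: (summ_cond (fun p : I * J => p.1 == i)).
Qed.

Lemma tot_fubini (I J : eqType) (F : I * J -> C) : summ F ->
  tot F = tot (fun i => tot (fun j => F (i, j))).
Proof.
by move=> HF; rewrite (tot_fiber fst) //; apply: tot_ext => i; apply: fiber_sum_fst.
Qed.

Lemma tot_prod (I J : eqType) (f : I -> C) (g : J -> C) : summ f -> summ g ->
  tot (fun p : I * J => f p.1 * g p.2)%C = (tot f * tot g)%C.
Proof.
move=> Hf Hg; rewrite tot_fubini; last exact: summ_prod.
rewrite (@tot_ext _ _ (fun i => tot g * f i)%C) => [|i /=]; last by rewrite tot_scal // Cmult_comm.
by rewrite tot_scal // Cmult_comm.
Qed.

Lemma usum_Ccv (f : nat -> C) S : usum f S -> Ccv (fun N => \cs_(n < N) f n) S.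
Proof.
move=> H eps e0; have [s0 u0 H0] := H eps e0.
exists (\max_(i <- s0) i).+1 => N /leP hN.
rewrite -(big_mkord xpredT f); apply: H0; first exact: iota_uniq.
move=> i hi; rewrite mem_index_iota /=; apply: leq_trans hN.
by rewrite ltnS (@leq_bigmax_seq _ _ xpredT (fun x => x) i hi isT).
Qed.

Lemma summ_nat (f : nat -> C) M : (forall N, \rs_(n < N) Cmod (f n) <= M) -> summ_by f M.
Proof.
move=> H s us; apply: Rle_trans (H (\max_(i <- s) i).+1).
rewrite -(big_mkord xpredT (fun n => Cmod (f n))); apply: rsum_subset => //.
- exact: iota_uniq.
- by move=> i hi; rewrite mem_index_iota /= ltnS (@leq_bigmax_seq _ _ xpredT (fun x => x) i hi isT).
by move=> i; apply: Cmod_ge_0.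
Qed.

End Rearrangement.

Lemma Ccv_unique (u : nat -> C) (a b : C) : Ccv u a -> Ccv u b -> a = b.
Proof.
move=> Ha Hb; apply: NNPP => neq.
have pos : 0 < Cmod (a - b)%C by apply/Cmod_gt_0 => /Csub_eq0.
have [N HN] := Ha (Cmod (a - b)%C / 2) ltac:(lra).
have [N' HN'] := Hb (Cmod (a - b)%C / 2) ltac:(lra).
have A := HN (Nat.max N N') ltac:(lia).
have B := HN' (Nat.max N N') ltac:(lia).
set t := u _ in A B.
have := Cmod_triangle (t - b)%C (- (t - a))%C; rewrite Cmod_opp.
have -> : ((t - b) + - (t - a) = a - b)%C by ring.
lra.
Qed.

Lemma Ccv_ext (u v : nat -> C) l : (forall n, u n = v n) -> Ccv u l -> Ccv v l.
Proof. by move=> /functional_extensionality ->. Qed.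

(** * Taylor coefficients of Dirichlet series at [s = 2] *)

Section DirichletTaylor.

Definition expterm (j : nat) (x : R) : R := x ^ j / INR (fact j).

(* [n^x], with the value 0 at [n = 0]. *)
Definition npow (n : nat) (x : R) : R := if n is 0%N then 0 else exp (x * ln (INR n)).

(* The [j]-th Taylor coefficient of [z |-> n^(z-2)] at 0. *)
Definition tcoef (j n : nat) : R := npow n (-2) * expterm j (ln (INR n)).

(** The [j]-th Taylor coefficient at [z = 0] of the Dirichlet series of [a] at [s = 2 - z]. *)
Definition dtaylor (a : nat -> C) (j : nat) : C := tot (fun n => a n * RtoC (tcoef j n))%C.

Definition dconv (a b : nat -> C) (n : nat) : C := \cs_(d <- divisors n) (a d * b (n %/ d)%N)%C.

Definition cauchy (a b : nat -> C) (j : nat) : C := \cs_(i < j.+1) (a i * b (j - i)%N)%C.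

Lemma sum_f_R0_big (F : nat -> R) n : sum_f_R0 F n = \rs_(i < n.+1) F i.
Proof.
elim: n => [|n IH] /=; first by rewrite big_ord_recr big_ord0 /=; lra.
by rewrite big_ord_recr /= -IH.
Qed.

Lemma expterm_ge0 j x : 0 <= x -> 0 <= expterm j x.
Proof.
move=> x0; apply: Rmult_le_pos; first exact: pow_le.
by apply: Rlt_le; apply: Rinv_0_lt_compat; apply: INR_fact_lt_0.
Qed.

Lemma expterm_add j x y :
  \rs_(i < j.+1) (expterm i x * expterm (j - i)%N y) = expterm j (x + y).
Proof.
rewrite /expterm Stdlib.Reals.Binomial.binomial sum_f_R0_big /Rdiv big_distrl /=; apply: eq_bigr => i _.
rewrite /Binomial.C -minusE; field; split; [|split]; exact: INR_fact_neq_0.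
Qed.

Lemma expterm_sum_le J x : 0 <= x -> \rs_(j < J) expterm j x <= exp x.
Proof.
case: J => [|J] x0; first by rewrite big_ord0; apply: Rlt_le; apply: exp_pos.
by rewrite -(sum_f_R0_big (fun j => expterm j x)); apply: exp_ge_taylor.
Qed.

Lemma expterm_le_exp j x : 0 <= x -> expterm j x <= exp x.
Proof.
move=> x0; apply: Rle_trans (expterm_sum_le j.+1 x0).
rewrite big_ord_recr /= -[X in X <= _]Rplus_0_l; apply: Rplus_le_compat_r.
by apply: rsum_ge0 => i _; apply: expterm_ge0.
Qed.

Lemma expterm_scal j c x : expterm j (c * x) = c ^ j * expterm j x.
Proof. by rewrite /expterm Rpow_mult_distr /Rdiv Rmult_assoc. Qed.

(** One term of the exponential series of [c * x], with [c] free: growth [n^c] is traded for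
    geometric decay [c^(-j)] of Taylor coefficients. *)
Lemma expterm_le j c x : 0 < c -> 0 <= x -> expterm j x <= (/ c) ^ j * exp (c * x).
Proof.
move=> c0 x0; have -> : expterm j x = (/ c) ^ j * expterm j (c * x).
  rewrite expterm_scal -Rmult_assoc -Rpow_mult_distr Rinv_l ?pow1; lra.
apply: Rmult_le_compat_l; last by apply: expterm_le_exp; nra.
by apply: pow_le; apply: Rlt_le; apply: Rinv_0_lt_compat.
Qed.

Lemma npow_ge0 n x : 0 <= npow n x.
Proof. by case: n => [|n] /=; [lra | apply: Rlt_le; apply: exp_pos]. Qed.

Lemma npow_add n x y : npow n (x + y) = npow n x * npow n y.
Proof. by case: n => [|n]; [rewrite /=; ring | rewrite /npow -exp_plus; congr exp; ring]. Qed.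

Lemma ln_mulnat m n : (0 < m)%N -> (0 < n)%N -> ln (INR (m * n)%N) = ln (INR m) + ln (INR n).
Proof.
move=> /ltP m0 /ltP n0; rewrite -multE mult_INR ln_mult //; exact: lt_0_INR.
Qed.

Lemma npowE n x : (0 < n)%N -> npow n x = exp (x * ln (INR n)).
Proof. by case: n. Qed.

Lemma npow_mul m n x : npow (m * n)%N x = npow m x * npow n x.
Proof.
case: m => [|m]; first by rewrite mul0n /=; ring.
case: n => [|n]; first by rewrite muln0 [npow 0 x]/= Rmult_0_r.
by rewrite !npowE ?muln_gt0 // ln_mulnat // Rmult_plus_distr_l exp_plus.
Qed.

Lemma ln_nat_ge0 n : 0 <= ln (INR n).
Proof.
case: n => [|n].
  change (INR 0) with 0; unfold ln; destruct (Rlt_dec 0 0) as [h|h]; [exfalso; clear -h; lra | exact: Rle_refl].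
rewrite -ln_1; apply: ln_le; first lra.
by apply: (le_INR 1); lia.
Qed.

Lemma npow_le n x y : x <= y -> npow n x <= npow n y.
Proof.
move=> xy; case: n => [|n]; first by rewrite /=; lra.
have := ln_nat_ge0 n.+1; rewrite /npow => h.
by case: (Req_dec (x * ln (INR n.+1)) (y * ln (INR n.+1))) => [->|ne];
  [lra | apply: Rlt_le; apply: exp_increasing; nra].
Qed.

Lemma tcoef_ge0 j n : 0 <= tcoef j n.
Proof. by apply: Rmult_le_pos; [apply: npow_ge0 | apply: expterm_ge0; apply: ln_nat_ge0]. Qed.

Lemma tcoef_le j n c : 0 < c -> tcoef j n <= (/ c) ^ j * npow n (c - 2).
Proof.
move=> c0; rewrite /tcoef.
apply: Rle_trans (_ : npow n (-2) * ((/ c) ^ j * exp (c * ln (INR n))) <= _).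
  apply: Rmult_le_compat_l; first exact: npow_ge0.
  by apply: expterm_le => //; apply: ln_nat_ge0.
have -> : c - 2 = c + -2 by ring.
by case: n => [|n]; rewrite npow_add /=; [right; ring | right; ring].
Qed.

(** The binomial theorem for [ln (m * n) = ln m + ln n]; this is what turns Dirichlet convolution
    into the Cauchy product. *)
Lemma tcoef_mul j m n :
  \rs_(i < j.+1) (tcoef i m * tcoef (j - i)%N n) = tcoef j (m * n)%N.
Proof.
case: m => [|m].
  by rewrite mul0n /tcoef /= !Rmult_0_l big1 // => i _; rewrite !Rmult_0_l.
case: n => [|n].
  by rewrite muln0 /tcoef /= !Rmult_0_l big1 // => i _; rewrite Rmult_0_l Rmult_0_r.
rewrite /tcoef npow_mul ln_mulnat // -expterm_add big_distrr /=; apply: eq_bigr => i _; ring.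
Qed.

(** Absolute convergence at [s = 2 - c], which makes the Taylor coefficients at [s = 2] of size
    [O(c^(-j))]. *)
Definition adm (c : R) (a : nat -> C) : Prop := summ (fun n => a n * RtoC (npow n (c - 2)))%C.

Lemma summ_tcoef c a j : 0 < c -> adm c a -> summ (fun n => a n * RtoC (tcoef j n))%C.
Proof.
move=> c0 /(summ_scal (RtoC ((/ c) ^ j)))/summ_le; apply=> n.
rewrite !Cmod_mult !Cmod_R; have := tcoef_le j n c0.
rewrite !Rabs_pos_eq; try exact: npow_ge0; try exact: tcoef_ge0; last first.
  by apply: pow_le; apply: Rlt_le; apply: Rinv_0_lt_compat.
by have := Cmod_ge_0 (a n); nra.
Qed.

Lemma dtaylor_le c a : 0 < c -> adm c a ->
  exists2 M, 0 <= M & forall j, Cmod (dtaylor a j) <= M * (/ c) ^ j.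
Proof.
move=> c0 [M HM]; exists M; first exact: summ_by_ge0 HM.
move=> j; apply: tot_norm => s us.
apply: Rle_trans (_ : _ <= \rs_(n <- s) (Cmod (a n * RtoC (npow n (c - 2)))%C * (/ c) ^ j)) _.
  apply: rsum_le => n; rewrite !Cmod_mult !Cmod_R; have := tcoef_le j n c0.
  rewrite !Rabs_pos_eq; try exact: npow_ge0; try exact: tcoef_ge0.
  by have := Cmod_ge_0 (a n); nra.
rewrite -big_distrl /=; apply: Rmult_le_compat_r; last exact: HM.
by apply: pow_le; apply: Rlt_le; apply: Rinv_0_lt_compat.
Qed.

Lemma tot_divisors (H : nat * nat -> C) N : (0 < N)%N ->
  tot (fun p : nat * nat => if (p.1 * p.2)%N == N then H p else RtoC 0)
  = \cs_(d <- divisors N) H (d, (N %/ d)%N).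
Proof.
move=> N0; rewrite (@tot_fin _ _ [seq (d, (N %/ d)%N) | d <- divisors N]).
- rewrite big_map big_seq [RHS]big_seq; apply: eq_bigr => d.
  by rewrite -dvdn_divisors //= => dN; rewrite mulnC divnK // eqxx.
- by rewrite map_inj_uniq ?divisors_uniq // => a b [].
case=> m n /=; case: eqP => // E /mapP[]; exists m.
  by rewrite -dvdn_divisors // -E dvdn_mulr.
by rewrite -E mulKn //; move: N0; rewrite -E muln_gt0 => /andP[].
Qed.

Lemma dconv_fiber a b (w : nat -> R) n : w 0%N = 0 ->
  fiber_sum (fun p : nat * nat => (p.1 * p.2)%N)
    (fun p => a p.1 * b p.2 * RtoC (w (p.1 * p.2)%N))%C n = (dconv a b n * RtoC (w n))%C.
Proof.
move=> w0; rewrite /fiber_sum; case: (posnP n) => [->|n0].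
  (* The fibre over [0] is infinite; its terms all vanish because [w 0 = 0]. *)
  rewrite (@tot_fin _ _ [::]) ?big_nil ?w0 ?Cmult_0_r // => -[x y] _ /=.
  by case: eqP => // ->; rewrite w0 Cmult_0_r.
rewrite tot_divisors // /dconv big_distrl /= big_seq [RHS]big_seq; apply: eq_bigr => d.
by rewrite -dvdn_divisors //= => dN; rewrite mulnC divnK.
Qed.

Lemma summ_pairs a b c : adm c a -> adm c b ->
  summ (fun p : nat * nat => a p.1 * b p.2 * RtoC (npow (p.1 * p.2)%N (c - 2)))%C.
Proof.
move=> Ha Hb; apply: summ_ext (summ_prod Ha Hb) => -[m n] /=.
by rewrite npow_mul RtoC_mult; ring.
Qed.

Lemma adm_conv a b c : adm c a -> adm c b -> adm c (dconv a b).
Proof.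
move=> Ha Hb.
apply: summ_ext (summ_fiber (fun p : nat * nat => (p.1 * p.2)%N) (summ_pairs Ha Hb)) => n.
exact: (@dconv_fiber a b (fun n => npow n (c - 2))).
Qed.

(** One absolutely convergent series over pairs, read in two ways: [tcoef_mul] splits it into
    products of one coefficient of each factor, and fibring it over [p.1 * p.2] gives the
    convolution. *)
Lemma dtaylor_conv a b c j : 0 < c -> adm c a -> adm c b ->
  dtaylor (dconv a b) j = cauchy (dtaylor a) (dtaylor b) j.
Proof.
move=> c0 Ha Hb.
have S i k : summ (fun p : nat * nat =>
    a p.1 * RtoC (tcoef i p.1) * (b p.2 * RtoC (tcoef k p.2)))%C.
  exact: (summ_prod (summ_tcoef i c0 Ha) (summ_tcoef k c0 Hb)).
rewrite /cauchy; under eq_bigr => i _ do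
  rewrite /dtaylor -(tot_prod (summ_tcoef i c0 Ha) (summ_tcoef (j - i)%N c0 Hb)).
rewrite -(@tot_sum _ _ _ (fun (i : 'I_j.+1) (p : nat * nat) =>
  a p.1 * RtoC (tcoef i p.1) * (b p.2 * RtoC (tcoef (j - i)%N p.2)))%C) /=; last by move=> i; apply: S.
pose G (p : nat * nat) := (a p.1 * b p.2 * RtoC (tcoef j (p.1 * p.2)%N))%C.
have E p : G p = \cs_(i < j.+1) (a p.1 * RtoC (tcoef i p.1) * (b p.2 * RtoC (tcoef (j - i)%N p.2)))%C.
  rewrite /G -tcoef_mul RtoC_rsum big_distrr /=; apply: eq_bigr => i _.
  by rewrite RtoC_mult; ring.
rewrite -(tot_ext E) (tot_fiber (fun p : nat * nat => (p.1 * p.2)%N)).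
  by apply: tot_ext => n; rewrite dconv_fiber // /tcoef /= Rmult_0_l.
by apply: summ_ext (summ_sum _ (fun i : 'I_j.+1 => S i (j - i)%N)) => p; rewrite E.
Qed.

End DirichletTaylor.

(** * Real estimates for the coefficients as functions of [n] *)

Section RealEstimates.

Lemma INRS_gt0 n : 0 < INR n.+1. Proof. by apply: lt_0_INR; lia. Qed.

Lemma npowN1 n : (0 < n)%N -> npow n (-1) = / INR n.
Proof.
case: n => // n _; have -> : npow n.+1 (-1) = exp (- ln (INR n.+1)) by congr exp; ring.
by rewrite exp_Ropp exp_ln //; exact: INRS_gt0.
Qed.

Lemma ln_succ_le n : (0 < n)%N -> ln (INR n.+1) - ln (INR n) <= npow n (-1).
Proof.
case: n => // n _; rewrite npowN1 //.
have p := INRS_gt0 n.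
rewrite -ln_div //; last exact: INRS_gt0.
rewrite S_INR; have -> : (INR n.+1 + 1) / INR n.+1 = 1 + / INR n.+1 by field; lra.
have q : 0 < / INR n.+1 by apply: Rinv_0_lt_compat.
rewrite -[X in _ <= X]ln_exp; apply: ln_le; [lra | exact: exp_ineq1_le].
Qed.

Lemma ln_succ_ge n : (0 < n)%N -> npow n.+1 (-1) <= ln (INR n.+1) - ln (INR n).
Proof.
case: n => // n _; rewrite npowN1 //.
have p := INRS_gt0 n; have p' := INRS_gt0 n.+1.
have E : ln (INR n.+1) - ln (INR n.+2) = ln (INR n.+1 / INR n.+2) by rewrite ln_div.
have : ln (INR n.+1 / INR n.+2) <= - / INR n.+2; last lra.
rewrite -[X in _ <= X]ln_exp; apply: ln_le; first exact: Rdiv_lt_0_compat.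
have -> : INR n.+1 / INR n.+2 = 1 + - / INR n.+2.
  by rewrite (S_INR n.+1); field; have := S_INR n.+1; lra.
exact: exp_ineq1_le.
Qed.

Lemma ln_le_succ n : (0 < n)%N -> ln (INR n) <= ln (INR n.+1).
Proof.
case: n => // n _; apply: ln_le; first exact: INRS_gt0.
by rewrite (S_INR n.+1); lra.
Qed.

Lemma npow_sum_le d N : 0 < d -> \rs_(n < N) npow n (-1 - d) <= 1 + / d.
Proof.
move=> d0; have id0 : 0 < / d by apply: Rinv_0_lt_compat.
(* Telescoping against [n^(-d) / d], whose derivative is [- n^(-1-d)], by means of
   [ln n.+1 - ln n >= 1 / n.+1]. *)
have step n : (0 < n)%N -> npow n.+1 (-1 - d) <= (npow n (- d) - npow n.+1 (- d)) / d.
  move=> n0; apply: (Rmult_le_reg_r d) => //.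
  have -> : (npow n (- d) - npow n.+1 (- d)) / d * d = npow n (- d) - npow n.+1 (- d) by field; lra.
  have -> : -1 - d = -1 + - d by ring.
  rewrite npow_add; have := ln_succ_ge n0; have := npow_ge0 n.+1 (-1).
  rewrite !(npowE (- d)) //; set x := ln (INR n); set y := ln (INR n.+1); set u := npow _ _ => u0 uy.
  have -> : exp (- d * x) = exp (- d * y) * exp (d * (y - x)) by rewrite -exp_plus; congr exp; ring.
  have := exp_ineq1_le (d * (y - x)); have := exp_pos (- d * y).
  set e := exp (- d * y); set f := exp _ => e0 f1.
  have h1 : d * u <= f - 1 by have := Rmult_le_compat_l d _ _ (Rlt_le _ _ d0) uy; lra.
  by have := Rmult_le_compat_l e _ _ (Rlt_le _ _ e0) h1; lra.
have H n : \rs_(m < n.+2) npow m (-1 - d) <= 1 + (1 - npow n.+1 (- d)) / d.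
  elim: n => [|n IH].
    rewrite !big_ord_recr big_ord0 /= ln_1 !Rmult_0_r exp_0.
    have -> : (1 - 1) / d = 0 by field; lra.
    lra.
  have h2 := step n.+1 isT; rewrite big_ord_recr.
  have -> : 1 + (1 - npow n.+2 (- d)) / d = 1 + (1 - npow n.+1 (- d)) / d
     + (npow n.+1 (- d) - npow n.+2 (- d)) / d by field; lra.
  exact: Rplus_le_compat IH h2.
case: N => [|[|n]].
- by rewrite big_ord0; lra.
- by rewrite big_ord_recr big_ord0 /=; lra.
apply: Rle_trans (H n) _; have := npow_ge0 n.+1 (- d).
move=> h; have : (1 - npow n.+1 (- d)) / d <= / d; last lra.
rewrite /Rdiv -[X in _ <= X]Rmult_1_l; apply: Rmult_le_compat_r; lra.
Qed.

Lemma summ_by_npow d : 0 < d -> summ_by (fun n => RtoC (npow n (-1 - d))) (1 + / d).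
Proof.
move=> d0; apply: summ_nat => N; apply: Rle_trans (npow_sum_le N d0).
by apply: rsum_le => n; rewrite Cmod_R Rabs_pos_eq; [lra | apply: npow_ge0].
Qed.

Lemma summ_npow x : x < -1 -> summ (fun n => RtoC (npow n x)).
Proof.
move=> x1; exists (1 + / (-1 - x)).
by have := @summ_by_npow (-1 - x) ltac:(lra); have -> : -1 - (-1 - x) = x by ring.
Qed.

Lemma derivable_expterm j x :
  derivable_pt_lim (expterm j) x (if j is i.+1 then expterm i x else 0).
Proof.
rewrite /expterm; apply/is_derive_Reals; auto_derive => //.
case: j => [|i]; first by rewrite /= ; field.
rewrite [Init.Nat.pred i.+1]/= fact_simpl mult_INR.
by field; split; [exact: INR_fact_neq_0 | exact: not_0_INR].
Qed.

(** [tcoef j] in the real variable [x = ln n], to which the mean value theorem applies. *)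
Definition tfun (j : nat) (x : R) : R := exp (-2 * x) * expterm j x.

Lemma tcoefE j n : (0 < n)%N -> tcoef j n = tfun j (ln (INR n)).
Proof. by move=> n0; rewrite /tcoef /tfun npowE. Qed.

Lemma derivable_tfun j x : derivable_pt_lim (tfun j) x
  (-2 * exp (-2 * x) * expterm j x + exp (-2 * x) * (if j is i.+1 then expterm i x else 0)).
Proof.
apply: (derivable_pt_lim_mult (fun x => exp (-2 * x)) (expterm j)); last exact: derivable_expterm.
by apply/is_derive_Reals; auto_derive => //; ring.
Qed.

(** Every [c < 2] gives decay [c^(-j)] with a factor [e^((c-2) x)]. The choice [c = 7/4] leaves
    [n^(-1/4)], summable together with the spacing [1/n] of the logarithms; the constant [4] exceeds
    [2 + 7/4]. *)
Lemma tfun_deriv_le j x : 0 <= x ->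
  Rabs (-2 * exp (-2 * x) * expterm j x + exp (-2 * x) * (if j is i.+1 then expterm i x else 0))
  <= 4 * (4 / 7) ^ j * exp (- (1 / 4) * x).
Proof.
move=> x0.
have E : exp (-2 * x) * exp (7 / 4 * x) = exp (- (1 / 4) * x) by rewrite -exp_plus; congr exp; field.
have A : expterm j x <= (4 / 7) ^ j * exp (7 / 4 * x).
  have := @expterm_le j (7 / 4) x ltac:(lra) x0.
  by have -> : / (7 / 4) = 4 / 7 by field.
have B : 0 <= (if j is i.+1 then expterm i x else 0) <= 7 / 4 * (4 / 7) ^ j * exp (7 / 4 * x).
  case: j {A} => [|i] /=.
    by have := exp_pos (7 / 4 * x); lra.
  split; first exact: expterm_ge0.
  have := @expterm_le i (7 / 4) x ltac:(lra) x0; have -> : / (7 / 4) = 4 / 7 by field.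
  lra.
have C := expterm_ge0 j x0; have D := exp_pos (-2 * x).
move: A B C; set u := expterm j x; set v := (if j is i.+1 then _ else _); rewrite -E.
set e := exp (-2 * x) in D *; set f := exp _; set r := (4 / 7) ^ j => A B C.
have H1 : e * u <= e * (r * f) by apply: Rmult_le_compat_l; lra.
have H2 : e * v <= e * (7 / 4 * r * f) by apply: Rmult_le_compat_l; lra.
have H3 : 0 <= e * u by apply: Rmult_le_pos; lra.
have H4 : 0 <= e * v by apply: Rmult_le_pos; lra.
have H5 : 0 <= e * (r * f).
  apply: Rle_trans H3 H1.
by apply: Rabs_le; split; nra.
Qed.

Lemma tfun_lip j n x y : (0 < n)%N -> ln (INR n) <= x <= ln (INR n.+1) ->
  ln (INR n) <= y <= ln (INR n.+1) ->
  Rabs (tfun j x - tfun j y) <= 4 * (4 / 7) ^ j * npow n (-1 - 1 / 4).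
Proof.
move=> n0 hx hy.
have [c [-> hc]] := @MVT_abs (tfun j) _ y x (fun c _ => derivable_tfun j c).
have l0 := ln_nat_ge0 n.
have hc' : ln (INR n) <= c.
  apply: Rle_trans (proj1 hc); apply: Rmin_glb; lra.
have -> : -1 - 1 / 4 = - (1 / 4) + -1 by field.
rewrite npow_add -Rmult_assoc; apply: Rmult_le_compat; try exact: Rabs_pos.
  apply: Rle_trans (tfun_deriv_le j _) _; first lra.
  apply: Rmult_le_compat_l; first by have := @pow_le (4 / 7) j ltac:(lra); lra.
  rewrite npowE //; case: (Req_dec (ln (INR n)) c) => [->|ne]; first lra.
  by apply: Rlt_le; apply: exp_increasing; lra.
apply: Rle_trans (ln_succ_le n0); apply: Rabs_le; lra.
Qed.

Lemma tcoef_lip j n : (0 < n)%N ->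
  Rabs (tcoef j n.+1 - tcoef j n) <= 4 * (4 / 7) ^ j * npow n (-1 - 1 / 4).
Proof.
move=> n0; rewrite !tcoefE //; have := ln_le_succ n0.
by move=> h; apply: tfun_lip => //; lra.
Qed.

(** [tprim j (ln u)] has derivative [tfun j (ln u)] in [u]: it is the integral of [tcoef j], running
    from [-1] at [u = 1] to [0] at infinity. *)
Definition tprim (j : nat) (x : R) : R := - (exp (- x) * \rs_(i < j.+1) expterm i x).

Lemma derivable_rsum (N : nat) (F : nat -> R -> R) (F' : nat -> R) x :
  (forall i, derivable_pt_lim (F i) x (F' i)) ->
  derivable_pt_lim (fun x => \rs_(i < N) F i x) x (\rs_(i < N) F' i).
Proof.
move=> H; elim: N => [|N IH].
  rewrite big_ord0; apply: (derivable_pt_lim_ext (fun=> 0)); first by move=> y; rewrite big_ord0.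
  exact: derivable_pt_lim_const.
rewrite big_ord_recr /=.
apply: (derivable_pt_lim_ext (fun x => \rs_(i < N) F i x + F N x)).
  by move=> y; rewrite big_ord_recr.
exact: derivable_pt_lim_plus.
Qed.

Lemma derivable_tprim j x : derivable_pt_lim (tprim j) x (exp (- x) * expterm j x).
Proof.
rewrite /tprim.
have A := @derivable_rsum j.+1 expterm (fun i => if i is i'.+1 then expterm i' x else 0) x
  (fun i => derivable_expterm i x).
have B : derivable_pt_lim (fun x => exp (- x)) x (- exp (- x)).
  by apply/is_derive_Reals; auto_derive => //; ring.
have := derivable_pt_lim_opp _ _ _ (derivable_pt_lim_mult _ _ _ _ _ B A).
set d := (- _); suff -> : d = exp (- x) * expterm j x by [].
have -> : d = - (- exp (- x) * (\rs_(i < j) expterm i x + expterm j x)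
    + exp (- x) * (0 + \rs_(i < j) expterm i x)).
  by rewrite /d; congr (- (_ * _ + _ * _)); [rewrite big_ord_recr | rewrite big_ord_recl].
by ring.
Qed.

Lemma tprim_step j n : (0 < n)%N ->
  Rabs (tcoef j n - (tprim j (ln (INR n.+1)) - tprim j (ln (INR n))))
  <= 4 * (4 / 7) ^ j * npow n (-1 - 1 / 4).
Proof.
move=> n0; have n0' : 0 < INR n by apply: lt_0_INR; apply/ltP.
have nS : INR n < INR n.+1 by rewrite S_INR; lra.
have [|c [-> hc]] := @MVT_cor2 (fun u => tprim j (ln u)) (fun u => tfun j (ln u)) (INR n) (INR n.+1) nS.
  move=> c hc; have c0 : 0 < c by lra.
  have := derivable_pt_lim_comp _ _ _ _ _ (derivable_pt_lim_ln c c0) (derivable_tprim j (ln c)).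
  suff -> : exp (- ln c) * expterm j (ln c) * / c = tfun j (ln c) by [].
  rewrite /tfun.
  have -> : -2 * ln c = - ln c + - ln c by ring.
  by rewrite exp_plus exp_Ropp exp_ln //; ring.
rewrite tcoefE //; have -> : INR n.+1 - INR n = 1 by rewrite S_INR; ring.
rewrite Rmult_1_r; apply: tfun_lip => //; have := ln_le_succ n0; first lra.
by move=> _; split; apply: ln_le; lra.
Qed.

End RealEstimates.

(** * Limits of complex sequences, geometric tails, dominated convergence *)

Section ComplexLimits.

Lemma Ccv_add (u v : nat -> C) (a b : C) : Ccv u a -> Ccv v b -> Ccv (fun n => u n + v n)%C (a + b)%C.
Proof.
move=> Ha Hb eps e0.
have [N HN] := Ha (eps / 2) ltac:(lra); have [M HM] := Hb (eps / 2) ltac:(lra).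
exists (Nat.max N M) => n hn; have := HN n ltac:(lia); have := HM n ltac:(lia).
have := Cmod_triangle (u n - a)%C (v n - b)%C.
have -> : (u n - a + (v n - b) = u n + v n - (a + b))%C by ring.
lra.
Qed.

Lemma Ccv_scal c (u : nat -> C) (a : C) : Ccv u a -> Ccv (fun n => c * u n)%C (c * a)%C.
Proof.
move=> Ha eps e0; have cp : 0 < Cmod c + 1 by have := Cmod_ge_0 c; lra.
have [N HN] := Ha (eps / (Cmod c + 1)) (Rdiv_lt_0_compat _ _ e0 cp).
exists N => n hn; have := HN n hn.
have -> : (c * u n - c * a = c * (u n - a))%C by ring.
rewrite Cmod_mult => h.
apply: Rle_lt_trans (_ : (Cmod c + 1) * Cmod (u n - a)%C < _).
  by have := Cmod_ge_0 (u n - a)%C; nra.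
have -> : eps = (Cmod c + 1) * (eps / (Cmod c + 1)) by field; lra.
exact: Rmult_lt_compat_l.
Qed.

Lemma Ccv_const c : Ccv (fun=> c) c.
Proof.
by move=> eps e0; exists 0%N => n _; have -> : (c - c = 0)%C; [ring | rewrite Cmod_0].
Qed.

Lemma Ccv_sum (I : Type) (r : seq I) (u : I -> nat -> C) (l : I -> C) :
  (forall i, Ccv (u i) (l i)) -> Ccv (fun n => \cs_(i <- r) u i n) (\cs_(i <- r) l i).
Proof.
move=> H; elim: r => [|i r IH].
  by rewrite big_nil; apply: Ccv_ext (Ccv_const _) => n; rewrite big_nil.
by rewrite big_cons; apply: Ccv_ext (Ccv_add (H i) IH) => n; rewrite big_cons.
Qed.

Lemma Ccv_bound (u : nat -> C) l M : Ccv u l -> (forall n, Cmod (u n) <= M) -> Cmod l <= M.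
Proof.
move=> H HM; apply: le_epsilon => eps e0; have [N HN] := H eps e0.
have := HN N (le_n N); have := HM N.
have := Cmod_triangle (u N) (- (u N - l))%C; rewrite Cmod_opp.
have -> : (u N + - (u N - l) = l)%C by ring.
lra.
Qed.

Lemma Ccv_shift (u : nat -> C) l : Ccv (fun n => u n.+1) l -> Ccv u l.
Proof.
move=> H eps e0; have [N HN] := H eps e0; exists N.+1 => -[|n] hn; first lia.
by apply: HN; lia.
Qed.

Lemma Ccv_shiftS (u : nat -> C) l : Ccv u l -> Ccv (fun n => u n.+1) l.
Proof. by move=> H eps e0; have [N HN] := H eps e0; exists N => n hn; apply: HN; lia. Qed.

Lemma geo_sum_le r J N : 0 <= r < 1 -> \big[Rplus/0]_(J <= j < N) r ^ j <= r ^ J / (1 - r).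
Proof.
move=> hr.
have H n : \big[Rplus/0]_(J <= j < J + n) r ^ j = (r ^ J - r ^ (J + n)%N) / (1 - r).
  elim: n => [|n IH]; first by rewrite addn0 big_geq //; field; lra.
  rewrite addnS big_nat_recr ?leq_addr //= IH; field; lra.
have q : 0 <= / (1 - r) by apply: Rlt_le; apply: Rinv_0_lt_compat; lra.
have p k : 0 <= r ^ k by apply: pow_le; lra.
case: (leqP J N) => JN.
  rewrite -(subnKC JN) H /Rdiv; apply: Rmult_le_compat_r => //; have := p (J + (N - J))%N; lra.
rewrite big_geq; first by apply: Rmult_le_pos.
exact: ltnW.
Qed.

Lemma geo_summ (c : nat -> C) K r : 0 <= r < 1 -> (forall j, Cmod (c j) <= K * r ^ j) ->
  summ_by c (K / (1 - r)).
Proof.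
move=> hr H.
have K0 : 0 <= K by have := H 0%N; have := Cmod_ge_0 (c 0%N); rewrite /=; lra.
apply: summ_nat => N; apply: Rle_trans (_ : \rs_(j < N) (K * r ^ j) <= _).
  by apply: rsum_le => j; apply: H.
rewrite -big_distrr /=; apply: Rmult_le_compat_l => //.
have := @geo_sum_le r 0 N hr; rewrite big_mkord /= /Rdiv Rmult_1_l.
by [].
Qed.

Lemma geo_tail (c : nat -> C) K r J : 0 <= r < 1 -> (forall j, Cmod (c j) <= K * r ^ j) ->
  Cmod (tot c - \cs_(j < J) c j)%C <= K * r ^ J / (1 - r).
Proof.
move=> hr H.
have K0 : 0 <= K by have := H 0%N; have := Cmod_ge_0 (c 0%N); rewrite /=; lra.
have S : summ c by exists (K / (1 - r)); apply: geo_summ.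
have L := Ccv_add (usum_Ccv (totP S)) (Ccv_const (- (\cs_(j < J) c j))%C).
have T N : Cmod (\cs_(j < J + N) c j + - (\cs_(j < J) c j))%C <= K * r ^ J / (1 - r).
  rewrite -!(big_mkord xpredT c) (@big_cat_nat _ _ _ J) ?leq_addr //=.
  set x := bigop _ _ _; set y := bigop _ _ _.
  have -> : (x + y + - x = y)%C by ring.
  apply: Rle_trans (Cmod_csum _ _ _) _.
  apply: Rle_trans (_ : \big[Rplus/0]_(J <= j < J + N) (K * r ^ j) <= _).
    by apply: rsum_le => j; apply: H.
  rewrite -big_distrr /= /Rdiv Rmult_assoc; apply: Rmult_le_compat_l => //.
  exact: geo_sum_le.
apply: (@Ccv_bound (fun N => \cs_(j < J + N) c j + - (\cs_(j < J) c j))%C) => //.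
move=> eps e0; have [N HN] := L eps e0; exists N => n hn.
by apply: HN; rewrite -plusE; lia.
Qed.

Lemma pow_small r K eps : 0 <= r < 1 -> 0 < eps -> exists J, K * r ^ J < eps.
Proof.
move=> hr e0.
case: (Rle_lt_dec K 0) => K0.
  by exists 0%N; rewrite /=; lra.
have [N HN] := pow_lt_1_zero r ltac:(by rewrite Rabs_pos_eq; lra) (eps / K) (Rdiv_lt_0_compat _ _ e0 K0).
exists N; have := HN N (le_n N); rewrite Rabs_pos_eq; last by apply: pow_le; lra.
move=> h; have := Rmult_lt_compat_l K _ _ K0 h.
by have -> : K * (eps / K) = eps by field; lra.
Qed.

(** Under the common majorant [K * r ^ j] the tails beyond [J] are uniformly small, while the first
    [J] terms converge. *)
Lemma tannery (u : nat -> nat -> C) (c : nat -> C) K r : 0 <= r < 1 ->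
  (forall N j, Cmod (u N j) <= K * r ^ j) -> (forall j, Ccv (fun N => u N j) (c j)) ->
  Ccv (fun N => tot (u N)) (tot c).
Proof.
move=> hr Hu Hc eps e0.
have Hb j : Cmod (c j) <= K * r ^ j by apply: Ccv_bound (Hc j) _.
have q : 0 < / (1 - r) by apply: Rinv_0_lt_compat; lra.
have [J HJ] := @pow_small r (K / (1 - r)) (eps / 4) hr ltac:(lra).
have [N HN] := @Ccv_sum _ (index_enum 'I_J) (fun j N => u N j) c (fun j => Hc j) (eps / 4) ltac:(lra).
exists N => n hn; have := HN n hn => /=; have := geo_tail J hr Hb; have := geo_tail J hr (Hu n).
have -> : K * r ^ J / (1 - r) = K / (1 - r) * r ^ J by field; lra.
set x := (\big[_/_]_(_ < _) _); set y := (\big[_/_]_(_ < _) _) => h1 h2 h3.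
have -> : (tot (u n) - tot c = (tot (u n) - x) + (x - y) - (tot c - y))%C by ring.
have := Cmod_triangle (tot (u n) - x + (x - y))%C (- (tot c - y))%C; rewrite Cmod_opp.
have := Cmod_triangle (tot (u n) - x)%C (x - y)%C.
rewrite /Cminus in h1 h2 h3 *; lra.
Qed.

End ComplexLimits.

(** * The exponential series of a complex number *)

Section ComplexExponential.

Definition cexp (z : C) : C := (exp (Re z) * cos (Im z), exp (Re z) * sin (Im z)).

Lemma expterm_S0 i : expterm i.+1 0 = 0.
Proof. by rewrite /expterm -[0 ^ i.+1]/(0 * 0 ^ i) !Rmult_0_l /Rdiv Rmult_0_l. Qed.

Lemma Cpow_S (z : C) n : (z ^ n.+1 = z * z ^ n)%C. Proof. by []. Qed.

(** With [w = x + iy] and [P(t)] the partial sum of [e^(wt)], the function [e^(-wt) P(t)] is [1] at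
    [t = 0] and has derivative [- e^(-wt) w^(J+1) t^J / J!]. The mean value theorem on [[0, 1]], for
    real and imaginary part separately, bounds its distance from [1] at [t = 1]. *)
Lemma exp_taylor_bound (x y : R) J :
  Cmod (\cs_(j < J.+1) ((x, y) ^ j * RtoC (/ INR (fact j))) - cexp (x, y))%C
  <= 4 * (exp (2 * Rabs x) * (Rabs x + Rabs y) * (Cmod (x, y) ^ J / INR (fact J))).
Proof.
pose w : C := (x, y).
pose p t := \rs_(j < J.+1) (Re (w ^ j)%C * expterm j t).
pose q t := \rs_(j < J.+1) (Im (w ^ j)%C * expterm j t).
pose dp := Re (w ^ J)%C; pose dq := Im (w ^ J)%C.
have Dp t : derivable_pt_lim p t (x * (p t - dp * expterm J t) - y * (q t - dq * expterm J t)).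
  have := @derivable_rsum J.+1 (fun j t => Re (w ^ j)%C * expterm j t) _ t
    (fun j => derivable_pt_lim_scal _ _ _ _ (derivable_expterm j t)).
  set D := bigop _ _ _; suff -> : D = x * (p t - dp * expterm J t) - y * (q t - dq * expterm J t) by [].
  have -> : p t - dp * expterm J t = \rs_(j < J) (Re (w ^ j)%C * expterm j t).
    by rewrite /p big_ord_recr /= -/dp; ring.
  have -> : q t - dq * expterm J t = \rs_(j < J) (Im (w ^ j)%C * expterm j t).
    by rewrite /q big_ord_recr /= -/dq; ring.
  rewrite /D big_ord_recl /= Rmult_0_r Rplus_0_l !big_distrr /= -rsum_minus.
  by apply: eq_bigr => i _; rewrite /= /bump add0n /Re /Im /=; ring.
have Dq t : derivable_pt_lim q t (x * (q t - dq * expterm J t) + y * (p t - dp * expterm J t)).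
  have := @derivable_rsum J.+1 (fun j t => Im (w ^ j)%C * expterm j t) _ t
    (fun j => derivable_pt_lim_scal _ _ _ _ (derivable_expterm j t)).
  set D := bigop _ _ _; suff -> : D = x * (q t - dq * expterm J t) + y * (p t - dp * expterm J t) by [].
  have -> : p t - dp * expterm J t = \rs_(j < J) (Re (w ^ j)%C * expterm j t).
    by rewrite /p big_ord_recr /= -/dp; ring.
  have -> : q t - dq * expterm J t = \rs_(j < J) (Im (w ^ j)%C * expterm j t).
    by rewrite /q big_ord_recr /= -/dq; ring.
  rewrite /D big_ord_recl /= Rmult_0_r Rplus_0_l !big_distrr /= -big_split /=.
  by apply: eq_bigr => i _; rewrite /= /bump add0n /Re /Im /=; ring.
pose K := exp (Rabs x) * (2 * (Rabs x + Rabs y) * (Cmod w ^ J / INR (fact J))).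
have dpB : Rabs dp <= Cmod w ^ J by apply: Rle_trans (re_le_Cmod _) _; rewrite Cmod_pow; lra.
have dqB : Rabs dq <= Cmod w ^ J by apply: Rle_trans (im_le_Cmod _) _; rewrite Cmod_pow; lra.
have bound t s1 s2 : 0 <= t <= 1 -> Rabs s1 <= 1 -> Rabs s2 <= 1 ->
  Rabs (exp (- x * t) * (expterm J t * (s1 * (- x * dp + y * dq) + s2 * (- x * dq - y * dp)))) <= K.
  move=> ht h1 h2; rewrite Rabs_mult (Rabs_mult (expterm J t)) /K; apply: Rmult_le_compat; try exact: Rabs_pos.
  - by apply: Rmult_le_pos; apply: Rabs_pos.
  - rewrite Rabs_pos_eq; last exact: Rlt_le (exp_pos _).
    have h : - x * t <= Rabs x.
      by have := Rle_abs (- x); rewrite Rabs_Ropp; have := Rabs_pos x; nra.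
    by case: (Req_dec (- x * t) (Rabs x)) => [->|ne]; [lra | apply: Rlt_le; apply: exp_increasing; lra].
  have tJ : Rabs (expterm J t) <= / INR (fact J).
    rewrite Rabs_pos_eq; last by apply: expterm_ge0; lra.
    rewrite /expterm -[X in _ <= X]Rmult_1_l; apply: Rmult_le_compat_r.
      by apply: Rlt_le; apply: Rinv_0_lt_compat; apply: INR_fact_lt_0.
    by rewrite -(pow1 J); apply: pow_incr.
  have part (a b s : R) : Rabs a <= Cmod w ^ J -> Rabs b <= Cmod w ^ J -> Rabs s <= 1 ->
      Rabs (s * (- x * a + y * b)) <= (Rabs x + Rabs y) * Cmod w ^ J.
    move=> ha hb hs; rewrite Rabs_mult.
    have := Rabs_triang (- x * a) (y * b); rewrite !Rabs_mult Rabs_Ropp => h.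
    have := Rabs_pos x; have := Rabs_pos y; have := Rabs_pos s; have := Rabs_pos (- x * a + y * b).
    have := Rmult_le_compat_l _ _ _ (Rabs_pos x) ha; have := Rmult_le_compat_l _ _ _ (Rabs_pos y) hb.
    nra.
  have A := part dp dq s1 dpB dqB h1.
  have B := part dq (- dp) s2 dqB ltac:(by rewrite Rabs_Ropp) h2.
  have := Rabs_triang (s1 * (- x * dp + y * dq)) (s2 * (- x * dq + y * - dp)).
  have -> : - x * dq + y * - dp = - x * dq - y * dp by ring.
  move=> C.
  have -> : 2 * (Rabs x + Rabs y) * (Cmod w ^ J / INR (fact J))
     = / INR (fact J) * (2 * ((Rabs x + Rabs y) * Cmod w ^ J)) by rewrite /Rdiv; ring.
  apply: Rmult_le_compat => //; try exact: Rabs_pos.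
  move: B; have -> : - x * dq + y * - dp = - x * dq - y * dp by ring.
  lra.
(* [f1] and [f2] are the real and imaginary parts of [e^(-wt) P(t)]. *)
pose f1 t := exp (- x * t) * (cos (y * t) * p t + sin (y * t) * q t).
pose f2 t := exp (- x * t) * (cos (y * t) * q t - sin (y * t) * p t).
have De t : derivable_pt_lim (fun t => exp (- x * t)) t (- x * exp (- x * t)).
  by apply/is_derive_Reals; auto_derive => //; ring.
have Dc t : derivable_pt_lim (fun t => cos (y * t)) t (- y * sin (y * t)).
  by apply/is_derive_Reals; auto_derive => //; ring.
have Ds t : derivable_pt_lim (fun t => sin (y * t)) t (y * cos (y * t)).
  by apply/is_derive_Reals; auto_derive => //; ring.
have [t1 [E1 ht1]] := @MVT_abs f1 _ 0 1 (fun t _ =>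
  derivable_pt_lim_mult _ _ _ _ _ (De t) (derivable_pt_lim_plus _ _ _ _ _
    (derivable_pt_lim_mult _ _ _ _ _ (Dc t) (Dp t)) (derivable_pt_lim_mult _ _ _ _ _ (Ds t) (Dq t)))).
have [t2 [E2 ht2]] := @MVT_abs f2 _ 0 1 (fun t _ =>
  derivable_pt_lim_mult _ _ _ _ _ (De t) (derivable_pt_lim_minus _ _ _ _ _
    (derivable_pt_lim_mult _ _ _ _ _ (Dc t) (Dq t)) (derivable_pt_lim_mult _ _ _ _ _ (Ds t) (Dp t)))).
rewrite Rmin_left ?Rmax_right in ht1 ht2; try lra.
have R10 : Rabs (1 - 0) = 1 by rewrite Rminus_0_r Rabs_R1.
rewrite R10 in E1 E2.
have B1 : Rabs (f1 1 - f1 0) <= K.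
  have := bound t1 (cos (y * t1)) (sin (y * t1)) ht1 (Rabs_le _ _ (COS_bound _)) (Rabs_le _ _ (SIN_bound _)).
  by apply: Rle_trans; rewrite E1 Rmult_1_r; right; congr Rabs; rewrite /mult_fct /plus_fct; ring.
have B2 : Rabs (f2 1 - f2 0) <= K.
  have h := Rabs_le _ _ (SIN_bound (y * t2)); rewrite -Rabs_Ropp in h.
  have := bound t2 (- sin (y * t2)) (cos (y * t2)) ht2 h (Rabs_le _ _ (COS_bound _)).
  by apply: Rle_trans; rewrite E2 Rmult_1_r; right; congr Rabs; rewrite /mult_fct /minus_fct; ring.
have p0 : p 0 = 1.
  rewrite /p big_ord_recl big1 => [|i _]; last by rewrite lift0 expterm_S0 Rmult_0_r.
  by rewrite /expterm /=; field.
have q0 : q 0 = 0.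
  rewrite /q big_ord_recl big1 => [|i _]; last by rewrite lift0 expterm_S0 Rmult_0_r.
  by rewrite /expterm /=; field.
have F10 : f1 0 = 1 by rewrite /f1 p0 q0 !Rmult_0_r exp_0 cos_0; ring.
have F20 : f2 0 = 0 by rewrite /f2 p0 q0 !Rmult_0_r exp_0 sin_0; ring.
rewrite F10 in B1; rewrite F20 in B2.
have -> : \cs_(j < J.+1) ((x, y) ^ j * RtoC (/ INR (fact j)))%C = (p 1, q 1).
  have eta (z : C) : z = (Re z, Im z) by case: z.
  rewrite [LHS]eta Re_csum Im_csum; congr pair;
  by apply: eq_bigr => i _; rewrite /expterm pow1 /w /Re /Im /=; field; exact: INR_fact_neq_0.
pose D : C := (f1 1 - 1, f2 1); 
have -> : ((p 1, q 1) - cexp (x, y) = cexp (x, y) * D)%C.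
  have e1 : exp x * exp (- x) = 1 by rewrite -exp_plus Rplus_opp_r exp_0.
  have cs := sin2_cos2 y; rewrite /Rsqr in cs.
  apply: injective_projections; rewrite /D /f1 /f2 /cexp /= !Rmult_1_r.
    transitivity (exp x * exp (- x) * (sin y * sin y + cos y * cos y) * p 1 - exp x * cos y); last ring.
    by rewrite e1 cs; ring.
  transitivity (exp x * exp (- x) * (sin y * sin y + cos y * cos y) * q 1 - exp x * sin y); last ring.
  by rewrite e1 cs; ring.
rewrite Cmod_mult.
have ce : Cmod (cexp (x, y)) <= exp (Rabs x).
  rewrite /cexp /Cmod /=.
  have -> : exp x * cos y * (exp x * cos y * 1) + exp x * sin y * (exp x * sin y * 1)
     = Rsqr (exp x) * (Rsqr (sin y) + Rsqr (cos y)) by rewrite /Rsqr; ring.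
  rewrite sin2_cos2 Rmult_1_r sqrt_Rsqr; last exact: Rlt_le (exp_pos _).
  case: (Req_dec x (Rabs x)) => [<-|ne]; first lra.
  by apply: Rlt_le; apply: exp_increasing; have := Rle_abs x; lra.
have cf : Cmod D <= 2 * K.
  have -> : D = (RtoC (f1 1 - 1) + Ci * RtoC (f2 1))%C.
    by apply: injective_projections => /=; ring.
  have := Cmod_triangle (RtoC (f1 1 - 1)) (Ci * RtoC (f2 1))%C.
  rewrite Cmod_mult Cmod_Ci !Cmod_R Rmult_1_l.
  by rewrite Rminus_0_r in B2; lra.
apply: Rle_trans (_ : exp (Rabs x) * (2 * K) <= _).
  by apply: Rmult_le_compat => //; apply: Cmod_ge_0.
rewrite /K; have -> : exp (2 * Rabs x) = exp (Rabs x) * exp (Rabs x) by rewrite -exp_plus; congr exp; ring.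
rewrite -/w; right; ring.
Qed.

Lemma cexp_series (z : C) :
  Ccv (fun J => \cs_(j < J) (z ^ j * RtoC (/ INR (fact j)))%C) (cexp z).
Proof.
case: z => x y; apply: Ccv_shift => eps e0.
pose K := 4 * (exp (2 * Rabs x) * (Rabs x + Rabs y)).
have K0 : 0 <= K.
  have := exp_pos (2 * Rabs x); have := Rabs_pos x; have := Rabs_pos y; rewrite /K => *.
  by apply: Rmult_le_pos; [lra | apply: Rmult_le_pos; lra].
have q : 0 < eps / (K + 1) by apply: Rdiv_lt_0_compat; lra.
have [N HN] := cv_speed_pow_fact (Cmod (x, y)) (eps / (K + 1)) q.
exists N => n hn; apply: Rle_lt_trans (exp_taylor_bound x y n) _.
have := HN n hn; rewrite /Rdist Rminus_0_r => h.
have {}h := Rle_lt_trans _ _ _ (Rle_abs _) h.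
set u := _ / _ in h *.
have u0 : 0 <= u.
  apply: Rmult_le_pos; first by apply: pow_le; apply: Cmod_ge_0.
  by apply: Rlt_le; apply: Rinv_0_lt_compat; apply: INR_fact_lt_0.
have -> : 4 * (exp (2 * Rabs x) * (Rabs x + Rabs y) * u) = K * u by rewrite /K; ring.
apply: Rle_lt_trans (_ : (K + 1) * u < _); first nra.
have -> : eps = (K + 1) * (eps / (K + 1)) by field; lra.
by apply: Rmult_lt_compat_l => //; lra.
Qed.

End ComplexExponential.

(** * Abel summation: decay of the Taylor coefficients and convergence of the Dirichlet series *)

Section TaylorCoefficients.

Lemma tcoef_at0 j : tcoef j 0 = 0. Proof. exact: Rmult_0_l. Qed.

Definition psum_le (a : nat -> C) (B : R) : Prop := forall N, Cmod (\cs_(n < N) a n) <= B.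

Lemma abel_summation (a w : nat -> C) N :
  \cs_(n < N.+1) (a n * w n)%C =
  ((\cs_(n < N.+1) a n) * w N - \cs_(n < N) ((\cs_(m < n.+1) a m) * (w n.+1 - w n)))%C.
Proof.
elim: N => [|N IH]; first by rewrite !big_ord_recr !big_ord0 /=; ring.
rewrite big_ord_recr IH [in RHS]big_ord_recr [\big[_/_]_(n < N.+1) ((\cs_(m < n.+1) a m) * _)%C]big_ord_recr /=.
ring.
Qed.

(** After summation by parts both terms are at most [B * V]; in the boundary term, [w 0 = 0] bounds
    [w N] by the variation. *)
Lemma abel_bound (a w : nat -> C) B V N : psum_le a B -> w 0%N = RtoC 0 ->
  (forall N, \rs_(n < N) Cmod (w n.+1 - w n)%C <= V) ->
  Cmod (\cs_(n < N) (a n * w n)%C) <= 2 * B * V.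
Proof.
move=> HB w0 HV.
have B0 : 0 <= B by have := HB 0%N; rewrite big_ord0 Cmod_0.
have V0 : 0 <= V by have := HV 0%N; rewrite big_ord0.
case: N => [|N]; first by rewrite big_ord0 Cmod_0; apply: Rmult_le_pos; lra.
have wN : Cmod (w N) <= V.
  apply: Rle_trans (HV N).
  have -> : w N = \cs_(n < N) (w n.+1 - w n)%C.
    elim: N => [|N IH]; first by rewrite big_ord0.
    by rewrite big_ord_recr /= -IH; ring.
  exact: Cmod_csum.
rewrite abel_summation; set x := (\big[_/_]_(_ < _) _); set y := (\big[_/_]_(_ < _) _).
have hx : Cmod (x * w N)%C <= B * V.
  by rewrite Cmod_mult; apply: Rmult_le_compat; try exact: Cmod_ge_0; [apply: HB | ].
have hy : Cmod y <= B * V.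
  apply: Rle_trans (Cmod_csum _ _ _) _.
  apply: Rle_trans (_ : \rs_(n < N) (B * Cmod (w n.+1 - w n)%C) <= _).
    apply: rsum_le => n; rewrite Cmod_mult; apply: Rmult_le_compat_r; first exact: Cmod_ge_0.
    exact: HB.
  by rewrite -big_distrr /=; apply: Rmult_le_compat_l B0 _; exact: HV.
have := Cmod_triangle (x * w N)%C (- y)%C; rewrite Cmod_opp /Cminus; lra.
Qed.

(* [n^(-it)]. *)
Definition twist (t : R) (n : nat) : C := (cos (t * ln (INR n)), - sin (t * ln (INR n))).

Lemma Cmod_twist t n : Cmod (twist t n) = 1.
Proof.
rewrite /twist /Cmod /=.
have -> : cos (t * ln (INR n)) * (cos (t * ln (INR n)) * 1) +
   - sin (t * ln (INR n)) * (- sin (t * ln (INR n)) * 1)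
   = Rsqr (sin (t * ln (INR n))) + Rsqr (cos (t * ln (INR n))) by rewrite /Rsqr; ring.
by rewrite sin2_cos2 sqrt_1.
Qed.

Lemma twist0 n : twist 0 n = RtoC 1.
Proof. by rewrite /twist Rmult_0_l cos_0 sin_0; apply: injective_projections => /=; ring. Qed.

Lemma Cmod_le_ReIm (z : C) : Cmod z <= Rabs (Re z) + Rabs (Im z).
Proof.
have E : z = (RtoC (Re z) + Ci * RtoC (Im z))%C.
  by case: z => x y; apply: injective_projections => /=; ring.
rewrite [X in Cmod X]E; apply: Rle_trans (Cmod_triangle _ _) _.
by rewrite Cmod_mult Cmod_Ci !Cmod_R Rmult_1_l; apply: Rle_refl.
Qed.

Lemma cos_lip x y : Rabs (cos x - cos y) <= Rabs (x - y).
Proof.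
have [c [-> _]] := @MVT_abs cos _ y x (fun c _ => derivable_pt_lim_cos c).
rewrite Rabs_Ropp -[X in _ <= X]Rmult_1_l; apply: Rmult_le_compat_r; first exact: Rabs_pos.
by apply: Rabs_le; exact: SIN_bound.
Qed.

Lemma sin_lip x y : Rabs (sin x - sin y) <= Rabs (x - y).
Proof.
have [c [-> _]] := @MVT_abs sin _ y x (fun c _ => derivable_pt_lim_sin c).
rewrite -[X in _ <= X]Rmult_1_l; apply: Rmult_le_compat_r; first exact: Rabs_pos.
by apply: Rabs_le; exact: COS_bound.
Qed.

Lemma twist_lip t n : (0 < n)%N -> Cmod (twist t n.+1 - twist t n)%C <= 2 * Rabs t * npow n (-1).
Proof.
move=> n0; apply: Rle_trans (Cmod_le_ReIm _) _.
pose x := t * ln (INR n.+1); pose y := t * ln (INR n).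
have -> : Re (twist t n.+1 - twist t n)%C = cos x - cos y by [].
have -> : Im (twist t n.+1 - twist t n)%C = - (sin x - sin y).
  by change (- sin x + - - sin y = - (sin x - sin y)); ring.
have A := cos_lip x y; have B := sin_lip x y.
have E : Rabs (x - y) <= Rabs t * npow n (-1).
  have -> : x - y = t * (ln (INR n.+1) - ln (INR n)) by rewrite /x /y; ring.
  rewrite Rabs_mult; apply: Rmult_le_compat_l; first exact: Rabs_pos.
  by rewrite Rabs_pos_eq; [exact: ln_succ_le | have := ln_le_succ n0; lra].
by rewrite Rabs_Ropp; lra.
Qed.

(** In units of [(4/7)^j]: [1] is the jump from [n = 0] to [n = 1], [4] and [2 |t|] are the
    variations of [tcoef] and of the twist, and [5] bounds the sum of [n^(-5/4)]. *)
Definition twist_const (t : R) : R := 1 + 5 * (4 + 2 * Rabs t).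

Lemma weight_variation t j N :
  \rs_(n < N) Cmod (twist t n.+1 * RtoC (tcoef j n.+1) - twist t n * RtoC (tcoef j n))%C
  <= twist_const t * (4 / 7) ^ j.
Proof.
have r0 : 0 <= (4 / 7) ^ j by apply: pow_le; lra.
have t0 := Rabs_pos t.
have step n : (0 < n)%N ->
   Cmod (twist t n.+1 * RtoC (tcoef j n.+1) - twist t n * RtoC (tcoef j n))%C
   <= (4 + 2 * Rabs t) * (4 / 7) ^ j * npow n (-1 - 1 / 4).
  move=> n0.
  have -> : (twist t n.+1 * RtoC (tcoef j n.+1) - twist t n * RtoC (tcoef j n) =
    twist t n.+1 * RtoC (tcoef j n.+1 - tcoef j n) + (twist t n.+1 - twist t n) * RtoC (tcoef j n))%C.
    by rewrite RtoC_minus; ring.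
  apply: Rle_trans (Cmod_triangle _ _) _; rewrite !Cmod_mult !Cmod_R Cmod_twist Rmult_1_l.
  have A := tcoef_lip j n0.
  have B := twist_lip t n0.
  have D := @tcoef_le j n (7 / 4) ltac:(lra).
  rewrite (Rabs_pos_eq (tcoef j n)); last exact: tcoef_ge0.
  have -> : -1 - 1 / 4 = -1 + (7 / 4 - 2) by field.
  have E : / (7 / 4) = 4 / 7 by field.
  have F := Rmult_le_compat _ _ _ _ (Cmod_ge_0 _) (tcoef_ge0 j n) B D.
  rewrite E in F; move: A; have -> : -1 - 1 / 4 = -1 + (7 / 4 - 2) by field.
  rewrite npow_add; lra.
have c0 : 0 <= (4 + 2 * Rabs t) * (4 / 7) ^ j by apply: Rmult_le_pos; lra.
have first : Cmod (twist t 1 * RtoC (tcoef j 1) - twist t 0 * RtoC (tcoef j 0))%C <= (4 / 7) ^ j.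
  rewrite tcoef_at0.
  have -> : (twist t 1 * RtoC (tcoef j 1) - twist t 0 * 0 = twist t 1 * RtoC (tcoef j 1))%C by ring.
  rewrite Cmod_mult Cmod_R Cmod_twist Rmult_1_l Rabs_pos_eq; last exact: tcoef_ge0.
  have := @tcoef_le j 1 (7 / 4) ltac:(lra).
  rewrite [npow 1 _]/= ln_1 Rmult_0_r exp_0.
  have -> : / (7 / 4) = 4 / 7 by field.
  lra.
case: N => [|N].
  by rewrite big_ord0 /twist_const; apply: Rmult_le_pos; lra.
rewrite big_ord_recl /=.
apply: Rle_trans (_ : (4 / 7) ^ j + (4 + 2 * Rabs t) * (4 / 7) ^ j * 5 <= _); last first.
  by rewrite /twist_const; lra.
apply: Rplus_le_compat => //.
apply: Rle_trans (_ : \rs_(i < N.+1) ((4 + 2 * Rabs t) * (4 / 7) ^ j * npow i (-1 - 1 / 4)) <= _).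
  rewrite big_ord_recl /= Rmult_0_r Rplus_0_l; apply: rsum_le => i.
  by rewrite /bump add1n; apply: step.
rewrite -big_distrr /=; apply: Rmult_le_compat_l => //.
by have := @npow_sum_le (1 / 4) N.+1 ltac:(lra); have -> : / (1 / 4) = 4 by field; lra.
Qed.

Definition twisted (a : nat -> C) (t : R) (n : nat) : C := (a n * twist t n)%C.

Lemma adm_bounded (c A : R) (a : nat -> C) : c < 1 -> (forall n, Cmod (a n) <= A) -> adm c a.
Proof.
by move=> c1 HA; apply: summ_bdd_mul HA _; apply: summ_npow; lra.
Qed.

Lemma Cmod_twisted a t n : Cmod (twisted a t n) = Cmod (a n).
Proof. by rewrite /twisted Cmod_mult Cmod_twist Rmult_1_r. Qed.

Lemma adm_twisted c A a t : c < 1 -> (forall n, Cmod (a n) <= A) -> adm c (twisted a t).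
Proof. by move=> c1 HA; apply: (adm_bounded c1 (A := A)) => n; rewrite Cmod_twisted. Qed.

Lemma dtaylor_partial_bound a B t j N : psum_le a B ->
  Cmod (\cs_(n < N) (twisted a t n * RtoC (tcoef j n)))%C <= 2 * B * twist_const t * (4 / 7) ^ j.
Proof.
move=> HB; rewrite Rmult_assoc.
have -> : \cs_(n < N) (twisted a t n * RtoC (tcoef j n))%C
   = \cs_(n < N) (a n * (twist t n * RtoC (tcoef j n)))%C.
  by apply: eq_bigr => n _; rewrite /twisted; ring.
apply: (@abel_bound a (fun n => twist t n * RtoC (tcoef j n))%C B _ N HB) => [|M].
  by rewrite tcoef_at0 Cmult_0_r.
exact: weight_variation.
Qed.

Lemma dtaylor_cv c a j : 0 < c -> adm c a ->
  Ccv (fun N => \cs_(n < N) (a n * RtoC (tcoef j n))%C) (dtaylor a j).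
Proof. by move=> c0 H; exact: (usum_Ccv (totP (summ_tcoef j c0 H))). Qed.

(** Bounded [a n] alone would give only [c^(-j)] with [c < 1]; bounded partial sums improve this to
    [(4/7)^j], which amounts to a continuation to the disc of radius [7/4] about [2 + it]. *)
Lemma dtaylor_twisted_bound a A B t j : (forall n, Cmod (a n) <= A) -> psum_le a B ->
  Cmod (dtaylor (twisted a t) j) <= 2 * B * twist_const t * (4 / 7) ^ j.
Proof.
move=> HA HB; have h := @adm_twisted (1 / 2) A a t ltac:(lra) HA.
apply: Ccv_bound (dtaylor_cv j (ltac:(lra) : 0 < 1 / 2) h) _ => N.
exact: dtaylor_partial_bound.
Qed.

Lemma tprim_small j eps : 0 < eps -> exists N0, forall N, (N0 <= N)%N ->
  Rabs (tprim j (ln (INR N.+1))) < eps.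
Proof.
move=> e0; pose K := INR j.+1 * 2 ^ j.
have K0 : 0 < K by apply: Rmult_lt_0_compat; [exact: INRS_gt0 | apply: pow_lt; lra].
have bound x : 0 <= x -> Rabs (tprim j x) <= K * exp (- x / 2).
  move=> x0; rewrite /tprim Rabs_Ropp Rabs_mult Rabs_pos_eq; last exact: Rlt_le (exp_pos _).
  rewrite Rabs_pos_eq; last by apply: rsum_ge0 => i _; apply: expterm_ge0.
  have -> : exp (- x / 2) = exp (- x) * exp (x / 2) by rewrite -exp_plus; congr exp; field.
  have : \rs_(i < j.+1) expterm i x <= K * exp (x / 2).
    apply: Rle_trans (_ : \rs_(i < j.+1) (2 ^ j * exp (x / 2)) <= _).
      apply: rsum_le_in => i _; have := @expterm_le i (1 / 2) x ltac:(lra) x0.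
      have -> : / (1 / 2) = 2 by field.
      have -> : 1 / 2 * x = x / 2 by field.
      move=> h; apply: Rle_trans h _; apply: Rmult_le_compat_r; first exact: Rlt_le (exp_pos _).
      by apply: Rle_pow; [lra | apply/leP; rewrite -ltnS; exact: ltn_ord].
    rewrite rsum_const /index_enum -enumT size_enum_ord /K; right; ring.
  have := exp_pos (- x); set e := exp (- x); set S := bigop _ _ _; set f := exp _ => p h.
  have := Rmult_le_compat_l _ _ _ (Rlt_le _ _ p) h; lra.
pose M := exp (2 * ln (K / eps + 1)).
have q : 0 < K / eps by apply: Rdiv_lt_0_compat.
have [N0 HN0] := INR_unbounded M.
exists N0 => N /leP hN.
have big : M <= INR N.+1 by rewrite S_INR; have := le_INR _ _ hN; lra.
have lM : 2 * ln (K / eps + 1) <= ln (INR N.+1).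
  by rewrite -[X in X <= _]ln_exp; apply: ln_le => //; exact: exp_pos.
apply: Rle_lt_trans (bound _ (ln_nat_ge0 _)) _.
apply: Rle_lt_trans (_ : K * exp (- ln (K / eps + 1)) < _).
  apply: Rmult_le_compat_l; first lra.
  case: (Req_dec (- ln (INR N.+1) / 2) (- ln (K / eps + 1))) => [->|ne]; first lra.
  by apply: Rlt_le; apply: exp_increasing; lra.
rewrite exp_Ropp exp_ln; last lra.
have -> : K * / (K / eps + 1) = eps * (K / (K + eps)) by field; lra.
have : K / (K + eps) < 1; last by nra.
apply: (Rmult_lt_reg_r (K + eps)); first lra.
by have -> : K / (K + eps) * (K + eps) = K; [field | ]; lra.
Qed.

(** At [s = 2 - z] the pole [1 / (s - 1)] of zeta is [1 / (1 - z)], all of whose coefficients are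
    [1]. That [1] is also the integral of [tcoef j] over [[1, oo)], and sum and integral differ by
    at most [4 * 5 * (4/7)^j]. *)
Lemma dtaylor_one_bound j : Cmod (dtaylor (fun=> RtoC 1) j - RtoC 1)%C <= 20 * (4 / 7) ^ j.
Proof.
apply: le_epsilon => eps e0.
have adm1 : adm (1 / 2) (fun=> RtoC 1).
  by apply: (@adm_bounded _ 1) => [|n]; [lra | rewrite Cmod_1; lra].
have [N1 H1] := dtaylor_cv j (ltac:(lra) : 0 < 1 / 2) adm1 (eps := eps / 2) ltac:(lra).
have [N2 H2] := @tprim_small j (eps / 2) ltac:(lra).
pose N := maxn N1 N2.
have A := H1 N.+1 ltac:(by apply/leP; apply: leq_trans (leq_maxl N1 N2) _).
have B := H2 N (leq_maxr N1 N2).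
pose L n := tprim j (ln (INR n)).
have E : \rs_(n < N) (L n.+2 - L n.+1) = L N.+1 - L 1%N.
  elim: N {A B} => [|N IH]; first by rewrite big_ord0; ring.
  by rewrite big_ord_recr IH /=; ring.
have L1 : L 1%N = -1.
  rewrite /L ln_1 /tprim Ropp_0 exp_0 big_ord_recl big1 => [|i _]; last by rewrite lift0 expterm_S0.
  by rewrite /expterm /=; field.
have D : Rabs (\rs_(n < N) tcoef j n.+1 - \rs_(n < N) (L n.+2 - L n.+1)) <= 20 * (4 / 7) ^ j.
  rewrite -rsum_minus -Cmod_R RtoC_rsum; apply: Rle_trans (Cmod_csum _ _ _) _.
  apply: Rle_trans (_ : \rs_(i < N.+1) (4 * (4 / 7) ^ j * npow i (-1 - 1 / 4)) <= _).
    rewrite big_ord_recl /= Rmult_0_r Rplus_0_l; apply: rsum_le => i.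
    by rewrite Cmod_R; apply: tprim_step.
  rewrite -big_distrr /=; have := @npow_sum_le (1 / 4) N.+1 ltac:(lra).
  have -> : / (1 / 4) = 4 by field.
  have : 0 <= (4 / 7) ^ j by apply: pow_le; lra.
  move=> r0 h; apply: Rle_trans (_ : 4 * (4 / 7) ^ j * (1 + 4) <= _); last lra.
  by apply: Rmult_le_compat_l; first lra.
have F : \cs_(n < N.+1) (1 * RtoC (tcoef j n))%C = RtoC (\rs_(n < N) tcoef j n.+1).
  rewrite big_ord_recl tcoef_at0 Cmult_0_r Cplus_0_l RtoC_rsum.
  by apply: eq_bigr => i _; rewrite Cmult_1_l lift0.
rewrite F in A; rewrite E L1 -/(L N.+1) in D B.
set S := (\big[_/_]_(_ < _) _) in A D.
set T := dtaylor _ _ in A *.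
have -> : (T - 1 = - (RtoC S - T) + (RtoC (S - (L N.+1 - -1)) + RtoC (L N.+1)))%C.
  by rewrite !RtoC_minus; rewrite RtoC_opp; ring.
have := Cmod_triangle (- (RtoC S - T))%C (RtoC (S - (L N.+1 - -1)) + RtoC (L N.+1))%C.
have := Cmod_triangle (RtoC (S - (L N.+1 - -1))) (RtoC (L N.+1)).
rewrite Cmod_opp !Cmod_R; lra.
Qed.

Definition pser (c : nat -> C) (z : C) : C := tot (fun j => c j * z ^ j)%C.

Lemma npow_neg_taylor t n (z : C) : (0 < n)%N ->
  Ccv (fun J => \cs_(j < J) (twist t n * RtoC (tcoef j n) * z ^ j)%C)
    (npow_neg n ((2, t) - z)%C).
Proof.
move=> n0; set L := ln (INR n).
have := Ccv_scal (twist t n * RtoC (npow n (-2)))%C (cexp_series (RtoC L * z)%C).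
suff -> : (twist t n * RtoC (npow n (-2)) * cexp (RtoC L * z))%C = npow_neg n ((2, t) - z)%C.
  apply: Ccv_ext => J; rewrite big_distrr /=; apply: eq_bigr => j _.
  rewrite /tcoef /expterm Cpow_mult_l -RtoC_pow /Rdiv !RtoC_mult -/L; ring.
case: z => x y; rewrite /npow_neg /cexp /twist npowE // -/L /=.
have -> : L * x - 0 * y = L * x by ring.
have -> : L * y + 0 * x = L * y by ring.
have -> : - (2 + - x) * L = -2 * L + L * x by ring.
have -> : (t + - y) * L = t * L - L * y by ring.
rewrite exp_plus cos_minus sin_minus; apply: injective_projections => /=; ring.
Qed.

Lemma npow_neg_zero_coef (a : nat -> C) s N :
  dirichlet_partial a s N = \cs_(n < N) (a n.+1 * npow_neg n.+1 s)%C.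
Proof. by elim: N => [|N IH]; [rewrite big_ord0 | rewrite big_ord_recr /= IH]. Qed.

(** The Taylor coefficients of the partial sums obey the Abel bound uniformly in [N], and
    [4/7 * 3/2 = 6/7 < 1], so [tannery] passes to the limit. The conclusion concerns the Dirichlet
    series itself, which is the object whose zeros [GRH] locates. *)
Lemma dirichlet_taylor (a : nat -> C) A B t (z : C) :
  (forall n, Cmod (a n) <= A) -> psum_le a B -> Cmod z <= 3 / 2 ->
  Ccv (dirichlet_partial a ((2, t) - z)%C) (pser (dtaylor (twisted a t)) z).
Proof.
move=> HA HB hz.
(* The [j]-th term in the expansion of the [N]-th partial sum; the bound is [N.+1] because the term
   [n = 0] is zero. *)
pose u N j := ((\cs_(n < N.+1) (twisted a t n * RtoC (tcoef j n))) * z ^ j)%C.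
have z0 := Cmod_ge_0 z.
have r : 0 <= 6 / 7 < 1 by lra.
have hu N j : Cmod (u N j) <= 2 * B * twist_const t * (6 / 7) ^ j.
  rewrite /u Cmod_mult Cmod_pow.
  have -> : 6 / 7 = 4 / 7 * (3 / 2) by field.
  rewrite Rpow_mult_distr -Rmult_assoc; apply: Rmult_le_compat; try exact: Cmod_ge_0.
  - by rewrite -Cmod_pow; exact: Cmod_ge_0.
  - exact: dtaylor_partial_bound.
  - exact: pow_incr.
have half : 0 < 1 / 2 by lra.
have hadm : adm (1 / 2) (twisted a t) by apply: adm_twisted HA; lra.
have := tannery r hu (c := fun j => (dtaylor (twisted a t) j * z ^ j)%C).
rewrite -/(pser (dtaylor (twisted a t)) z) => T.
apply: Ccv_ext (T _) => [N|j]; last first.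
  rewrite Cmult_comm; apply: Ccv_ext (Ccv_scal _ (Ccv_shiftS (dtaylor_cv j half hadm))) => N.
  by rewrite /u Cmult_comm.
have S : summ (u N) by eexists; apply: geo_summ r (hu N).
apply: Ccv_unique (usum_Ccv (totP S)) _.
rewrite npow_neg_zero_coef.
have H := @Ccv_sum _ (index_enum 'I_N)
  (fun n J => (a n.+1 * \cs_(j < J) (twist t n.+1 * RtoC (tcoef j n.+1) * z ^ j))%C)
  (fun n => (a n.+1 * npow_neg n.+1 ((2, t) - z))%C)
  (fun n => Ccv_scal (a n.+1) (npow_neg_taylor t z (ltn0Sn n))).
apply: Ccv_ext H => J /=.
rewrite (eq_bigr (fun i : 'I_N => \cs_(j < J) (a i.+1 * (twist t i.+1 * RtoC (tcoef j i.+1) * z ^ j))%C)).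
  rewrite exchange_big /=; apply: eq_bigr => j _.
  rewrite /u big_ord_recl tcoef_at0 Cmult_0_r Cplus_0_l big_distrl /=.
  by apply: eq_bigr => i _; rewrite /twisted /bump add1n; ring.
by move=> i _; rewrite big_distrr.
Qed.

End TaylorCoefficients.

(** * The ring of formal power series *)

Section PowerSeriesRing.

Definition szero (j : nat) : C := RtoC 0.
Definition sone (j : nat) : C := if j is 0%N then RtoC 1 else RtoC 0.
Definition sadd (a b : nat -> C) (j : nat) : C := (a j + b j)%C.
Definition sopp (a : nat -> C) (j : nat) : C := (- a j)%C.

Lemma cauchyC a b : cauchy a b = cauchy b a.
Proof.
apply: functional_extensionality => j; rewrite /cauchy.
rewrite (reindex_inj rev_ord_inj) /=; apply: eq_bigr => i _.
have ij : (i <= j)%N by rewrite -ltnS ltn_ord.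
by rewrite subSS (subKn ij) Cmult_comm.
Qed.

Lemma cauchyDl a b c : cauchy (sadd a b) c = sadd (cauchy a c) (cauchy b c).
Proof.
apply: functional_extensionality => j; rewrite /cauchy /sadd -big_split.
by apply: eq_bigr => i _; rewrite Cmult_plus_distr_r.
Qed.

Lemma cauchy1l a : cauchy sone a = a.
Proof.
apply: functional_extensionality => j; rewrite /cauchy big_ord_recl big1 => [|i _] /=; last ring.
by rewrite subn0; ring.
Qed.

Lemma cauchyA a b c : cauchy a (cauchy b c) = cauchy (cauchy a b) c.
Proof.
apply: functional_extensionality => n; rewrite [cauchy (cauchy a b) c]cauchyC.
rewrite [cauchy b c]cauchyC /cauchy.
pose F j k := (a j * (b (n - j - k)%N * c k))%C.
transitivity (\big[Cplus/RtoC 0]_(j < n.+1) \big[Cplus/RtoC 0]_(k < n.+1 | (k <= n - j)%N) F j k).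
  apply: eq_bigr => j _; rewrite big_distrr /=.
  rewrite (big_ord_narrow_leq (leq_subr j n)) /=; apply: eq_bigr => k _.
  by rewrite /F [(c k * _)%C]Cmult_comm.
rewrite (exchange_big_dep predT) //=; apply: eq_bigr => k _.
transitivity (\big[Cplus/RtoC 0]_(j < n.+1 | (j <= n - k)%N) F j k).
  apply: eq_bigl => j; rewrite -ltnS -(ltnS j) -!subSn ?leq_ord //.
  by rewrite -subn_gt0 -(subn_gt0 j) -!subnDA addnC.
rewrite (big_ord_narrow_leq (leq_subr k n)) big_distrr /=.
by apply: eq_bigr => j _; rewrite /F -!subnDA addnC; ring.
Qed.

(** Makes [ring] available for identities between coefficient sequences, with the Cauchy product as
    multiplication. *)
Lemma series_ring_theory : ring_theory szero sone sadd cauchy (fun a b => sadd a (sopp b)) sopp eq.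
Proof.
have ext (a b : nat -> C) : (forall j, a j = b j) -> a = b by exact: functional_extensionality.
split=> *; try (by apply: ext => j; rewrite /sadd /szero /sopp; ring).
- exact: cauchy1l.
- exact: cauchyC.
- exact: cauchyA.
- exact: cauchyDl.
Qed.

Add Ring series_ring : series_ring_theory.

Lemma cauchy_fiber a b (w : nat -> C) j : (forall i k, w (i + k)%N = (w i * w k)%C) ->
  fiber_sum (fun p : nat * nat => (p.1 + p.2)%N) (fun p => (a p.1 * w p.1) * (b p.2 * w p.2))%C j
  = (cauchy a b j * w j)%C.
Proof.
move=> wM; rewrite /fiber_sum (@tot_fin _ _ [seq (i, (j - i)%N) | i <- iota 0 j.+1]).
- rewrite big_map -[iota 0 j.+1]/(index_iota 0 j.+1) /cauchy big_distrl /=.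
  rewrite -(big_mkord xpredT (fun i => a i * b (j - i)%N * w j)%C).
  rewrite big_seq [RHS]big_seq; apply: eq_bigr => i.
  rewrite mem_index_iota ltnS => /andP[_ ij] /=; rewrite subnKC // eqxx.
  have -> : w j = (w i * w (j - i)%N)%C by rewrite -wM subnKC.
  ring.
- by rewrite map_inj_uniq ?iota_uniq // => x y [].
case=> m n ni; case: eqP => //= E; case/mapP: ni; exists m.
  by rewrite mem_iota add0n ltnS -E leq_addr.
by rewrite -E addKn.
Qed.

Lemma Cpow_add (z : C) m n : (z ^ (m + n)%N = z ^ m * z ^ n)%C.
Proof. by elim: m => [|m IH]; [rewrite add0n /=; ring | rewrite addSn !Cpow_S IH; ring]. Qed.

Lemma summ_cauchy a b z : summ (fun j => a j * z ^ j)%C -> summ (fun j => b j * z ^ j)%C ->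
  summ (fun j => cauchy a b j * z ^ j)%C.
Proof.
move=> Ha Hb.
apply: summ_ext (summ_fiber (fun p : nat * nat => (p.1 + p.2)%N) (summ_prod Ha Hb)) => j.
exact: (@cauchy_fiber a b (fun j => z ^ j)%C j (Cpow_add z)).
Qed.

Lemma pser_cauchy a b z : summ (fun j => a j * z ^ j)%C -> summ (fun j => b j * z ^ j)%C ->
  pser (cauchy a b) z = (pser a z * pser b z)%C.
Proof.
move=> Ha Hb; rewrite /pser -tot_prod // (tot_fiber (fun p : nat * nat => (p.1 + p.2)%N)).
  apply: tot_ext => j; symmetry; exact: (@cauchy_fiber a b (fun j => z ^ j)%C j (Cpow_add z)).
exact: (summ_prod Ha Hb).
Qed.

Lemma pser_sone z : pser sone z = RtoC 1.
Proof.
rewrite /pser (@tot_fin _ _ [:: 0%N]) ?big_seq1 //=; first ring.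
by case=> // n _ /=; ring.
Qed.

Lemma summ_geo (c : nat -> C) K r z : (forall j, Cmod (c j) <= K * r ^ j) -> 0 <= r ->
  r * Cmod z < 1 -> summ (fun j => c j * z ^ j)%C.
Proof.
move=> H r0 hz; eexists; apply: (@geo_summ _ K (r * Cmod z)).
  by split=> //; apply: Rmult_le_pos => //; exact: Cmod_ge_0.
move=> j; rewrite Cmod_mult Cmod_pow Rpow_mult_distr -Rmult_assoc.
by apply: Rmult_le_compat_r => //; apply: pow_le; exact: Cmod_ge_0.
Qed.

End PowerSeriesRing.

(** * Multiplicative functions and their local series *)

Section MultiplicativeFunctions.

Implicit Types g h : nat -> nat -> C.

(** The multiplicative function with value [g p j] at [p ^ j] for [j > 0]; identities of Dirichlet
    series reduce to identities of the local sequences [g p]. *)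
Definition mulf g (n : nat) : C := \big[Cmult/RtoC 1]_(p <- primes n) g p (logn p n).

Lemma mulf1 g : mulf g 1 = RtoC 1. Proof. by rewrite /mulf big_nil. Qed.

Lemma mulf_pfactor g m p a : prime p -> coprime p m -> (0 < m)%N -> (forall p, g p 0%N = RtoC 1) ->
  mulf g (m * p ^ a)%N = (mulf g m * g p a)%C.
Proof.
move=> pp cp m0 g0; case: (posnP a) => [->|a0]; first by rewrite expn0 muln1 g0 Cmult_1_r.
have pa0 : (0 < p ^ a)%N by rewrite expn_gt0 prime_gt0.
have pm : p \notin primes m.
  by rewrite mem_primes pp m0 /= -prime_coprime.
have -> : mulf g (m * p ^ a) = \big[Cmult/RtoC 1]_(q <- p :: primes m) g q (logn q (m * p ^ a)%N).
  apply: perm_big; apply: uniq_perm; rewrite ?primes_uniq //= ?pm ?primes_uniq //.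
  by move=> q; rewrite primesM // primesX // (primes_prime pp) mem_seq1 orbC in_cons.
rewrite big_cons lognM // pfactorK // (logn_coprime cp) add0n Cmult_comm; congr Cmult.
rewrite /mulf big_seq [RHS]big_seq; apply: eq_bigr => q qm.
have qp : (q == p) = false by apply/negbTE; apply: contraNneq pm => <-.
by rewrite lognM // lognX (logn_prime q pp) qp muln0 addn0.
Qed.

Lemma divisors_pfactor m p a : prime p -> coprime p m -> (0 < m)%N ->
  perm_eq (divisors (m * p ^ a)%N) [seq (d * p ^ i)%N | d <- divisors m, i <- index_iota 0 a.+1].
Proof.
move=> pp cp m0; have p0 := prime_gt0 pp.
have pa0 i : (0 < p ^ i)%N by rewrite expn_gt0 p0.
have npd d : d \in divisors m -> ~~ (p %| d)%N.
  rewrite -dvdn_divisors // => dm; apply/negP => pd.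
  by move: cp; rewrite prime_coprime // (dvdn_trans pd dm).
apply: uniq_perm; first exact: divisors_uniq.
  apply: allpairs_uniq; rewrite ?divisors_uniq ?iota_uniq //.
  move=> [d i] [d' i'] h1 h2 E.
  have {h1} hx : d \in divisors m.
    by case/allpairsPdep: h1 => x [y [hx _ [-> _]]].
  have {h2} hx' : d' \in divisors m.
    by case/allpairsPdep: h2 => x [y [hx' _ [-> _]]].
  have x0 : (0 < d)%N by move: hx; rewrite -dvdn_divisors //; apply: dvdn_gt0.
  have x0' : (0 < d')%N by move: hx'; rewrite -dvdn_divisors //; apply: dvdn_gt0.
  have L z e : z \in divisors m -> (0 < z)%N -> logn p (z * p ^ e)%N = e.
    move=> hz z0; rewrite lognM // pfactorK // logn_coprime ?add0n // prime_coprime //.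
    exact: npd.
  have /= E' : (d * p ^ i = d' * p ^ i')%N by [].
  have ii : i = i' by rewrite -(L d i) // E' L.
  by move: E'; rewrite ii => /eqP; rewrite eqn_pmul2r // => /eqP ->.
move=> d; rewrite -dvdn_divisors ?muln_gt0 ?m0 ?pa0 //; apply/idP/allpairsPdep => [dn|[e [i [he hi ->]]]].
  have d0 : (0 < d)%N by apply: dvdn_gt0 dn; rewrite muln_gt0 m0 pa0.
  have [e ce E] := pfactor_coprime pp d0.
  exists e, (logn p d); split=> //.
    rewrite -dvdn_divisors //.
    have : (e %| m * p ^ a)%N by apply: dvdn_trans dn; rewrite [X in (_ %| X)%N]E dvdn_mulr.
    by rewrite Gauss_dvdl // coprimeXr // coprime_sym.
  have := dvdn_leq_log p _ dn; rewrite muln_gt0 m0 pa0 => /(_ isT).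
  by rewrite lognM // pfactorK // (logn_coprime cp) add0n mem_index_iota ltnS.
rewrite -dvdn_divisors // in he; apply: dvdn_mul => //.
by apply: dvdn_exp2l; move: hi; rewrite mem_index_iota ltnS.
Qed.

(** Induction on [n], splitting off the full power of its least prime factor: the divisors of
    [m * p ^ a] are the products [d * p ^ i], so the sum factors. *)
Lemma dconv_mulf g h n : (forall p, g p 0%N = RtoC 1) -> (forall p, h p 0%N = RtoC 1) -> (0 < n)%N ->
  dconv (mulf g) (mulf h) n = mulf (fun p => cauchy (g p) (h p)) n.
Proof.
move=> g0 h0; elim/ltn_ind: n => n IH n0.
case: (leqP n 1) => [n1|n1].
  have -> : n = 1%N by apply/eqP; rewrite eqn_leq n1 n0.
  by rewrite /dconv /divisors /= big_seq1 !mulf1 Cmult_1_l.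
have pp := pdiv_prime n1; set p := pdiv n in pp.
have [m cp E] := pfactor_coprime pp n0; set a := logn p n in E.
have p0 := prime_gt0 pp.
have pa0 i : (0 < p ^ i)%N by rewrite expn_gt0 p0.
have m0 : (0 < m)%N by move: n0; rewrite E muln_gt0 => /andP[].
have a0 : (0 < a)%N by rewrite /a logn_gt0 mem_primes pp n0 pdiv_dvd.
have mn : (m < n)%N by rewrite E -{1}(muln1 m) ltn_pmul2l // -{1}(expn0 p) ltn_exp2l // prime_gt1.
have c0 q : cauchy (g q) (h q) 0%N = RtoC 1.
  by rewrite /cauchy big_ord_recl big_ord0 /= g0 h0; ring.
rewrite E mulf_pfactor // -IH // /dconv (perm_big _ (divisors_pfactor a pp cp m0)) big_allpairs_dep /=.
rewrite big_distrl /=.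
rewrite big_seq [RHS]big_seq; apply: eq_bigr => d dm; rewrite -dvdn_divisors // in dm.
have d0 : (0 < d)%N by apply: dvdn_gt0 dm.
have cd : coprime p d by apply: coprime_dvdr dm cp.
have cmd : coprime p (m %/ d) by apply: coprime_dvdr cp; apply: dvdn_div.
have md0 : (0 < m %/ d)%N by rewrite divn_gt0 // dvdn_leq.
rewrite big_mkord [cauchy _ _ _]/cauchy big_distrr /=.
apply: eq_bigr => i _; rewrite mulf_pfactor //.
have ia : (i <= a)%N by rewrite -ltnS.
have -> : ((m * p ^ a) %/ (d * p ^ i) = (m %/ d) * p ^ (a - i))%N.
  rewrite -{1}(divnK dm) -{1}(subnK ia) expnD.
  rewrite [(_ * (_ * _))%N]mulnACA mulnK // muln_gt0 d0; exact: pa0.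
by rewrite mulf_pfactor //; ring.
Qed.

Lemma mulf_ext g h n : (forall p j, prime p -> (0 < j)%N -> g p j = h p j) -> mulf g n = mulf h n.
Proof.
move=> H; rewrite /mulf big_seq [RHS]big_seq; apply: eq_bigr => p.
by move=> hp; apply: H; [move: hp; rewrite mem_primes => /and3P[] | rewrite logn_gt0].
Qed.

Lemma dconv_ext a b a' b' n : (0 < n)%N -> (forall n, (0 < n)%N -> a n = a' n) ->
  (forall n, (0 < n)%N -> b n = b' n) -> dconv a b n = dconv a' b' n.
Proof.
move=> n0 Ha Hb; rewrite /dconv big_seq [RHS]big_seq; apply: eq_bigr => d; rewrite -dvdn_divisors // => dn.
have d0 := dvdn_gt0 n0 dn; rewrite Ha // Hb // divn_gt0 //; exact: dvdn_leq.
Qed.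

Definition completely_mult (u : nat -> C) : Prop :=
  u 1%N = RtoC 1 /\ forall m n, (0 < m)%N -> (0 < n)%N -> u (m * n)%N = (u m * u n)%C.

Lemma completely_mult_pow u m j : completely_mult u -> (0 < m)%N -> u (m ^ j)%N = (u m ^ j)%C.
Proof.
case=> u1 uM m0; elim: j => [|j IH]; first by rewrite expn0 u1.
by rewrite expnS uM ?expn_gt0 ?m0 // IH.
Qed.

Lemma mulf_completely_mult u g n : completely_mult u -> (forall p, g p 0%N = RtoC 1) -> (0 < n)%N ->
  mulf (fun p j => g p j * u p ^ j)%C n = (mulf g n * u n)%C.
Proof.
move=> hu g0; have [u1 uM] := hu; elim/ltn_ind: n => n IH n0.
case: (leqP n 1) => [n1|n1].
  have -> : n = 1%N by apply/eqP; rewrite eqn_leq n1 n0.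
  by rewrite !mulf1 u1 Cmult_1_l.
have pp := pdiv_prime n1; set p := pdiv n in pp.
have [m cp E] := pfactor_coprime pp n0; set a := logn p n in E.
have p0 := prime_gt0 pp.
have pa0 i : (0 < p ^ i)%N by rewrite expn_gt0 p0.
have m0 : (0 < m)%N by move: n0; rewrite E muln_gt0 => /andP[].
have a0 : (0 < a)%N by rewrite /a logn_gt0 mem_primes pp n0 pdiv_dvd.
have mn : (m < n)%N by rewrite E -{1}(muln1 m) ltn_pmul2l // -{1}(expn0 p) ltn_exp2l // prime_gt1.
rewrite E mulf_pfactor // => [|q]; last by rewrite g0 Cmult_1_l.
rewrite mulf_pfactor // IH // uM // completely_mult_pow //; ring.
Qed.

Lemma mulf_const1 n : mulf (fun _ _ => RtoC 1) n = RtoC 1.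
Proof. by rewrite /mulf big1. Qed.

Lemma mulf_sone n : (1 < n)%N -> mulf (fun _ => sone) n = RtoC 0.
Proof.
move=> n1; rewrite /mulf (big_rem (pdiv n)) /=; last first.
  by rewrite mem_primes pdiv_prime // (ltnW n1) pdiv_dvd.
have : (0 < logn (pdiv n) n)%N by rewrite logn_gt0 mem_primes pdiv_prime // (ltnW n1) pdiv_dvd.
by case: logn => //= k _; rewrite Cmult_0_l.
Qed.

End MultiplicativeFunctions.

(** * Nonnegativity of the coefficients of [zeta(s)^2 L(s, u) L(s, conj u)] *)

Section NonnegativeLocalFactors.

Definition at_least (x : R) (z : C) : Prop := Im z = 0 /\ x <= Re z.

Lemma at_least_prod (I : eqType) (s : seq I) (F : I -> C) :
  (forall i, i \in s -> at_least 0 (F i)) -> at_least 0 (\big[Cmult/RtoC 1]_(i <- s) F i).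
Proof.
move=> H; rewrite big_seq; elim/big_rec: _ => [|i z si [Iz Rz]]; first by split=> /=; lra.
have [Ii Ri] := H i si; split; rewrite /Re /Im /= in Ii Ri Iz Rz *; rewrite Ii Iz; first ring.
by have := Rmult_le_pos _ _ Ri Rz; lra.
Qed.

Lemma at_least1_prod (I : eqType) (s : seq I) (F : I -> C) :
  (forall i, i \in s -> at_least 1 (F i)) -> at_least 1 (\big[Cmult/RtoC 1]_(i <- s) F i).
Proof.
move=> H; rewrite big_seq; elim/big_rec: _ => [|i z si [Iz Rz]]; first by split=> /=; lra.
have [Ii Ri] := H i si; split; rewrite /Re /Im /= in Ii Ri Iz Rz *; rewrite Ii Iz; first ring.
nra.
Qed.

Lemma at_least_add x y w z : at_least x w -> at_least y z -> at_least (x + y) (w + z)%C.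
Proof. by case=> a b [c d]; split; rewrite /Re /Im /= in a b c d *; lra. Qed.

Lemma at_least_conj z : at_least 0 (z * Cconj z)%C.
Proof. by case: z => x y; split; rewrite /Re /Im /=; nra. Qed.

(** Coefficients of [1 / ((1 - x) (1 - u x))], the local factor of [zeta(s) L(s, u)]. *)
Definition geo (u : C) : nat -> C := cauchy (fun=> RtoC 1) (fun j => u ^ j)%C.

Lemma geo0 u : geo u 0%N = RtoC 1.
Proof. by rewrite /geo /cauchy big_ord_recl big_ord0 /=; ring. Qed.

Lemma geoE u j : geo u j = \cs_(i < j.+1) (u ^ i)%C.
Proof. by rewrite /geo cauchyC /cauchy; apply: eq_bigr => i _; ring. Qed.

Lemma geoS u j : geo u j.+1 = (1 + u * geo u j)%C.
Proof.
by rewrite !geoE big_ord_recl /= big_distrr.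
Qed.

(** The local factor of [zeta(s)^2 L(s, u) L(s, conj u)] at a prime where the character takes the
    value [u]. *)
Definition local_landau (u : C) : nat -> C := cauchy (geo u) (geo (Cconj u)).

Lemma local_landau0 u : local_landau u 0%N = RtoC 1.
Proof. by rewrite /local_landau /cauchy big_ord_recl big_ord0 !geo0 /=; ring. Qed.

Lemma local_landau1 u : local_landau u 1%N = (geo u 1 + geo (Cconj u) 1)%C.
Proof.
transitivity (geo u 0 * geo (Cconj u) 1 + (geo u 1 * geo (Cconj u) 0 + 0))%C.
  by rewrite /local_landau /cauchy !big_ord_recl big_ord0.
by rewrite !geo0; ring.
Qed.

Lemma local_landauSS u j :
  local_landau u j.+2 = (geo (Cconj u) j.+2 + (1 + u) * local_landau u j.+1 - u * local_landau u j)%C.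
Proof.
have E : local_landau u j.+1 = (geo (Cconj u) j.+1 +
    \cs_(i < j.+1) (geo u i.+1 * geo (Cconj u) (j - i)%N))%C.
  rewrite /local_landau /cauchy big_ord_recl /= geo0 subn0; by congr (_ + _)%C; ring.
transitivity (geo u 0 * geo (Cconj u) j.+2 + (geo u 1 * geo (Cconj u) j.+1
    + \cs_(i < j.+1) (geo u i.+2 * geo (Cconj u) (j - i)%N)))%C.
  by rewrite /local_landau /cauchy big_ord_recl big_ord_recl.
have -> : \cs_(i < j.+1) (geo u i.+2 * geo (Cconj u) (j - i)%N)%C
  = ((1 + u) * (\cs_(i < j.+1) (geo u i.+1 * geo (Cconj u) (j - i)%N)) - u * local_landau u j)%C.
  rewrite /local_landau /cauchy !big_distrr /= -csum_minus; apply: eq_bigr => i _.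
  by rewrite !geoS; ring.
have -> : geo u 1 = (1 + u)%C by rewrite geoS geo0; ring.
by rewrite E geo0; ring.
Qed.

(* The coefficient identity
   [(1 - x^2) / ((1 - x)^2 (1 - u x) (1 - u' x)) = sum |r_j|^2 x^j] for [|u| = 1]. *)
Lemma local_landau_rec u j : (u * Cconj u)%C = RtoC 1 ->
  local_landau u j.+2 = (local_landau u j + geo u j.+2 * Cconj (geo u j.+2))%C.
Proof.
move=> uv.
have -> : Cconj (geo u j.+2) = geo (Cconj u) j.+2.
  elim: (j.+2) => [|k IH]; first by rewrite !geo0; apply: injective_projections => /=; ring.
  by rewrite !geoS -IH Cplus_conj Cmult_conj; congr Cplus; apply: injective_projections => /=; ring.
set v := Cconj u in uv *.
suff H : forall j, local_landau u j.+2 = (local_landau u j + geo u j.+2 * geo v j.+2)%C /\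
    local_landau u j.+3 = (local_landau u j.+1 + geo u j.+3 * geo v j.+3)%C by case: (H j).
elim=> [|k [IH1 IH2]].
  split; rewrite !local_landauSS ?local_landau1 ?local_landau0 -/v !geoS !geo0; ring [uv].
split=> //; rewrite (local_landauSS u k.+2) -/v IH2.
rewrite {1}IH1 (local_landauSS u k) -/v !geoS; ring [uv].
Qed.

(** For [|u| = 1] a step of two in the index adds a square modulus, starting from [1] at index [0]
    and from [2 + 2 Re u >= 0] at index [1]; hence the even coefficients never drop below [1]. For
    [u = 0] the coefficient is [j + 1]. *)
Lemma local_landau_pos u : u = RtoC 0 \/ Cmod u = 1 ->
  forall j, at_least 0 (local_landau u j) /\ at_least 1 (local_landau u (2 * j)%N).
Proof.
move=> [->|u1].
  have g1 j (v : C) : v = RtoC 0 -> geo v j = RtoC 1.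
    by move=> ->; case: j => [|j]; rewrite ?geo0 // geoS; ring.
  have c0 : Cconj (RtoC 0) = RtoC 0 by apply: injective_projections => /=; ring.
  have E j : local_landau 0%C j = RtoC (INR j.+1).
    rewrite /local_landau /cauchy (eq_bigr (fun=> RtoC 1)) => [|i _].
      by rewrite csum_const /index_enum -enumT size_enum_ord Cmult_1_r.
    by rewrite !g1 // Cmult_1_l.
  move=> j; rewrite !E; split; (split; first by []); first exact: (pos_INR j.+1).
  by apply: (le_INR 1 (2 * j).+1); lia.
have uv : (u * Cconj u)%C = RtoC 1.
  by rewrite -Cmod2_conj u1 pow1.
have P j : at_least 0 (local_landau u j) /\ at_least 0 (local_landau u j.+1).
  elim: j => [|j [IH1 IH2]].
    rewrite local_landau0 local_landau1 !geoS !geo0; split; first by split=> /=; lra.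
    split; first by case: u {u1 uv} => x y; rewrite /Im /=; ring.
    have := re_le_Cmod u; rewrite u1; case: u {u1 uv} => x y; rewrite /Re /= => h.
    by have := Rle_abs (- x); rewrite Rabs_Ropp; lra.
  split=> //; rewrite local_landau_rec //.
  by have := at_least_add IH1 (at_least_conj (geo u j.+2)); rewrite Rplus_0_l.
have Q j : at_least 1 (local_landau u (2 * j)%N).
  elim: j => [|j IH]; first by rewrite local_landau0; split=> /=; lra.
  rewrite mulnS /= add2n local_landau_rec //.
  by have := at_least_add IH (at_least_conj (geo u (2 * j).+2)); rewrite Rplus_0_r.
by move=> j; split; [case: (P j) | apply: Q].
Qed.

Definition landau_coef (u : nat -> C) : nat -> C :=
  dconv (dconv (fun=> RtoC 1) u) (dconv (fun=> RtoC 1) (fun n => Cconj (u n))).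

Lemma completely_mult_mulf u n : completely_mult u -> (0 < n)%N ->
  mulf (fun p j => u p ^ j)%C n = u n.
Proof.
move=> hu n0; have := @mulf_completely_mult u (fun _ _ => RtoC 1) n hu (fun=> erefl) n0.
rewrite mulf_const1 Cmult_1_l => <-.
by apply: mulf_ext => p j _ _; rewrite Cmult_1_l.
Qed.

Lemma completely_mult_conj u : completely_mult u -> completely_mult (fun n => Cconj (u n)).
Proof.
case=> u1 uM; split; first by rewrite u1; apply: injective_projections => /=; ring.
by move=> m n m0 n0; rewrite uM // Cmult_conj.
Qed.

Lemma landau_coefE u n : completely_mult u -> (0 < n)%N ->
  landau_coef u n = mulf (fun p => local_landau (u p)) n.
Proof.
move=> hu n0.
have S v m : completely_mult v -> (0 < m)%N -> dconv (fun=> RtoC 1) v m = mulf (fun p => geo (v p)) m.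
  move=> hv m0; rewrite (@dconv_ext _ _ (mulf (fun _ _ => RtoC 1)) (mulf (fun p j => v p ^ j)%C)) //.
  - by rewrite dconv_mulf.
  - by move=> k _; rewrite mulf_const1.
  - by move=> k k0; rewrite completely_mult_mulf.
rewrite /landau_coef (@dconv_ext _ _ (mulf (fun p => geo (u p))) (mulf (fun p => geo (Cconj (u p))))) //.
- by rewrite dconv_mulf // => p; exact: geo0.
- by move=> k k0; apply: S.
by move=> k k0; apply: (S (fun n => Cconj (u n))) => //; exact: completely_mult_conj.
Qed.

(** All prime exponents of [n * n] are even, and there each local coefficient is at least [1]. *)
Lemma landau_coef_pos u n : completely_mult u ->
  (forall p, prime p -> u p = RtoC 0 \/ Cmod (u p) = 1) -> (0 < n)%N ->
  at_least 0 (landau_coef u n) /\ at_least 1 (landau_coef u (n * n)%N).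
Proof.
move=> hu hp n0; rewrite !landau_coefE ?muln_gt0 ?n0 //; split.
  apply: at_least_prod => p; rewrite mem_primes => /and3P[pp _ _].
  by have [] := local_landau_pos (hp p pp) (logn p n).
apply: at_least1_prod => p; rewrite mem_primes => /and3P[pp _ _].
have [_] := local_landau_pos (hp p pp) (logn p n).
by rewrite lognM // addnn -mul2n.
Qed.

End NonnegativeLocalFactors.

(** * Nonvanishing on the line [Re s = 1] *)

Section Landau.

Lemma usum_conj (I : eqType) (f : I -> C) S : usum f S -> usum (fun i => Cconj (f i)) (Cconj S).
Proof.
move=> H eps e0; have [s0 u0 H0] := H eps e0; exists s0 => // s us sub.
have -> : \cs_(i <- s) Cconj (f i) = Cconj (\cs_(i <- s) f i).
  elim/big_rec2: _ => [|i x y _ ->]; last by rewrite Cplus_conj.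
  by apply: injective_projections => /=; ring.
by rewrite -Cminus_conj Cmod_conj; apply: H0.
Qed.

Lemma Cconj_R (x : R) : Cconj (RtoC x) = RtoC x.
Proof. by apply: injective_projections => /=; ring. Qed.

Lemma dtaylor_conj c u j : 0 < c -> adm c u ->
  dtaylor (fun n => Cconj (u n)) j = Cconj (dtaylor u j).
Proof.
move=> c0 H; apply: usum_tot.
apply: usum_ext (usum_conj (totP (summ_tcoef j c0 H))) => n.
by rewrite Cmult_conj Cconj_R.
Qed.

Lemma adm_conj c u : adm c u -> adm c (fun n => Cconj (u n)).
Proof. by move/summ_le; apply=> n; rewrite !Cmod_mult Cmod_conj; lra. Qed.

Lemma tcoef_series n (x : R) : (0 < n)%N ->
  Ccv (fun J => \cs_(j < J) (RtoC (tcoef j n) * RtoC x ^ j)%C) (RtoC (npow n (x - 2))).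
Proof.
move=> n0; have := npow_neg_taylor 0 (RtoC x) n0.
have -> : npow_neg n ((2, 0) - RtoC x)%C = RtoC (npow n (x - 2)).
  rewrite npowE // /npow_neg /=.
  have -> : - (2 + - x) * ln (INR n) = (x - 2) * ln (INR n) by ring.
  have -> : (0 + - 0) * ln (INR n) = 0 by ring.
  by rewrite cos_0 sin_0; apply: injective_projections => /=; ring.
apply: Ccv_ext => J; apply: eq_bigr => j _; rewrite twist0; ring.
Qed.

Lemma harmonic_ge_ln N : ln (INR N.+1) <= \rs_(m < N.+1) npow m (-1).
Proof.
elim: N => [|N IH]; first by rewrite ln_1 big_ord_recr big_ord0 /=; lra.
by rewrite big_ord_recr /=; have := ln_succ_le (ltn0Sn N); move: IH; rewrite /=; lra.
Qed.

(* If the product [zeta(s)^2 L(s,u) L(s,conj u)] had its pole at [1] cancelled, its Taylor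
   series at [2] would converge up to [s = 1/2], where the nonnegative Dirichlet coefficients,
   at least [1] on squares, make it diverge. *)
Lemma landau_nonvanishing u K : completely_mult u -> (forall n, Cmod (u n) <= 1) ->
  (forall p, prime p -> u p = RtoC 0 \/ Cmod (u p) = 1) ->
  (forall j, Cmod (dtaylor u j) <= K * (4 / 7) ^ j) ->
  pser (dtaylor u) (RtoC 1) <> RtoC 0.
Proof.
move=> hu bu hp HK Z.
(* The value [3/2] of [z] is the point [1/2] of the Dirichlet series; the ratio [4/7 * 3/2] is still
   below [1]. *)
pose s := RtoC (3 / 2).
have ms : 4 / 7 * Cmod s < 1 by rewrite Cmod_R Rabs_pos_eq; lra.
have r0 : 0 <= 4 / 7 by lra.
have half : 0 < 1 / 2 by lra.
pose c := dtaylor u; pose z := dtaylor (fun=> RtoC 1).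
have adm1 : adm (1 / 2) (fun=> RtoC 1).
  by apply: (@adm_bounded _ 1) => [|n]; [lra | rewrite Cmod_1; lra].
have admu : adm (1 / 2) u by apply: adm_bounded bu; lra.
have admv := adm_conj admu.
have Sc : summ (fun j => c j * s ^ j)%C by apply: summ_geo HK r0 ms.
have tc0 : tot c = RtoC 0.
  rewrite -Z; apply: tot_ext => j; by rewrite Cpow_1_l Cmult_1_r.
(* Division by [1 - z] produces the partial sums of [c]; as [c] sums to zero, these are negated
   tails and decay like [(4/7)^j] again. This is the cancellation of the pole. *)
have S1 : summ (fun j => cauchy (fun=> RtoC 1) c j * s ^ j)%C.
  apply: (@summ_geo _ (K * (4 / 7) / (1 - 4 / 7)) (4 / 7)) => // j.
  have -> : cauchy (fun=> RtoC 1) c j = (- (tot c - \cs_(i < j.+1) c i))%C.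
    have N0 (x : C) : (- (0 - x))%C = x by ring.
    rewrite tc0 cauchyC /cauchy N0.
    by apply: eq_bigr => i _; rewrite Cmult_1_r.
  rewrite Cmod_opp; apply: Rle_trans (geo_tail j.+1 _ HK) _; first lra.
  by rewrite /=; right; field.
have Se : summ (fun j => (z j - 1) * s ^ j)%C.
  by apply: (@summ_geo _ 20 (4 / 7)) => // j; apply: dtaylor_one_bound.
pose r := cauchy z c.
have Sr : summ (fun j => r j * s ^ j)%C.
  apply: summ_ext (summ_add S1 (summ_cauchy Se Sc)) => j.
  have -> : r = sadd (cauchy (fun=> RtoC 1) c) (cauchy (fun j => z j - 1)%C c).
    rewrite -cauchyDl; congr cauchy; apply: functional_extensionality => i; rewrite /sadd; ring.
  by rewrite /sadd Cmult_plus_distr_r.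
have Sr' : summ (fun j => Cconj (r j) * s ^ j)%C.
  by move: Sr => /summ_le; apply=> j; rewrite !Cmod_mult Cmod_conj; lra.
have admr := adm_conv adm1 admu; have admr' := adm_conv adm1 admv.
have Fr j : dtaylor (dconv (fun=> RtoC 1) u) j = r j by apply: (@dtaylor_conv _ _ (1 / 2)).
have Fr' : dtaylor (dconv (fun=> RtoC 1) (fun n => Cconj (u n))) = (fun j => Cconj (r j)).
  apply: functional_extensionality => j; rewrite -Fr -(dtaylor_conj j half admr).
  apply: tot_ext => n; congr Cmult; rewrite /dconv.
  elim/big_rec2: _ => [|i x y _ ->]; first by rewrite Cconj_R.
  by rewrite Cplus_conj Cmult_conj Cconj_R.
have [M HM] := summ_cauchy Sr Sr'.
pose F := cauchy r (fun j => Cconj (r j)).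
pose A := landau_coef u.
have FA j : dtaylor A j = F j.
  rewrite /A (@dtaylor_conv _ _ (1 / 2)) // Fr' /F; congr (cauchy _ _ _).
  exact: functional_extensionality.
have admA : adm (1 / 2) A by apply: adm_conv.
have Apos n : (0 < n)%N -> at_least 0 (A n) by move=> n0; have [] := landau_coef_pos hu hp n0.
pose a n := if n is 0%N then 0 else Re (A n).
have Aa n : (0 < n)%N -> A n = RtoC (a n).
  by case: n => // n _; have [I0 _] := Apos n.+1 isT; rewrite /a; move: I0; case: (A n.+1) => x y /= ->.
have a0 n : 0 <= a n by case: n => [|n]; [apply: Rle_refl | have [] := Apos n.+1 isT].
have At j n : (A n * RtoC (tcoef j n))%C = RtoC (a n * tcoef j n).
  case: n => [|n]; first by rewrite tcoef_at0 Rmult_0_r Cmult_0_r.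
  by rewrite Aa // RtoC_mult.
(* [n^(-1/2)] is the value at [s] of the expansion with coefficients [tcoef j n]. After exchanging
   the finite sums, nonnegativity bounds each sum over [n] by [Cmod (F j)]. *)
have key N : \rs_(n < N) (a n * npow n (-1 / 2)) <= M.
  have L : Ccv (fun J => \cs_(n < N) (RtoC (a n) * \cs_(j < J) (RtoC (tcoef j n) * s ^ j)))%C
      (\cs_(n < N) RtoC (a n * npow n (-1 / 2))).
    apply: Ccv_sum => -[n _] /=; case: n => [|n].
      rewrite Rmult_0_l; apply: Ccv_ext (Ccv_const _) => J; by rewrite Cmult_0_l.
    rewrite RtoC_mult; apply: Ccv_scal.
    by have := tcoef_series (3 / 2) (ltn0Sn n); have -> : 3 / 2 - 2 = -1 / 2 by field.
  apply: Rle_trans (Rle_abs _) _; rewrite -Cmod_R RtoC_rsum; apply: Ccv_bound L _ => J.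
  rewrite (eq_bigr (fun n : 'I_N => \cs_(j < J) RtoC (a n * tcoef j n * (3 / 2) ^ j))); last first.
    move=> n _; rewrite big_distrr /=; apply: eq_bigr => j _.
    by rewrite /s -RtoC_pow -!RtoC_mult; congr RtoC; ring.
  rewrite exchange_big /=.
  apply: Rle_trans (Cmod_csum _ _ _) _.
  apply: Rle_trans (_ : \rs_(j < J) Cmod (F j * s ^ j)%C <= _); last first.
    have := HM (iota 0 J) (iota_uniq 0 J).
    by rewrite -(big_mkord xpredT (fun j => Cmod (F j * s ^ j)%C)) /index_iota subn0.
  apply: rsum_le => j; rewrite -RtoC_rsum Cmod_R -big_distrl /= Rabs_mult Cmod_mult Cmod_pow Cmod_R.
  rewrite -RPow_abs; apply: Rmult_le_compat_r; first by apply: pow_le; apply: Rabs_pos.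
  have Ss : summ (fun n => RtoC (a n * tcoef j n)).
    by apply: summ_ext (summ_tcoef j half admA) => n; rewrite At.
  rewrite Rabs_pos_eq; last by apply: rsum_ge0 => n _; apply: Rmult_le_pos => //; exact: tcoef_ge0.
  apply: Rle_trans (_ : rtot (fun n => a n * tcoef j n) <= _).
    have := rtot_ge_fin Ss _ (iota_uniq 0 N).
    rewrite -(big_mkord xpredT (fun n => a n * tcoef j n)) /index_iota subn0; apply=> n.
    by apply: Rmult_le_pos => //; exact: tcoef_ge0.
  rewrite /rtot -(tot_ext (At j)) -/(dtaylor A j) FA.
  by apply: Rle_trans (Rle_abs _) _; exact: re_le_Cmod.
have [N hN] := INR_unbounded (exp M).
have N0 : (0 < N)%N.
  by case: N hN => //=; have := exp_pos M; lra.
have : ln (INR N.+1) <= M; last first.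
  move=> h; have : exp M < INR N.+1 by rewrite S_INR; lra.
  by have := exp_pos M => p /(ln_increasing _ _ p); rewrite ln_exp; lra.
apply: Rle_trans (harmonic_ge_ln N) _; apply: Rle_trans (key (N.+1 * N.+1)%N).
rewrite -(big_mkord xpredT (fun n => a n * npow n (-1 / 2))) -(big_mkord xpredT (fun m => npow m (-1))).
(* At [m * m] the weight is [1 / m] and the coefficient at least [1], so the harmonic sum would stay
   below [M]. *)
pose q m := (m * m)%N.
apply: Rle_trans (_ : \rs_(n <- map q (index_iota 0 N.+1)) (a n * npow n (-1 / 2)) <= _); last first.
  apply: rsum_subset => [|||n]; last by apply: Rmult_le_pos => //; exact: npow_ge0.
  - rewrite map_inj_uniq ?iota_uniq // => x y /eqP.
    by rewrite /q !mulnn eqn_sqr => /eqP.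
  - exact: iota_uniq.
  by move=> n /mapP[m]; rewrite !mem_index_iota /= => hm ->; apply: ltn_mul.
rewrite big_map; apply: rsum_le => -[|m]; first by rewrite /q /=; lra.
have [_ [_ h1]] := landau_coef_pos hu hp (ltn0Sn m).
rewrite npow_mul -npow_add; have -> : -1 / 2 + -1 / 2 = -1 by field.
rewrite -[X in X <= _]Rmult_1_l; apply: Rmult_le_compat_r; first exact: npow_ge0.
by rewrite /q /a mulSn.
Qed.

End Landau.

(** * The coefficients of [zeta(s)^(-k)] *)

Section MuK.

(** The coefficient of [x^j] in [(1 - x)^k]. *)
Definition mob (k j : nat) : R := (-1) ^ j * INR (Defs.binom k j).

(* [muk k] has Dirichlet series [zeta(s)^(-k)]. *)
Definition muk (k n : nat) : R := \big[Rmult/1]_(p <- primes n) mob k (logn p n).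

Lemma mob0 k : mob k 0 = 1. Proof. by rewrite /mob; case: k => [|k] /=; ring. Qed.

(** Taking partial sums is division by [1 - x], here of [(1 - x)^(k+1)]. *)
Lemma mob_sum k j : \rs_(i < j.+1) mob k.+1 i = mob k j.
Proof.
elim: j => [|j IH]; first by rewrite big_ord_recr big_ord0 /= !mob0; ring.
rewrite big_ord_recr /= IH /mob.
have -> : Defs.binom k.+1 j.+1 = (Defs.binom k j + Defs.binom k j.+1)%N by [].
by rewrite -plusE plus_INR /=; ring.
Qed.

Lemma binom_le k j : (Defs.binom k j <= 2 ^ k)%N.
Proof.
elim: k j => [|k IH] [|j] //; first by rewrite expn_gt0.
have -> : Defs.binom k.+1 j.+1 = (Defs.binom k j + Defs.binom k j.+1)%N by [].
by rewrite expnS mul2n -addnn leq_add.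
Qed.

Lemma mob_abs k j : Rabs (mob k j) <= INR (2 ^ k)%N.
Proof.
rewrite /mob Rabs_mult -RPow_abs Rabs_Ropp Rabs_R1 pow1 Rmult_1_l Rabs_pos_eq; last exact: pos_INR.
by apply: le_INR; apply/leP; apply: binom_le.
Qed.

Lemma muk_mulf k n : RtoC (muk k n) = mulf (fun _ j => RtoC (mob k j)) n.
Proof. by rewrite /muk /mulf; elim/big_rec2: _ => [|i x y _ <-] //; rewrite RtoC_mult. Qed.

(** At each prime this is [mob_sum] with powers of [u p] attached. In terms of series it reads
    [L * L^(-(k+1)) = L^(-k)], so that inverse powers are handled by recursion on [k] instead of
    division. *)
Lemma dconv_muk k u n : completely_mult u -> (0 < n)%N ->
  dconv u (fun n => RtoC (muk k.+1 n) * u n)%C n = (RtoC (muk k n) * u n)%C.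
Proof.
move=> hu n0.
have S i m : (0 < m)%N -> (RtoC (muk i m) * u m)%C = mulf (fun p j => RtoC (mob i j) * u p ^ j)%C m.
  by move=> m0; rewrite muk_mulf mulf_completely_mult // => p; rewrite mob0.
rewrite (@dconv_ext _ _ (mulf (fun p j => u p ^ j)%C)
    (mulf (fun p j => RtoC (mob k.+1 j) * u p ^ j)%C)) // => [|m m0|m m0].
- rewrite dconv_mulf // => [|p]; last by rewrite mob0 /=; ring.
  rewrite S //; apply: mulf_ext => p j _ _; rewrite cauchyC /cauchy.
  rewrite -mob_sum RtoC_rsum big_distrl /=; apply: eq_bigr => i _.
  have ij : (i <= j)%N by rewrite -ltnS ltn_ord.
  have -> : (u p ^ j = u p ^ i * u p ^ (j - i)%N)%C by rewrite -Cpow_add subnKC.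
  ring.
- by rewrite completely_mult_mulf.
by rewrite S.
Qed.

Lemma muk0 n : (1 < n)%N -> muk 0 n = 0.
Proof.
move=> n1; apply: RtoC_inj; rewrite muk_mulf -(mulf_sone n1); apply: mulf_ext => p [|j] //= _ _.
by rewrite /mob /= Rmult_0_r.
Qed.

Lemma muk1 k : muk k 1 = 1. Proof. by rewrite /muk big_nil. Qed.

Lemma rprod_le (s : seq nat) (F G : nat -> R) : (forall p, p \in s -> 0 <= F p <= G p) ->
  0 <= \big[Rmult/1]_(p <- s) F p <= \big[Rmult/1]_(p <- s) G p.
Proof.
move=> H; rewrite big_seq [X in _ <= _ <= X]big_seq.
elim/big_rec2: _ => [|p x y ps [h1 h2]]; first lra.
have [a b] := H p ps; split; first by apply: Rmult_le_pos.
by apply: Rmult_le_compat.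
Qed.

Lemma npow_ge1 n x : (0 < n)%N -> 0 <= x -> 1 <= npow n x.
Proof.
move=> n0 x0; rewrite npowE // -exp_0.
case: (Req_dec 0 (x * ln (INR n))) => [<-|ne]; first lra.
apply: Rlt_le; apply: exp_increasing; have := Rmult_le_pos _ _ x0 (ln_nat_ge0 n); lra.
Qed.

Lemma npow_leq m n x : (0 < m)%N -> (m <= n)%N -> 0 <= x -> npow m x <= npow n x.
Proof.
move=> m0 mn x0; rewrite !npowE //; last exact: leq_trans mn.
have : ln (INR m) <= ln (INR n).
  by apply: ln_le; [apply: lt_0_INR; apply/ltP | apply: le_INR; apply/leP].
move=> h; have := Rmult_le_compat_l _ _ _ x0 h => h'.
case: (Req_dec (x * ln (INR m)) (x * ln (INR n))) => [->|ne]; first lra.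
by apply: Rlt_le; apply: exp_increasing; lra.
Qed.

Lemma prod_primes_le_self n : (0 < n)%N -> (\prod_(p <- primes n) p <= n)%N.
Proof.
move=> n0; rewrite {2}(prod_prime_decomp n0) /primes big_map big_seq [X in (_ <= X)%N]big_seq.
apply: leq_prod => -[p e] /mem_prime_decomp[pp e0 _] /=.
by rewrite -{1}(expn1 p) leq_exp2l ?prime_gt1.
Qed.

(** A prime with [p^d >= B] pays for its factor [B] by its share of [n^d]; the other primes lie
    below a fixed [P0], so there are at most [P0] of them. *)
Lemma omega_bound (B d : R) : 1 <= B -> 0 < d -> exists2 K, 1 <= K &
  forall n, (0 < n)%N -> \big[Rmult/1]_(p <- primes n) B <= K * npow n d.
Proof.
move=> B1 d0.
have [P0 hP0] := INR_unbounded (exp (ln B / d)).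
have big p : (P0 <= p)%N -> B <= npow p d.
  move=> hp; have p0 : (0 < p)%N.
    by move: hp; case: p => //; rewrite leqn0 => /eqP E; move: hP0; rewrite E /=; have := exp_pos (ln B / d); lra.
  have h : exp (ln B / d) <= INR p by have := le_INR P0 p ltac:(exact/leP); lra.
  have h2 : ln B / d <= ln (INR p) by rewrite -[X in X <= _]ln_exp; apply: ln_le => //; exact: exp_pos.
  have h3 : ln B <= d * ln (INR p).
    have := Rmult_le_compat_l d _ _ (Rlt_le _ _ d0) h2.
    by have -> : d * (ln B / d) = ln B by field; lra.
  rewrite npowE // -{1}(exp_ln B); last lra.
  by case: (Req_dec (ln B) (d * ln (INR p))) => [->|ne]; [lra | apply: Rlt_le; apply: exp_increasing; lra].
exists (B ^ P0); first exact: pow_R1_Rle.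
move=> n n0.
have step p : p \in primes n -> 0 <= B <= (if (p < P0)%N then B else 1) * npow p d.
  move=> pn; have p0 : (0 < p)%N by move: pn; rewrite mem_primes => /and3P[/prime_gt0].
  split; first lra.
  have := @npow_ge1 p d p0 (Rlt_le _ _ d0); case: ltnP => [_|/big]; nra.
apply: Rle_trans (proj2 (rprod_le step)) _; rewrite big_split /=.
have nn : 0 <= \big[Rmult/1]_(p <- primes n) npow p d.
  by apply: (proj1 (@rprod_le _ _ (fun p => npow p d) _)) => p _; have := npow_ge0 p d; lra.
apply: Rmult_le_compat => //.
- apply: (proj1 (@rprod_le _ _ (fun p => (if (p < P0)%N then B else 1)) _)) => p _; case: ifP; lra.
- rewrite -big_mkcond /= -big_filter.
  have : (size [seq p <- primes n | (p < P0)%N] <= P0)%N.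
    rewrite -{2}(size_iota 0 P0); apply: uniq_leq_size; first by rewrite filter_uniq ?primes_uniq.
    by move=> p; rewrite mem_filter mem_iota => /andP[].
  move=> /leP h; apply: Rle_trans (Rle_pow B _ _ B1 h).
  right; elim: [seq _ <- _ | _] => [|p s IH] /=; rewrite ?big_nil // big_cons IH //.
- apply: Rle_trans (_ : npow (\prod_(p <- primes n) p)%N d <= _).
    right; elim: (primes n) => [|p s IH]; last by rewrite !big_cons npow_mul IH.
    by rewrite !big_nil /= ln_1 Rmult_0_r exp_0.
  apply: npow_leq; [|exact: prod_primes_le_self|lra].
  rewrite big_seq; apply: prodn_cond_gt0 => p; rewrite mem_primes => /and3P[/prime_gt0] //.
Qed.

Lemma muk_bound k d : 0 < d -> exists2 K, 1 <= K & forall n, Rabs (muk k n) * npow n (- d) <= K.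
Proof.
move=> d0; have B1 : 1 <= INR (2 ^ k)%N by apply: (le_INR 1); apply/leP; rewrite expn_gt0.
have [K K1 HK] := omega_bound B1 d0.
exists K => // -[|n]; first by rewrite /= Rmult_0_r; lra.
have : Rabs (muk k n.+1) <= K * npow n.+1 d.
  apply: Rle_trans (HK n.+1 isT).
  have -> : Rabs (muk k n.+1) = \big[Rmult/1]_(p <- primes n.+1) Rabs (mob k (logn p n.+1)).
    by rewrite /muk; elim/big_rec2: _ => [|p x y _ <-]; rewrite ?Rabs_R1 // Rabs_mult.
  by apply: (proj2 (@rprod_le _ _ _ _)) => p _; split; [exact: Rabs_pos | exact: mob_abs].
move=> h; have E : npow n.+1 d * npow n.+1 (- d) = 1.
  by rewrite -npow_add /= Rplus_opp_r Rmult_0_l exp_0.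
have := Rmult_le_compat_r _ _ _ (npow_ge0 n.+1 (- d)) h.
by rewrite Rmult_assoc E; lra.
Qed.

Lemma adm_muk k u c : c < 1 -> (forall n, Cmod (u n) <= 1) -> adm c (fun n => RtoC (muk k n) * u n)%C.
Proof.
(* Half of the gap [1 - c] absorbs [muk k n]; the other half keeps the exponent [(c - 3) / 2] below
   [-1]. *)
move=> c1 hu; have d0 : 0 < (1 - c) / 2 by lra.
have [K K1 HK] := muk_bound k d0.
apply: summ_le (summ_scal (RtoC K) (@summ_npow ((c - 3) / 2) ltac:(lra))) _ => n.
rewrite !Cmod_mult !Cmod_R (Rabs_pos_eq K); last lra.
rewrite !(Rabs_pos_eq (npow _ _)); try exact: npow_ge0.
have -> : npow n (c - 2) = npow n (- ((1 - c) / 2)) * npow n ((c - 3) / 2).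
  by rewrite -npow_add; congr npow; field.
have := HK n; have := npow_ge0 n ((c - 3) / 2); have := npow_ge0 n (- ((1 - c) / 2)).
set a := npow _ _; set b := npow _ _ => a0 b0 h.
have := Rabs_pos (muk k n); have := Cmod_ge_0 (u n); have := hu n; set x := Rabs _ in h *; set y := Cmod _.
move=> y1 y0 x0.
have h2 : x * y * a <= K.
  apply: Rle_trans h; have : 0 <= x * a by apply: Rmult_le_pos.
  by nra.
have := Rmult_le_compat_r b _ _ b0 h2; lra.
Qed.

End MuK.

(** * Zero-free disc and Taylor coefficients of [L(s, chi)] *)

Section LFunction.

Variables (chi : nat -> C) (B : R).
Hypothesis chi_mul : completely_mult chi.
Hypothesis chi_unit : forall n, chi n = RtoC 0 \/ Cmod (chi n) = 1.
Hypothesis chi_psum : psum_le chi B.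

Lemma chi_le1 n : Cmod (chi n) <= 1.
Proof. by case: (chi_unit n) => ->; rewrite ?Cmod_0; lra. Qed.

Lemma twist_mul t m n : (0 < m)%N -> (0 < n)%N -> twist t (m * n)%N = (twist t m * twist t n)%C.
Proof.
move=> m0 n0; rewrite /twist ln_mulnat // Rmult_plus_distr_l cos_plus sin_plus.
by apply: injective_projections => /=; ring.
Qed.

Lemma twisted_mul t : completely_mult (twisted chi t).
Proof.
have [c1 cM] := chi_mul; split.
  by rewrite /twisted c1 /twist ln_1 Rmult_0_r cos_0 sin_0; apply: injective_projections => /=; ring.
by move=> m n m0 n0; rewrite /twisted cM // twist_mul //; ring.
Qed.

Lemma twisted_unit t n : twisted chi t n = RtoC 0 \/ Cmod (twisted chi t n) = 1.
Proof.
rewrite Cmod_twisted; case: (chi_unit n) => E; [left | by right].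
by rewrite /twisted E Cmult_0_l.
Qed.

Lemma twisted_le1 t n : Cmod (twisted chi t n) <= 1.
Proof. by rewrite Cmod_twisted; exact: chi_le1. Qed.

(** The Taylor coefficients of [L(2 - z, u)^(-k)]. *)
Definition dmuk (u : nat -> C) (k : nat) : nat -> C := dtaylor (fun n => RtoC (muk k n) * u n)%C.

Lemma dtaylor_ext a b j : (forall n, (0 < n)%N -> a n = b n) -> dtaylor a j = dtaylor b j.
Proof.
move=> H; apply: tot_ext => -[|n]; first by rewrite !tcoef_at0 !Cmult_0_r.
by rewrite H.
Qed.

Lemma dmuk0 u : completely_mult u -> dmuk u 0 = sone.
Proof.
case=> u1 _; apply: functional_extensionality => j.
rewrite /dmuk /dtaylor (@tot_fin _ _ [:: 1%N]) // => [|n].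
  rewrite big_seq1 muk1 u1 /tcoef [npow 1 _]/= [INR 1]/= ln_1 Rmult_0_r exp_0 Rmult_1_l !Cmult_1_l.
  by case: j => [|j]; [rewrite /expterm /= /Rdiv Rinv_1 Rmult_1_r | rewrite expterm_S0].
rewrite mem_seq1; case: n => [|[|n]] //; first by rewrite tcoef_at0 Cmult_0_r.
by rewrite muk0 // !Cmult_0_l.
Qed.

Lemma dmuk_cauchy u k : completely_mult u -> (forall n, Cmod (u n) <= 1) ->
  cauchy (dtaylor u) (dmuk u k.+1) = dmuk u k.
Proof.
move=> hu u1; apply: functional_extensionality => j.
rewrite /dmuk -(@dtaylor_conv _ _ (1 / 2)); [|lra| |].
- by apply: dtaylor_ext => n n0; apply: dconv_muk.
- by apply: adm_bounded u1; lra.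
by apply: adm_muk => //; lra.
Qed.

(** Telescoping with [1 / n^2 <= 1 / (n - 1) - 1 / n], begun only after the exact terms [1 + 1/4]:
    the sum from [n = 2] on then stays below [3/4], which separates [L(s, chi)] from [0] for
    [Re s >= 2]. *)
Lemma inv_square_sum N : \rs_(n < N.+3) npow n (-2) <= 7 / 4 - / INR N.+2.
Proof.
have sq n : (0 < n)%N -> npow n (-2) = / INR n * / INR n.
  by move=> n0; rewrite -npowN1 // -npow_add; congr npow; ring.
elim: N => [|N IH].
  by rewrite !big_ord_recr big_ord0 /= -/(npow 1 (-2)) -/(npow 2 (-2)) !sq //=; lra.
rewrite big_ord_recr [nat_of_ord _]/=; apply: Rle_trans (Rplus_le_compat_r _ _ _ IH) _.
rewrite sq //; have := S_INR N.+2; have := INRS_gt0 N.+1; set x := INR N.+2; set y := INR N.+3 => x0 yx.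
have -> : 7 / 4 - / x + / y * / y = 7 / 4 - / y - / (x * y * y) by rewrite yx; field; lra.
have : 0 < / (x * y * y); last lra.
by apply: Rinv_0_lt_compat; apply: Rmult_lt_0_compat; [apply: Rmult_lt_0_compat|]; lra.
Qed.

Lemma Cmod_npow_neg n s : (0 < n)%N -> Cmod (npow_neg n s) = npow n (- Re s).
Proof.
move=> n0; rewrite npowE // /npow_neg.
have -> : ((exp (- Re s * ln (INR n)) * cos (Im s * ln (INR n)),
   - (exp (- Re s * ln (INR n)) * sin (Im s * ln (INR n)))) : C)
   = (RtoC (exp (- Re s * ln (INR n))) * twist (Im s) n)%C.
  by apply: injective_projections => /=; ring.
by rewrite Cmod_mult Cmod_twist Cmod_R Rmult_1_r Rabs_pos_eq //; apply: Rlt_le; apply: exp_pos.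
Qed.

Lemma dirichlet_partial_near1 s N : 2 <= Re s -> Cmod (dirichlet_partial chi s N.+1 - 1)%C <= 3 / 4.
Proof.
move=> hs; rewrite npow_neg_zero_coef big_ord_recl.
have -> : npow_neg 1 s = RtoC 1.
  by rewrite /npow_neg ln_1 !Rmult_0_r exp_0 cos_0 sin_0; apply: injective_projections => /=; ring.
have [-> _] := chi_mul.
set x := (\big[_/_]_(_ < _) _); have -> : (1 * 1 + x - 1 = x)%C by ring.
apply: Rle_trans (Cmod_csum _ _ _) _.
apply: Rle_trans (_ : \rs_(n < N) npow n.+2 (-2) <= _).
  apply: rsum_le => n; rewrite lift0 Cmod_mult Cmod_npow_neg //.
  have := chi_le1 n.+2; have := @npow_le n.+2 (- Re s) (-2) ltac:(lra).
  by have := npow_ge0 n.+2 (- Re s); have := Cmod_ge_0 (chi n.+2); nra.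
have := inv_square_sum N; have := Rinv_0_lt_compat _ (INRS_gt0 N.+1).
have : 1 + \rs_(n < N) npow n.+2 (-2) <= \rs_(n < N.+3) npow n (-2); last lra.
have -> : \rs_(n < N.+3) npow n (-2) = \rs_(n < N.+2) npow n (-2) + npow N.+2 (-2) by rewrite big_ord_recr.
have -> : \rs_(n < N.+2) npow n (-2) = npow 0 (-2) + (npow 1 (-2) + \rs_(n < N) npow n.+2 (-2)).
  by rewrite big_ord_recl big_ord_recl.
have -> : npow 1 (-2) = 1 by rewrite /= ln_1 Rmult_0_r exp_0.
by have := npow_ge0 0 (-2); have := npow_ge0 N.+2 (-2); lra.
Qed.

Hypothesis chi_grh : forall s : C, 0 < Re s < 1 -> Ccv (dirichlet_partial chi s) (RtoC 0) -> Re s = 1 / 2.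

Lemma dtaylor_chi_bound t j : Cmod (dtaylor (twisted chi t) j) <= 2 * B * twist_const t * (4 / 7) ^ j.
Proof. exact: dtaylor_twisted_bound chi_le1 chi_psum. Qed.

Lemma twisted0 : twisted chi 0 = chi.
Proof. by apply: functional_extensionality => n; rewrite /twisted twist0 Cmult_1_r. Qed.

Lemma dirichlet_line t x : Rabs x <= 3 / 2 ->
  Ccv (dirichlet_partial chi (2 - x, t)) (pser (dtaylor (twisted chi t)) (RtoC x)).
Proof.
move=> hx; have := dirichlet_taylor t chi_le1 chi_psum (z := RtoC x).
rewrite Cmod_R => /(_ hx); have -> : ((2, t) - RtoC x)%C = (2 - x, t); last by [].
by apply: injective_projections => /=; ring.
Qed.

Lemma dirichlet_disc z : Cmod z <= 3 / 2 ->
  Ccv (dirichlet_partial chi (RtoC 2 - z)%C) (pser (dtaylor chi) z).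
Proof.
by move=> hz; have := dirichlet_taylor 0 chi_le1 chi_psum hz; rewrite twisted0.
Qed.

(** In the region of absolute convergence the product with the series of [muk 1] is [1]. *)
Lemma pser_chi_neq0_abs t x : 0 < x < 1 -> pser (dtaylor (twisted chi t)) (RtoC x) <> RtoC 0.
Proof.
move=> hx Z; pose u := twisted chi t.
have hu := twisted_mul t; have u1 := twisted_le1 t.
have S1 : summ (fun j => dtaylor u j * RtoC x ^ j)%C.
  by apply: (summ_geo (dtaylor_chi_bound t)); rewrite ?Cmod_R ?Rabs_pos_eq; lra.
have S2 : summ (fun j => dmuk u 1 j * RtoC x ^ j)%C.
  (* Strictly between [x] and [1]: [adm_muk] asks for [c < 1], convergence at [x] for
     [x / c < 1]. *)
  pose c := (1 + x) / 2.
  have [M M0 HM] := @dtaylor_le c _ ltac:(rewrite /c; lra) (@adm_muk 1 u c ltac:(rewrite /c; lra) u1).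
  have c0 : 0 < c by rewrite /c; lra.
  apply: (summ_geo HM); first by apply: Rlt_le; apply: Rinv_0_lt_compat.
  rewrite Cmod_R Rabs_pos_eq; last lra.
  apply: (Rmult_lt_reg_l c) => //; rewrite -Rmult_assoc Rinv_r; rewrite /c; lra.
have := pser_cauchy S1 S2; rewrite dmuk_cauchy // dmuk0 // pser_sone Z Cmult_0_l.
by case; lra.
Qed.

(** The cases for [Re s], with [s = 2 - z]: [[3/4, 1)] is [GRH], the line [1] is
    [landau_nonvanishing], [(1, 2)] is [pser_chi_neq0_abs], and from [2] on the series is within
    [3/4] of [1]. *)
Lemma pser_chi_neq0 z : Cmod z <= 5 / 4 -> pser (dtaylor chi) z <> RtoC 0.
Proof.
move=> hz Z; have L := @dirichlet_disc z ltac:(lra); rewrite Z in L.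
set s := (RtoC 2 - z)%C in L.
have rs : 3 / 4 <= Re s.
  have := re_le_Cmod z; have := Rle_abs (Re z).
  have -> : Re s = 2 - Re z by rewrite /s; case: z {hz Z L s} => x y /=; ring.
  lra.
case: (Rlt_le_dec (Re s) 1) => h1.
  by have := chi_grh (s := s) ltac:(lra) L; lra.
case: (Rlt_le_dec (Re s) 2) => h2; last first.
  have := Ccv_bound (Ccv_add (Ccv_shiftS L) (Ccv_const (- RtoC 1)%C)) (fun N => @dirichlet_partial_near1 s N h2).
  by rewrite Cplus_0_l Cmod_opp Cmod_1; lra.
(* Recentring at [2 + i Im s] replaces the complex [z] by the real [2 - Re s], the form that both
   remaining nonvanishing lemmas take; uniqueness of limits identifies the two values. *)
have es : s = (2 - (2 - Re s), Im s) by case: (s) => x y; apply: injective_projections => /=; ring.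
have := dirichlet_line (Im s) (x := 2 - Re s); rewrite -es => /(_ _)/Ccv_unique H.
have {}H := H _ _ L.
have Z' : pser (dtaylor (twisted chi (Im s))) (RtoC (2 - Re s)) = RtoC 0.
  by apply: H; rewrite Rabs_pos_eq; lra.
case: (Req_dec (Re s) 1) => E.
  rewrite E (_ : 2 - 1 = 1) in Z'; last ring.
  apply: landau_nonvanishing (twisted_mul (Im s)) (twisted_le1 _) _ (dtaylor_chi_bound _) Z' => p _.
  exact: twisted_unit.
by apply: (@pser_chi_neq0_abs (Im s) (2 - Re s)) => //; lra.
Qed.

Lemma dtaylor_chi_0 : 1 / 4 <= Cmod (dtaylor chi 0).
Proof.
have L := @dirichlet_disc (RtoC 0) ltac:(rewrite Cmod_0; lra).
have E : pser (dtaylor chi) (RtoC 0) = dtaylor chi 0.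
  rewrite /pser (@tot_fin _ _ [:: 0%N]) ?big_seq1 /= ?Cmult_1_r // => -[|j] //= _.
  by rewrite !Cmult_0_l Cmult_0_r.
rewrite E in L; have h2 : 2 <= Re (RtoC 2 - RtoC 0)%C by rewrite /=; lra.
have := Ccv_bound (Ccv_add (Ccv_shiftS L) (Ccv_const (- RtoC 1)%C)) (fun N => @dirichlet_partial_near1 _ N h2).
set w := dtaylor chi 0 => h.
have := Cmod_triangle w (- (w + - RtoC 1))%C; rewrite Cmod_opp.
have -> : (w + - (w + - RtoC 1) = RtoC 1)%C by ring.
by rewrite Cmod_1; lra.
Qed.

Lemma Lfun_pser : Lfun chi (RtoC 1) = pser (dtaylor chi) (RtoC 1).
Proof.
have L := @dirichlet_disc (RtoC 1) ltac:(rewrite Cmod_1; lra).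
have E1 : (RtoC 2 - RtoC 1)%C = RtoC 1 by rewrite -RtoC_minus; congr RtoC; ring.
rewrite E1 in L; set l := pser _ _ in L *.
have eta (w : C) : w = (Re w, Im w) by case: w.
rewrite [RHS]eta /Lfun; congr pair.
  rewrite (@is_lim_seq_unique _ (Rbar.Finite (Re l))) //; apply/is_lim_seq_spec => eps.
  have [N HN] := L eps (cond_pos eps); exists N => n hn.
  apply: Rle_lt_trans (HN n hn); apply: Rle_trans (re_le_Cmod _).
  by right; congr Rabs; rewrite /Cminus /= /Re; ring.
rewrite (@is_lim_seq_unique _ (Rbar.Finite (Im l))) //; apply/is_lim_seq_spec => eps.
have [N HN] := L eps (cond_pos eps); exists N => n hn.
apply: Rle_lt_trans (HN n hn); apply: Rle_trans (im_le_Cmod _).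
by right; congr Rabs; rewrite /Cminus /= /Im; ring.
Qed.

End LFunction.

(** * Roots of complex polynomials *)

Section ComplexRoots.

Import mathcomp.algebra.ssralg mathcomp.reals_stdlib.Rstruct mathcomp.real_closed.complex.

Let toC (z : complex R) : C := (complex.Re z, complex.Im z).
Let ofC (z : C) : complex R := @complex.Complex R (fst z) (snd z).

Lemma toC_mul (x y : complex R) : toC (GRing.mul x y) = Cmult (toC x) (toC y).
Proof. by case: x => a b; case: y => c d; apply: injective_projections. Qed.

Lemma toC_add (x y : complex R) : toC (GRing.add x y) = Cplus (toC x) (toC y).
Proof. by case: x => a b; case: y => c d; apply: injective_projections. Qed.

Lemma toC_exp (x : complex R) n : toC (GRing.exp x n) = Cpow (toC x) n.
Proof.
elim: n => [|n IH]; first by apply: injective_projections.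
by rewrite GRing.exprS toC_mul IH.
Qed.

(** Algebraic closedness of [complex R], transported along the coordinatewise identification with
    [C]. *)
Lemma Croot_exists (P : nat -> C) n : (0 < n)%N ->
  exists x : C, Cpow x n = \cs_(i < n) Cmult (P i) (Cpow x i).
Proof.
move=> n0; have [x Hx] := @GRing.solve_monicpoly (complex R) n (fun i => ofC (P i)) n0.
exists (toC x); rewrite -toC_exp Hx.
elim/big_rec2: _ => [|i y z _ <-]; first by apply: injective_projections.
rewrite toC_add toC_mul toC_exp; congr (Cplus (Cmult _ _) _); by case: (P i).
Qed.

End ComplexRoots.

(** * Factorization of polynomials and Newton's identity *)

Section Factorization.

Definition linser (w : C) (j : nat) : C := if j is j'.+1 then (if j' is 0%N then - w else RtoC 0)%C else RtoC 1.
Definition geoser (w : C) (j : nat) : C := (w ^ j)%C.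
Definition constser (c : C) (j : nat) : C := if j is 0%N then c else RtoC 0.
Definition fin_supp (a : nat -> C) (N : nat) : Prop := forall j, (N < j)%N -> a j = RtoC 0.

Lemma fin_supp_tot (a : nat -> C) N z : fin_supp a N ->
  pser a z = \cs_(j < N.+1) (a j * z ^ j)%C.
Proof.
move=> H; rewrite /pser (@tot_fin _ _ (iota 0 N.+1)) ?iota_uniq //.
  by rewrite -(big_mkord xpredT (fun j => a j * z ^ j)%C) /index_iota subn0.
by move=> j; rewrite mem_iota add0n /= ltnS -ltnNge => /H ->; rewrite Cmult_0_l.
Qed.

Lemma fin_supp_summ (a : nat -> C) N z : fin_supp a N -> summ (fun j => a j * z ^ j)%C.
Proof.
move=> H; apply: (@summ_fin _ _ (iota 0 N.+1)) (iota_uniq _ _) _ => j.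
by rewrite mem_iota add0n /= ltnS -ltnNge => /H ->; rewrite Cmult_0_l.
Qed.

Lemma linser_cauchy w a j : cauchy (linser w) a j.+1 = (a j.+1 - w * a j)%C.
Proof.
rewrite /cauchy big_ord_recl big_ord_recl big1 => [|i _]; last by rewrite !lift0 /= Cmult_0_l.
transitivity (1 * a (j.+1 - 0)%N + (- w * a (j.+1 - 1)%N + 0))%C; first by [].
by rewrite subn0 subn1 succnK; ring.
Qed.

Lemma linser_cauchy0 w a : cauchy (linser w) a 0%N = a 0%N.
Proof. by rewrite /cauchy big_ord_recl big_ord0 /= subn0; ring. Qed.

Lemma linser_geoser w : cauchy (linser w) (geoser w) = sone.
Proof.
apply: functional_extensionality => -[|j]; first by rewrite linser_cauchy0.
by rewrite linser_cauchy /geoser Cpow_S /=; ring.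
Qed.

Lemma constser_cauchy c a j : cauchy (constser c) a j = (c * a j)%C.
Proof.
rewrite /cauchy big_ord_recl big1 => [|i _]; last by rewrite lift0 /= Cmult_0_l.
by rewrite /= subn0; ring.
Qed.

Lemma linser_fin w : fin_supp (linser w) 1.
Proof. by move=> [|[|j]]. Qed.

Lemma pser_linser w z : pser (linser w) z = (1 - w * z)%C.
Proof. by rewrite (fin_supp_tot _ (@linser_fin w)) !big_ord_recl big_ord0 /=; ring. Qed.

Definition linprod (ws : seq C) : nat -> C := foldr (fun w a => cauchy (linser w) a) sone ws.
Definition geoprod (ws : seq C) : nat -> C := foldr (fun w a => cauchy (geoser w) a) sone ws.

Add Ring series_ring' : series_ring_theory.

Lemma linprod_geoprod ws : cauchy (linprod ws) (geoprod ws) = sone.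
Proof.
elim: ws => [|w ws IH] /=; first exact: cauchy1l.
transitivity (cauchy (cauchy (linser w) (geoser w)) (cauchy (linprod ws) (geoprod ws))); first ring.
by rewrite linser_geoser IH cauchy1l.
Qed.

(** Induction on the degree. A root [r] lies outside the disc; multiplying by the geometric series
    of [w = / r] divides by [1 - w z], and the quotient again has no zero in the disc. Inverse roots
    are recorded because the factors [1 - w z] are [1] at [z = 0]. *)
Lemma factor_polynomial (Rad : R) N (P : nat -> C) : 0 < Rad -> fin_supp P N -> P 0%N <> RtoC 0 ->
  (forall z, Cmod z <= Rad -> pser P z <> RtoC 0) ->
  exists2 ws : seq C, P = cauchy (constser (P 0%N)) (linprod ws) &
    List.Forall (fun w => Cmod w * Rad < 1) ws.
Proof.
move=> R0; elim: N P => [|N IH] P fP P0 nz.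
  exists [::]; last exact: List.Forall_nil.
  apply: functional_extensionality => -[|j]; rewrite constser_cauchy /=; first by ring.
  by rewrite fP //; ring.
case: (classic (P N.+1 = RtoC 0)) => [PN|PN].
  apply: IH => // j; rewrite leq_eqVlt => /orP[/eqP <- //|]; exact: fP.
have [r Hr] := Croot_exists (fun i => - (P i / P N.+1))%C (ltn0Sn N).
have Pr : pser P r = RtoC 0.
  have E : \cs_(j < N.+2) (P j * r ^ j)%C = (\cs_(j < N.+1) (P j * r ^ j) + P N.+1 * r ^ N.+1)%C.
    by rewrite big_ord_recr.
  rewrite (fin_supp_tot _ fP) E Hr big_distrr -big_split big1 // => i _ /=.
  by field.
have r0 : r <> RtoC 0.
  move=> E; apply: P0; rewrite -Pr E (fin_supp_tot _ fP) big_ord_recl big1 => [|i _].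
    by rewrite /=; ring.
  by rewrite lift0 Cpow_S; ring.
have rR : Rad < Cmod r by apply: Rnot_le_lt => /nz; apply.
pose w := (/ r)%C.
have wR : Cmod w * Rad < 1.
  rewrite /w Cmod_inv //; apply: (Rmult_lt_reg_l (Cmod r)); first lra.
  by rewrite -Rmult_assoc Rinv_r; lra.
pose Q := cauchy (geoser w) P.
have QP : cauchy (linser w) Q = P.
  by rewrite /Q cauchyA linser_geoser cauchy1l.
have Q0 : Q 0%N = P 0%N by rewrite -QP linser_cauchy0.
have QS j : Q j.+1 = (P j.+1 + w * Q j)%C by rewrite -{1}QP linser_cauchy; ring.
(* The quotient series terminates: its coefficient at [N.+1] is [w^(N+1) P(r) = 0], and the later
   ones follow from [Q j.+1 = w * Q j]. *)
have QN : Q N.+1 = RtoC 0.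
  have -> : Q N.+1 = (w ^ N.+1 * pser P r)%C; last by rewrite Pr; ring.
  rewrite (fin_supp_tot _ fP) /Q cauchyC /cauchy big_distrr; apply: eq_bigr => i _.
  have iN : (i <= N.+1)%N by rewrite -ltnS ltn_ord.
  have -> : (w ^ N.+1 = w ^ (N.+1 - i)%N * w ^ i)%C by rewrite -Cpow_add subnK.
  have wr : (w ^ i * r ^ i)%C = RtoC 1.
    rewrite -Cpow_mult_l /w Cinv_l //; exact: Cpow_1_l.
  rewrite /geoser; transitivity (P i * w ^ (N.+1 - i)%N * (w ^ i * r ^ i))%C; last by rewrite /=; ring.
  by rewrite wr /=; ring.
have fQ : fin_supp Q N.
  move=> j; elim: j => // j IHj; rewrite leq_eqVlt => /orP[/eqP [<-] //|Nj].
  by rewrite QS fP ?IHj //; ring.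
have [||ws EQ Hws] := IH Q fQ; first by rewrite Q0.
  move=> z hz E; apply: (nz z hz).
  rewrite -QP pser_cauchy ?E; first ring.
    exact: fin_supp_summ (@linser_fin w).
  exact: fin_supp_summ fQ.
exists (w :: ws); last exact: List.Forall_cons.
by rewrite -{1}QP EQ Q0 /=; ring.
Qed.

(** The derivation [z d/dz] of the Cauchy product. *)
Definition theta (a : nat -> C) (j : nat) : C := (RtoC (INR j) * a j)%C.

Lemma theta_cauchy a b : theta (cauchy a b) = sadd (cauchy (theta a) b) (cauchy a (theta b)).
Proof.
apply: functional_extensionality => j; rewrite /theta /sadd /cauchy big_distrr -big_split /=.
apply: eq_bigr => i _; have ij : (i <= j)%N by rewrite -ltnS ltn_ord.
have -> : INR j = INR i + INR (j - i)%N by rewrite -plus_INR plusE subnKC.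
by rewrite RtoC_plus; ring.
Qed.

(** The series [w z / (1 - w z)], which is the logarithmic derivative of [1 / (1 - w z)] with
    respect to [theta]. Summed over the inverse roots, its coefficients are their power sums. *)
Definition powser (w : C) (j : nat) : C := if j is 0%N then RtoC 0 else (w ^ j)%C.
Definition powsums (ws : seq C) : nat -> C := foldr (fun w a => sadd (powser w) a) szero ws.

Lemma theta_geoser w : theta (geoser w) = cauchy (powser w) (geoser w).
Proof.
apply: functional_extensionality => j; rewrite /theta /cauchy big_ord_recl.
have -> : \cs_(i < j) (powser w (lift ord0 i) * geoser w (j - lift ord0 i)%N)%C = \cs_(i < j) (w ^ j)%C.
  apply: eq_bigr => i _; rewrite lift0 /= /geoser -Cpow_S -Cpow_add subnKC //.
by rewrite csum_const /index_enum -enumT size_enum_ord /= /geoser; ring.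
Qed.

Lemma theta_sone : theta sone = szero.
Proof. by apply: functional_extensionality => -[|j]; rewrite /theta /szero /=; ring. Qed.

Lemma theta_geoprod ws : theta (geoprod ws) = cauchy (powsums ws) (geoprod ws).
Proof.
elim: ws => [|w ws IH] /=; first by rewrite theta_sone; ring.
by rewrite theta_cauchy theta_geoser IH; ring.
Qed.

Fixpoint spow (a : nat -> C) (k : nat) : nat -> C := if k is k'.+1 then cauchy a (spow a k') else sone.

(** Iterated addition instead of a scalar factor, so that [ring] on series can treat it. *)
Fixpoint nscale (k : nat) (a : nat -> C) : nat -> C := if k is k'.+1 then sadd a (nscale k' a) else szero.

Lemma nscaleE k a j : nscale k a j = (RtoC (INR k) * a j)%C.
Proof.
elim: k => [|k IH]; first by rewrite /= /szero; ring.
by rewrite S_INR RtoC_plus /= /sadd IH; ring.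
Qed.

Lemma theta_spow_geoprod ws k :
  theta (spow (geoprod ws) k) = cauchy (nscale k (powsums ws)) (spow (geoprod ws) k).
Proof.
elim: k => [|k IH] /=; first by rewrite theta_sone; ring.
by rewrite theta_cauchy IH theta_geoprod; ring.
Qed.

Lemma powsums0 ws : powsums ws 0%N = RtoC 0.
Proof. by elim: ws => //= w ws IH; rewrite /sadd IH /=; ring. Qed.

(* Newton's identity for the power series [prod (1 - w z)^(-k)]. *)
Lemma newton_identity ws k j :
  (RtoC (INR j.+1) * spow (geoprod ws) k j.+1
   = RtoC (INR k) * \cs_(i < j.+1) (powsums ws i.+1 * spow (geoprod ws) k (j - i)%N))%C.
Proof.
have := theta_spow_geoprod ws k => /(f_equal (fun a => a j.+1)); rewrite {1}/theta => ->.
rewrite /cauchy big_ord_recl nscaleE powsums0 big_distrr /=.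
rewrite Cmult_0_r Cmult_0_l Cplus_0_l; apply: eq_bigr => i _.
by rewrite nscaleE /bump add1n subSS; ring.
Qed.

Lemma geoprod0 ws : geoprod ws 0%N = RtoC 1.
Proof.
elim: ws => //= w ws IH; rewrite /cauchy big_ord_recl big_ord0 /= subn0 IH /geoser /=; ring.
Qed.

Lemma spow0 a k : a 0%N = RtoC 1 -> spow a k 0%N = RtoC 1.
Proof.
move=> a0; elim: k => //= k IH; rewrite /cauchy big_ord_recl big_ord0 /= subn0 IH a0; ring.
Qed.

End Factorization.

(** * Binomial majorants and growth of inverse powers *)

Section Majorant.

(* The coefficients of [(1 - x)^(-L)]. *)
Fixpoint negbin (L j : nat) : R := if L is L'.+1 then \rs_(i < j.+1) negbin L' i else (if j is 0%N then 1 else 0).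

Lemma negbinS L j : negbin L.+1 j.+1 = negbin L.+1 j + negbin L j.+1.
Proof. by rewrite /= big_ord_recr. Qed.

Lemma negbinS0 L : negbin L 0 = 1.
Proof. by elim: L => //= L IH; rewrite big_ord_recr big_ord0 /= IH; ring. Qed.

(** The derivative of [(1 - x)^(-L)] is [L (1 - x)^(-(L+1))], coefficient by coefficient. *)
Lemma negbin_rec L j : INR j.+1 * negbin L j.+1 = INR L * negbin L.+1 j.
Proof.
elim: L j => [|L IHL] j; first by rewrite /=; ring.
elim: j => [|j IHj].
  have h := IHL 0%N; rewrite negbinS0 in h; rewrite negbinS !negbinS0 (S_INR L).
  have i1 : INR 1 = 1 by []; rewrite i1 in h *; lra.
rewrite negbinS Rmult_plus_distr_l IHL (S_INR j.+1) Rmult_plus_distr_r IHj (negbinS L.+1) (S_INR L); ring.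
Qed.

(** All terms are nonnegative, so a single one at [x = t] is at most the value [(1 - t)^(-L)] of the
    whole series. *)
Lemma negbin_le L j t : 0 < t < 1 -> negbin L j <= (/ t) ^ j * (/ (1 - t)) ^ L.
Proof.
move=> ht; have it : 0 < / t by apply: Rinv_0_lt_compat; lra.
have i1 : 1 < / t by rewrite -Rinv_1; apply: Rinv_lt_contravar; lra.
have iu : 0 < / (1 - t) by apply: Rinv_0_lt_compat; lra.
elim: L j => [|L IH] j.
  case: j => [|j]; first by rewrite /=; lra.
  by rewrite [negbin _ _]/= Rmult_1_r; apply: Rlt_le; apply: pow_lt.
apply: Rle_trans (_ : \rs_(i < j.+1) ((/ t) ^ i * (/ (1 - t)) ^ L) <= _).
  by apply: rsum_le => i; apply: IH.
rewrite -big_distrl /= Rmult_comm [X in _ <= X]Rmult_comm Rmult_comm.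
have pL : 0 <= (/ (1 - t)) ^ L by apply: pow_le; lra.
have -> : / (1 - t) * (/ (1 - t)) ^ L * (/ t) ^ j = ((/ t) ^ j * / (1 - t)) * (/ (1 - t)) ^ L by ring.
apply: Rmult_le_compat_r => //.
have H n : \rs_(i < n.+1) (/ t) ^ i = ((/ t) ^ n - t) / (1 - t).
  elim: n => [|n IHn]; first by rewrite big_ord_recr big_ord0 /=; field; lra.
  by rewrite big_ord_recr IHn /=; field; lra.
by rewrite H /Rdiv; apply: Rmult_le_compat_r; lra.
Qed.

(** [negbin L] satisfies the same recursion with equality, since [negbin L.+1 j] is the sum of
    [negbin L] up to [j]. *)
Lemma majorant_le (L : nat) (u : nat -> R) : u 0%N <= 1 ->
  (forall j, INR j.+1 * u j.+1 <= INR L * \rs_(i < j.+1) u i) -> forall j, u j <= negbin L j.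
Proof.
move=> u0 H; elim/ltn_ind => -[|j] IH; first by rewrite negbinS0.
apply: (Rmult_le_reg_l (INR j.+1)); first exact: INRS_gt0.
rewrite negbin_rec; apply: Rle_trans (H j) _; apply: Rmult_le_compat_l; first exact: pos_INR.
by apply: rsum_le_in => i _; apply: IH; rewrite ltn_ord.
Qed.

Lemma linear_geometric m : INR m * (24 / 25) ^ m <= 24.
Proof.
have H : 1 + INR m / 24 <= (25 / 24) ^ m.
  elim: m => [|m IH]; first by rewrite /=; lra.
  rewrite S_INR /=; have := pos_INR m; nra.
have E : (25 / 24) ^ m * (24 / 25) ^ m = 1.
  by rewrite -Rpow_mult_distr (_ : 25 / 24 * (24 / 25) = 1) ?pow1 //; field.
have p : 0 < (24 / 25) ^ m by apply: pow_lt; lra.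
have := Rmult_le_compat_r _ _ _ (Rlt_le _ _ p) H; rewrite E; nra.
Qed.

(* The ratio [8/9 = (5/6) / (15/16)] leaves room between [4/5] and [1]. *)
Lemma spow_geoprod_bound ws k T L : 0 <= T -> INR k * T * 24 <= INR L ->
  (forall m, (0 < m)%N -> Cmod (powsums ws m) <= INR m * T * (4 / 5) ^ m) ->
  forall j, Cmod (spow (geoprod ws) k j) <= 16 ^ L * (8 / 9) ^ j.
Proof.
(* The rescaling by [6/5 < 5/4] lets [(4/5 * 6/5)^m = (24/25)^m] absorb the factor [m] of the power
   sums at the cost of [24]; Newton's identity then becomes the recursive inequality of
   [majorant_le]. *)
move=> T0 hL hp j; pose u j := Cmod (spow (geoprod ws) k j) * (6 / 5) ^ j.
have kT : 0 <= INR k * T by apply: Rmult_le_pos => //; exact: pos_INR.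
have h : u j <= negbin L j.
  apply: majorant_le => [|i]; first by rewrite /u (spow0 _ (geoprod0 ws)) Cmod_1 /=; lra.
  rewrite /u -Rmult_assoc.
  have -> : INR i.+1 * Cmod (spow (geoprod ws) k i.+1)
     = Cmod (RtoC (INR i.+1) * spow (geoprod ws) k i.+1)%C.
    by rewrite Cmod_mult Cmod_R Rabs_pos_eq //; exact: pos_INR.
  rewrite newton_identity Cmod_mult Cmod_R (Rabs_pos_eq (INR k)); last exact: pos_INR.
  apply: Rle_trans (_ : INR k * (\rs_(m < i.+1) (T * 24 * u (i - m)%N)) <= _).
    rewrite Rmult_assoc; apply: Rmult_le_compat_l; first exact: pos_INR.
    apply: Rle_trans (Rmult_le_compat_r _ _ _ _ (Cmod_csum _ _ _)) _; first by apply: pow_le; lra.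
    rewrite big_distrl /=; apply: rsum_le => m; rewrite Cmod_mult /u.
    have hm := hp m.+1 isT; have lg := linear_geometric m.+1.
    have mi : (m <= i)%N by rewrite -ltnS ltn_ord.
    have -> : (6 / 5 * (6 / 5) ^ i) = (6 / 5) ^ m.+1 * (6 / 5) ^ (i - m)%N.
      by rewrite -pow_add -[6 / 5 * _]/((6 / 5) ^ i.+1) plusE addSn subnKC.
    set c := Cmod (spow _ _ _); set d := Cmod (powsums _ _) in hm *.
    have c0 : 0 <= c by apply: Cmod_ge_0.
    have p0 : 0 < (6 / 5) ^ m.+1 by apply: pow_lt; lra.
    have q0 : 0 <= (6 / 5) ^ (i - m)%N by apply: pow_le; lra.
    have h1 : d * (6 / 5) ^ m.+1 <= T * 24.
      apply: Rle_trans (Rmult_le_compat_r _ _ _ (Rlt_le _ _ p0) hm) _.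
      have E : (4 / 5) ^ m.+1 * (6 / 5) ^ m.+1 = (24 / 25) ^ m.+1.
        by rewrite -Rpow_mult_distr; congr (_ ^ _); field.
      have -> : INR m.+1 * T * (4 / 5) ^ m.+1 * (6 / 5) ^ m.+1 = T * (INR m.+1 * (24 / 25) ^ m.+1).
        by rewrite -E; ring.
      exact: Rmult_le_compat_l.
    have := Rmult_le_compat_r (c * (6 / 5) ^ (i - m)%N) _ _ (Rmult_le_pos _ _ c0 q0) h1; lra.
  rewrite -big_distrr /= -Rmult_assoc -Rmult_assoc.
  have -> : \rs_(m < i.+1) u (i - m)%N = \rs_(m < i.+1) u m.
    rewrite [RHS](reindex_inj rev_ord_inj) /=; apply: eq_bigr => m _.
    by rewrite subSS.
  apply: Rmult_le_compat_r => //; apply: rsum_ge0 => m _; apply: Rmult_le_pos; first exact: Cmod_ge_0.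
  by apply: pow_le; lra.
have nb := @negbin_le L j (15 / 16) ltac:(lra).
have E1 : / (1 - 15 / 16) = 16 by field.
have E2 : / (15 / 16) = 16 / 15 by field.
rewrite E1 E2 in nb.
have p : 0 < (5 / 6) ^ j by apply: pow_lt; lra.
have E3 : (6 / 5) ^ j * (5 / 6) ^ j = 1.
  by rewrite -Rpow_mult_distr (_ : 6 / 5 * (5 / 6) = 1) ?pow1 //; field.
have E4 : (16 / 15) ^ j * (5 / 6) ^ j = (8 / 9) ^ j.
  by rewrite -Rpow_mult_distr; congr (_ ^ _); field.
have := Rmult_le_compat_r _ _ _ (Rlt_le _ _ p) (Rle_trans _ _ _ h nb).
rewrite /u Rmult_assoc E3 Rmult_1_r => /Rle_trans; apply.
by right; rewrite -E4; ring.
Qed.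

End Majorant.

(** * Logarithms of linear factors, roots of unity, Borel-Caratheodory *)

Section BorelCaratheodory.

Lemma geom_sum (v : C) K : ((1 - v) * (\cs_(m < K) (v ^ m)) = 1 - v ^ K)%C.
Proof.
elim: K => [|K IH]; first by rewrite big_ord0 /=; ring.
by rewrite big_ord_recr /= Cmult_plus_distr_l IH; ring.
Qed.

Lemma Cmod_one_minus (v : C) : 1 - Cmod v <= Cmod (1 - v)%C.
Proof.
have := Cmod_triangle (1 - v)%C v; have -> : (1 - v + v = RtoC 1)%C by ring.
by rewrite Cmod_1; lra.
Qed.

(** For [x] in [[0, 1]], [ln |1 - u x|] plus its Taylor sum is a real function with derivative
    [Re (- u (u x)^K / (1 - u x))]; the mean value theorem for this function takes the place of a
    complex logarithm. *)
Lemma log_taylor (u : C) rho K : Cmod u <= rho < 1 ->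
  Rabs (ln (Cmod (1 - u)%C) + \rs_(m < K) (Re (u ^ m.+1)%C / INR m.+1)) <= rho ^ K.+1 / (1 - rho).
Proof.
move=> hu; have u0 := Cmod_ge_0 u.
pose a := Re u; pose b := Im u.
pose S x := (1 - a * x) ^ 2 + (b * x) ^ 2.
have SC x : S x = Cmod (1 - u * RtoC x)%C ^ 2.
  by rewrite Cmod2_alt /S /a /b; case: (u) => p q; rewrite /Re /Im /=; ring.
have bd x : 0 <= x <= 1 -> Cmod (u * RtoC x)%C <= rho.
  by move=> hx; rewrite Cmod_mult Cmod_R Rabs_pos_eq; [nra | lra].
have pos x : 0 <= x <= 1 -> 1 - rho <= Cmod (1 - u * RtoC x)%C.
  by move=> hx; have := Cmod_one_minus (u * RtoC x)%C; have := bd x hx; lra.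
have Spos x : 0 <= x <= 1 -> 0 < S x.
  by move=> hx; rewrite SC; apply: pow_lt; have := pos x hx; lra.
pose f x := / 2 * ln (S x) + \rs_(m < K) (Re (u ^ m.+1)%C / INR m.+1 * x ^ m.+1).
pose f' x := / 2 * ((2 * (1 - a * x) * - a + 2 * (b * x) * b) / S x) + \rs_(m < K) (Re (u ^ m.+1)%C * x ^ m).
have Df x : Rmin 0 1 <= x <= Rmax 0 1 -> derivable_pt_lim f x (f' x).
  rewrite Rmin_left ?Rmax_right; try lra; move=> hx.
  apply: derivable_pt_lim_plus.
    apply: derivable_pt_lim_scal.
    have -> : (2 * (1 - a * x) * - a + 2 * (b * x) * b) / S x
       = / S x * (2 * (1 - a * x) * - a + 2 * (b * x) * b) by rewrite /Rdiv Rmult_comm.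
    apply: (derivable_pt_lim_comp S ln); last by apply: derivable_pt_lim_ln; apply: Spos.
    by apply/is_derive_Reals; rewrite /S; auto_derive => //; ring.
  apply: (@derivable_rsum K (fun m x => Re (u ^ m.+1)%C / INR m.+1 * x ^ m.+1) (fun m => Re (u ^ m.+1)%C * x ^ m)) => m.
  have -> : Re (u ^ m.+1)%C * x ^ m = Re (u ^ m.+1)%C / INR m.+1 * (INR m.+1 * x ^ (m.+1).-1).
    by rewrite [Nat.pred _]/=; field; apply: not_0_INR.
  by apply: derivable_pt_lim_scal; apply: derivable_pt_lim_pow.
have [x [E hx]] := MVT_abs f f' 0 1 Df.
rewrite Rmin_left ?Rmax_right in hx; try lra.
have px := pos x hx; have rp : 0 < 1 - rho by lra.
have nz : (1 - u * RtoC x)%C <> RtoC 0.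
  by move=> Z; rewrite Z Cmod_0 in px; lra.
have E' : f' x = Re (- u * (u * RtoC x) ^ K / (1 - u * RtoC x))%C.
  have -> : (- u * (u * RtoC x) ^ K / (1 - u * RtoC x)
      = - u / (1 - u * RtoC x) + \cs_(m < K) (u ^ m.+1 * RtoC (x ^ m)))%C.
    have -> : \cs_(m < K) (u ^ m.+1 * RtoC (x ^ m))%C = (u * (\cs_(m < K) (u * RtoC x) ^ m))%C.
      rewrite big_distrr /=; apply: eq_bigr => m _.
      by rewrite RtoC_pow Cpow_mult_l; ring.
    have G := geom_sum (u * RtoC x)%C K.
    have -> : \cs_(m < K) ((u * RtoC x) ^ m)%C = ((1 - (u * RtoC x) ^ K) / (1 - u * RtoC x))%C.
      by rewrite -G; field.
    by field.
  rewrite /f' re_plus Re_csum; congr (_ + _).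
    have s0 : S x <> 0 by have := Spos x hx; lra.
    move: s0 nz; rewrite SC Cmod2_alt /a /b; case: (u) => p q /=; rewrite /Re /Im /= => s0 nz.
    by field => Z; apply: s0; rewrite -[RHS]Z; ring.
  by apply: eq_bigr => m _; rewrite /Re /=; ring.
have B : Rabs (f' x) <= rho ^ K.+1 / (1 - rho).
  rewrite E'; apply: Rle_trans (re_le_Cmod _) _.
  rewrite Cmod_div // Cmod_mult Cmod_opp Cmod_pow.
  have h1 : Cmod u * Cmod (u * RtoC x)%C ^ K <= rho ^ K.+1.
    apply: Rmult_le_compat => //; try lra; first by apply: pow_le; exact: Cmod_ge_0.
    by apply: pow_incr; split; [exact: Cmod_ge_0 | exact: bd].
  apply: Rmult_le_compat => //.
  - by apply: Rmult_le_pos => //; apply: pow_le; exact: Cmod_ge_0.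
  - by apply: Rlt_le; apply: Rinv_0_lt_compat; lra.
  exact: Rinv_le_contravar.
have f0 : f 0 = 0.
  rewrite /f big1 => [|m _]; last by rewrite -[0 ^ m.+1]/(0 * 0 ^ m) Rmult_0_l Rmult_0_r.
  by rewrite /S !Rmult_0_r Rminus_0_r (_ : 1 ^ 2 + 0 ^ 2 = 1) ?ln_1; ring.
have f1 : f 1 = ln (Cmod (1 - u)%C) + \rs_(m < K) (Re (u ^ m.+1)%C / INR m.+1).
  rewrite /f; congr (_ + _); last by apply: eq_bigr => m _; rewrite pow1 Rmult_1_r.
  rewrite SC; have -> : (1 - u * RtoC 1 = 1 - u)%C by ring.
  have q : 0 < Cmod (1 - u)%C by have := Cmod_one_minus u; lra.
  by rewrite /= Rmult_1_r ln_mult //; field.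
by rewrite -f1 -[f 1]Rminus_0_r -f0 E Rminus_0_r Rabs_R1 Rmult_1_r.
Qed.

Definition root1 (n : nat) : C := (cos (2 * PI / INR n), sin (2 * PI / INR n)).

Lemma root1_pow n m : (root1 n ^ m)%C = (cos (2 * PI / INR n * INR m), sin (2 * PI / INR n * INR m)).
Proof.
elim: m => [|m IH].
  by rewrite /= Rmult_0_r cos_0 sin_0.
rewrite Cpow_S IH S_INR Rmult_plus_distr_l Rmult_1_r Rplus_comm cos_plus sin_plus.
by apply: injective_projections => /=; ring.
Qed.

Lemma root1_n n : (0 < n)%N -> (root1 n ^ n)%C = RtoC 1.
Proof.
move=> /ltP n0; rewrite root1_pow; have -> : 2 * PI / INR n * INR n = 2 * PI.
  by field; apply: not_0_INR; lia.
by rewrite cos_2PI sin_2PI.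
Qed.

Lemma root1_neq1 n m : (0 < m < n)%N -> (root1 n ^ m)%C <> RtoC 1.
Proof.
move=> /andP[/ltP m0 /ltP mn]; rewrite root1_pow => -[E _].
pose x := PI / INR n * INR m.
have n0 : 0 < INR n by apply: lt_0_INR; lia.
have E2 : 2 * PI / INR n * INR m = 2 * x by rewrite /x; field; lra.
rewrite E2 cos_2a_sin in E.
have x0 : 0 < x.
  by apply: Rmult_lt_0_compat; [apply: Rdiv_lt_0_compat => //; exact: PI_RGT_0 | apply: lt_0_INR].
have xp : x < PI.
  have h : INR m < INR n by apply: lt_INR.
  have -> : PI = PI / INR n * INR n by field; lra.
  by apply: Rmult_lt_compat_l => //; apply: Rdiv_lt_0_compat => //; exact: PI_RGT_0.
have := sin_gt_0 x x0 xp; nra.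
Qed.

Lemma root1_sum n e : (0 < n)%N ->
  \cs_(t < n) ((root1 n ^ t) ^ e)%C = if (n %| e)%N then RtoC (INR n) else RtoC 0.
Proof.
move=> n0.
have sw (t : nat) : ((root1 n ^ t) ^ e = (root1 n ^ e) ^ t)%C by rewrite -!Cpow_mult_r Nat.mul_comm.
under eq_bigr => t _ do rewrite sw.
have red : (root1 n ^ e)%C = (root1 n ^ (e %% n)%N)%C.
  rewrite {1}(divn_eq e n) Cpow_add mulnC -multE Cpow_mult_r root1_n // Cpow_1_l; ring.
rewrite red; case: ifP => [/eqP -> | /negbT ne].
  under eq_bigr => t _ do rewrite /= Cpow_1_l.
  by rewrite csum_const /index_enum -enumT size_enum_ord; ring.
have G := geom_sum (root1 n ^ (e %% n)%N)%C n.
have Z : ((root1 n ^ (e %% n)%N) ^ n)%C = RtoC 1.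
  by rewrite -Cpow_mult_r Nat.mul_comm Cpow_mult_r root1_n // Cpow_1_l.
rewrite Z in G; set S := (\big[_/_]_(_ < _) _) in G *.
have nz : (1 - root1 n ^ (e %% n)%N)%C <> RtoC 0.
  move=> /Csub_eq0 E; apply: (@root1_neq1 n (e %% n)%N); last by rewrite E.
  by rewrite lt0n ltn_mod n0 andbT.
have -> : S = ((1 - root1 n ^ (e %% n)%N) * S / (1 - root1 n ^ (e %% n)%N))%C by field.
rewrite G; field; exact: nz.
Qed.

Lemma Cmod_root1 n : Cmod (root1 n) = 1.
Proof.
rewrite /root1 /Cmod /= !Rmult_1_r.
have := sin2_cos2 (2 * PI / INR n); rewrite /Rsqr => E.
by rewrite Rplus_comm E sqrt_1.
Qed.

(* Averaging [(A - Re H) (1 + Re (e w^(j+1)))] over roots of unity [w] of large order isolates one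
   coefficient of [H]. *)
Lemma borel_caratheodory (h : nat -> C) K A Rad j : 0 < Rad -> (j < K)%N ->
  (forall z, Cmod z = Rad -> Re (\cs_(m < K) (h m * z ^ m.+1)%C) <= A) ->
  Cmod (h j) * Rad ^ j.+1 <= 2 * A.
Proof.
(* With [n > 2 K] the frequencies [m + 1 + j + 1 <= 2 K] do not wrap around modulo [n]. *)
move=> R0 jK HA; have [n n2K] : {n | n = (K + K).+1} by exists (K + K).+1.
have n0 : (0 < n)%N by rewrite n2K.
have nR : 0 < INR n by rewrite n2K; apply: INRS_gt0.
pose w t := (root1 n ^ t)%C.
have w1 t : Cmod (w t) = 1 by rewrite /w Cmod_pow Cmod_root1 pow1.
(* The phase of [h j]; it enters the weight [W] so that the average isolates [Cmod (h j)] and not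
   merely a real part. *)
have [e [e1 he]] : exists e : C, Cmod e = 1 /\ Re (Cconj e * h j)%C = Cmod (h j).
  case: (classic (h j = RtoC 0)) => [->|nz].
    by exists (RtoC 1); rewrite Cmod_1 Cmod_0; split=> //; rewrite Cmult_0_r.
  have m0 : Cmod (h j) <> 0 by move=> /Cmod_eq_0.
  exists (h j / RtoC (Cmod (h j)))%C; split.
    rewrite Cmod_div; last by move=> /RtoC_inj.
    by rewrite Cmod_R Rabs_pos_eq; [field | exact: Cmod_ge_0].
  have -> : (Cconj (h j / RtoC (Cmod (h j))) * h j = RtoC (Cmod (h j)))%C; last by [].
  rewrite Cdiv_conj; last by move=> /RtoC_inj.
  have -> : Cconj (RtoC (Cmod (h j))) = RtoC (Cmod (h j)) by apply: injective_projections => /=; ring.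
  transitivity ((h j * Cconj (h j)) / RtoC (Cmod (h j)))%C; first by field; move=> /RtoC_inj.
  by rewrite -Cmod2_conj RtoC_pow; field; move=> /RtoC_inj.
pose W t := 1 + Re (e * w t ^ j.+1)%C.
have W0 t : 0 <= W t.
  have := re_le_Cmod (e * w t ^ j.+1)%C; rewrite Cmod_mult e1 Cmod_pow w1 pow1 => h1.
  by rewrite /W; have := Rle_abs (- Re (e * w t ^ j.+1)%C); rewrite Rabs_Ropp; lra.
have conjw t : Cconj (w t) = (w t ^ (n - 1)%N)%C.
  have c1 : (w t * Cconj (w t))%C = RtoC 1 by rewrite -Cmod2_conj w1 pow1.
  have c2 : (w t * w t ^ (n - 1)%N)%C = RtoC 1.
    by rewrite subn1 -Cpow_S prednK // /w -Cpow_mult_r Nat.mul_comm Cpow_mult_r root1_n // Cpow_1_l.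
  transitivity ((w t * w t ^ (n - 1)%N) * Cconj (w t))%C; first by rewrite c2; ring.
  transitivity ((w t * Cconj (w t)) * w t ^ (n - 1)%N)%C; first ring.
  by rewrite c1; ring.
have WC t : RtoC (W t) = (1 + / 2 * (e * w t ^ j.+1) + / 2 * (Cconj e * w t ^ ((n - 1) * j.+1)%N))%C.
  rewrite /W RtoC_plus re_alt Cmult_conj Cpow_conj conjw Cpow_mult_r.
  by field.
have sumw i : (0 < i < n)%N -> \cs_(t < n) (w t ^ i)%C = RtoC 0.
  move=> /andP[i0 i_n]; rewrite root1_sum //; case: ifP => // /(dvdn_leq i0).
  by rewrite leqNgt i_n.
(* Modulo [n] the exponent [(n - 1) * j.+1] is [- j.+1], so only the frequency [m = j] survives. *)
have sumc m : (m < K)%N -> \cs_(t < n) (w t ^ (m.+1 + (n - 1) * j.+1)%N)%C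
    = if m == j then RtoC (INR n) else RtoC 0.
  move=> mK; rewrite root1_sum //; congr (if _ then _ else _).
  have E : (m.+1 + (n - 1) * j.+1 + j.+1 = m.+1 + n * j.+1)%N.
    by rewrite -addnA -mulSnr subn1 prednK.
  have b1 : (m.+1 < n)%N by rewrite n2K ltnS; apply: leq_trans mK (leq_addr _ _).
  have b2 : (j.+1 < n)%N by rewrite n2K ltnS; apply: leq_trans jK (leq_addr _ _).
  apply/idP/eqP => [d | ->].
    have : ((m.+1 + (n - 1) * j.+1 + j.+1) %% n = (m.+1 + n * j.+1) %% n)%N by rewrite E.
    rewrite -modnDml (eqP d) add0n (modn_small b2) addnC mulnC modnMDl (modn_small b1).
    by case.
  by rewrite -mulSn subn1 prednK // dvdn_mulr.
pose T := \cs_(t < n) (RtoC (W t) * (\cs_(m < K) (h m * (RtoC Rad * w t) ^ m.+1)))%C.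
have T1 : Re T <= A * INR n.
  have sW : \rs_(t < n) W t = INR n.
    have Z : \cs_(t < n) (e * w t ^ j.+1)%C = RtoC 0.
      rewrite -big_distrr sumw; first exact: Cmult_0_r.
      by rewrite /= n2K ltnS (leq_trans jK) // leq_addr.
    rewrite big_split /= -(Re_csum _ _ (fun t : 'I_n => e * w t ^ j.+1)%C) Z.
    by rewrite rsum_const /index_enum -enumT size_enum_ord /=; ring.
  rewrite /T Re_csum -{1}sW big_distrr; apply: rsum_le => t; rewrite [X in _ <= X]/=.
  set H := (\big[_/_]_(_ < _) _).
  have -> : Re (RtoC (W t) * H)%C = Re H * W t by case: (H) => x y; rewrite /Re /=; ring.
  apply: Rmult_le_compat_r => //; apply: HA.
  by rewrite Cmod_mult w1 Cmod_R Rmult_1_r Rabs_pos_eq; lra.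
have T2 : T = (h j * RtoC (Rad ^ j.+1) * (/ 2 * Cconj e) * RtoC (INR n))%C.
  rewrite /T; under eq_bigr => t _ do rewrite big_distrr.
  rewrite exchange_big /=.
  have inner (m : 'I_K) : \cs_(t < n) (RtoC (W t) * (h m * (RtoC Rad * w t) ^ m.+1))%C
     = (if (m : nat) == j then h j * RtoC (Rad ^ j.+1) * (/ 2 * Cconj e) * RtoC (INR n) else 0)%C.
    transitivity (h m * RtoC (Rad ^ m.+1) * ((\cs_(t < n) (w t ^ m.+1))
      + / 2 * e * (\cs_(t < n) (w t ^ (j.+1 + m.+1)%N))
      + / 2 * Cconj e * (\cs_(t < n) (w t ^ (m.+1 + (n - 1) * j.+1)%N))))%C.
      rewrite !big_distrr -!big_split big_distrr /=; apply: eq_bigr => t _.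
      rewrite WC ?Cpow_mult_l !Cpow_add ?RtoC_mult ?RtoC_pow /=; ring.
    rewrite sumc // !sumw //=.
    - by case: eqP => [->|_]; ring.
    - by rewrite n2K addSn addnS !ltnS -addnS -addSn leq_add.
    by rewrite n2K ltnS; apply: leq_trans (ltn_ord m) (leq_addr _ _).
  under eq_bigr => m _ do rewrite inner.
  rewrite (bigD1 (Ordinal jK)) //= eqxx big1 ?Cplus_0_r // => m ne.
  by case: eqP => // E; case/eqP: ne; apply: val_inj.
have T3 : Re T = Cmod (h j) * Rad ^ j.+1 / 2 * INR n.
  have -> : T = (Cconj e * h j * RtoC (Rad ^ j.+1 / 2 * INR n))%C.
    by rewrite T2 /Rdiv 2!RtoC_mult (RtoC_inv 2) //; ring.
  rewrite -he; set x := (Cconj e * h j)%C; case: (x) => p q; rewrite /Re /=; field.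
have : Cmod (h j) * Rad ^ j.+1 / 2 <= A; last lra.
by apply: (Rmult_le_reg_r (INR n)) => //; rewrite -T3.
Qed.

End BorelCaratheodory.

(** * Bounds for the coefficients of inverse powers of a zero-free series *)

Section InversePowers.

Lemma RtoC_INRS m : RtoC (INR m.+1) <> RtoC 0.
Proof. by move/RtoC_inj; exact: not_0_INR. Qed.

Lemma linprod_fin ws : fin_supp (linprod ws) (size ws).
Proof.
elim: ws => [|w ws IH] [|j] //= hj.
by rewrite linser_cauchy !IH //; [ring | exact: ltnW].
Qed.

Lemma pser_linprod ws z : pser (linprod ws) z = \big[Cmult/RtoC 1]_(w <- ws) (1 - w * z)%C.
Proof.
elim: ws => [|w ws IH]; first by rewrite big_nil pser_sone.
rewrite big_cons /= pser_cauchy ?pser_linser ?IH //.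
  exact: fin_supp_summ (@linser_fin w).
exact: fin_supp_summ (@linprod_fin ws).
Qed.

Lemma common_radius ws Rad : List.Forall (fun w => Cmod w * Rad < 1) ws ->
  exists2 rho, 0 <= rho < 1 & List.Forall (fun w => Cmod w * Rad <= rho) ws.
Proof.
elim=> [|w l hw _ [rho hr IH]]; first by exists 0; [lra | exact: List.Forall_nil].
exists (Rmax rho (Cmod w * Rad)).
  by have := Rmax_l rho (Cmod w * Rad); split; [lra | apply: Rmax_lub_lt; lra].
apply: List.Forall_cons; first exact: Rmax_r.
by apply: List.Forall_impl IH => v /Rle_trans; apply; exact: Rmax_l.
Qed.

(** [log_taylor] summed over the factors: the logarithm of the product has coefficients
    [- powsums ws m.+1 / m.+1]. The error tends to zero as [K] grows, whatever the number of
    roots. *)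
Lemma log_linprod ws Rad rho K z : Cmod z = Rad -> 0 <= rho < 1 ->
  List.Forall (fun w => Cmod w * Rad <= rho) ws ->
  0 < Cmod (pser (linprod ws) z) /\
  Re (\cs_(m < K) (- (powsums ws m.+1 / RtoC (INR m.+1)) * z ^ m.+1)%C)
   <= ln (Cmod (pser (linprod ws) z)) + INR (size ws) * (rho ^ K.+1 / (1 - rho)).
Proof.
move=> hz hr; rewrite pser_linprod; elim=> [|w l hw _ [IH0 IH]].
  rewrite big_nil Cmod_1 ln_1; split; first lra.
  rewrite big1 => [|m _]; last first.
    by change (powsums [::] m.+1) with (RtoC 0); rewrite /Cdiv Cmult_0_l; ring.
  by rewrite /=; lra.
have hu : Cmod (w * z)%C <= rho by rewrite Cmod_mult hz.
have p : 0 < Cmod (1 - w * z)%C by have := Cmod_one_minus (w * z)%C; lra.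
have L := @log_taylor (w * z)%C rho K (conj hu (proj2 hr)).
rewrite big_cons Cmod_mult ln_mult //; split; first exact: Rmult_lt_0_compat.
have -> : \cs_(m < K) (- (powsums (w :: l) m.+1 / RtoC (INR m.+1)) * z ^ m.+1)%C
  = (- (\cs_(m < K) ((w * z) ^ m.+1 * RtoC (/ INR m.+1)))
    + \cs_(m < K) (- (powsums l m.+1 / RtoC (INR m.+1)) * z ^ m.+1))%C.
  rewrite csum_opp -big_split; apply: eq_bigr => m _.
  transitivity (- ((w * z) ^ m.+1 * RtoC (/ INR m.+1))
    + - (powsums l m.+1 / RtoC (INR m.+1)) * z ^ m.+1)%C; last by [].
  rewrite Cpow_mult_l RtoC_inv; last exact: not_0_INR.
  have -> : powsums (w :: l) m.+1 = (w ^ m.+1 + powsums l m.+1)%C by [].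
  by field; exact: RtoC_INRS.
rewrite re_plus re_opp Re_csum [size _]/= S_INR Rmult_plus_distr_r Rmult_1_l.
have -> : \rs_(m < K) Re ((w * z) ^ m.+1 * RtoC (/ INR m.+1))%C = \rs_(m < K) (Re ((w * z) ^ m.+1)%C / INR m.+1).
  by apply: eq_bigr => m _; set x := ((w * z) ^ m.+1)%C; case: (x) => a b; rewrite /Re /Rdiv /=; ring.
have := Rle_abs (- (ln (Cmod (1 - w * z)%C) + \rs_(m < K) (Re ((w * z) ^ m.+1)%C / INR m.+1))).
rewrite Rabs_Ropp; lra.
Qed.

(** [borel_caratheodory] for the truncated logarithm, whose real part on the circle is at most
    [ln M] plus the truncation error. That error is absorbed in [eps] by taking [K] large, so the
    number of roots leaves no trace in the bound. *)
Lemma powsums_bound ws Rad M : 0 < Rad -> List.Forall (fun w => Cmod w * Rad < 1) ws ->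
  (forall z, Cmod z = Rad -> Cmod (pser (linprod ws) z) <= M) ->
  forall m, (0 < m)%N -> Cmod (powsums ws m) * Rad ^ m <= INR m * (2 * ln M).
Proof.
move=> R0 /common_radius[rho hr Hrho] HM [|j] // _.
apply: le_epsilon => eps e0; have jp := INRS_gt0 j.
pose S := INR (size ws) / (1 - rho).
have [K1 HK1] := @pow_small rho (INR j.+1 * 2 * S) eps hr e0.
pose K := maxn K1 j.+1.
have S0 : 0 <= S.
  by apply: Rmult_le_pos; [exact: pos_INR | apply: Rlt_le; apply: Rinv_0_lt_compat; lra].
have rK : rho ^ K.+1 <= rho ^ K1.
  have E : (K.+1 = K1 + (K.+1 - K1))%N by rewrite subnKC // ltnW // ltnS leq_maxl.
  rewrite E -plusE pow_add -[X in _ <= X]Rmult_1_r; apply: Rmult_le_compat_l; first by apply: pow_le; lra.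
  by rewrite -(pow1 (K.+1 - K1)); apply: pow_incr; lra.
have BC := @borel_caratheodory (fun m => - (powsums ws m.+1 / RtoC (INR m.+1)))%C K
  (ln M + INR (size ws) * (rho ^ K.+1 / (1 - rho))) Rad j R0 (leq_maxr _ _).
have {BC} h : Cmod (- (powsums ws j.+1 / RtoC (INR j.+1)))%C * Rad ^ j.+1
    <= 2 * (ln M + INR (size ws) * (rho ^ K.+1 / (1 - rho))).
  apply: BC => z hz; have [p L] := log_linprod K hz hr Hrho.
  have := ln_le _ _ p (HM z hz); lra.
rewrite Cmod_opp Cmod_div in h; last exact: RtoC_INRS.
rewrite Cmod_R Rabs_pos_eq in h; last exact: Rlt_le.
have h2 : INR (size ws) * (rho ^ K.+1 / (1 - rho)) <= S * rho ^ K1.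
  have -> : INR (size ws) * (rho ^ K.+1 / (1 - rho)) = S * rho ^ K.+1 by rewrite /S /Rdiv; ring.
  exact: Rmult_le_compat_l.
have := Rmult_le_compat_l (INR j.+1) _ _ (Rlt_le _ _ jp)
  (Rle_trans _ _ _ h (Rmult_le_compat_l 2 _ _ ltac:(lra) (Rplus_le_compat_l (ln M) _ _ h2))).
have -> : INR j.+1 * (Cmod (powsums ws j.+1) / INR j.+1 * Rad ^ j.+1) = Cmod (powsums ws j.+1) * Rad ^ j.+1.
  by field; lra.
lra.
Qed.

Lemma Cpow_lip r (z w : C) j : Cmod z <= r -> Cmod w <= r ->
  Cmod (z ^ j - w ^ j)%C * r <= INR j * r ^ j * Cmod (z - w)%C.
Proof.
move=> hz hw; have r0 : 0 <= r by have := Cmod_ge_0 z; lra.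
elim: j => [|j IH].
  have -> : (z ^ 0 - w ^ 0 = RtoC 0)%C by rewrite /=; ring.
  by rewrite Cmod_0 /=; lra.
have -> : (z ^ j.+1 - w ^ j.+1 = z * (z ^ j - w ^ j) + (z - w) * w ^ j)%C by rewrite /=; ring.
apply: Rle_trans (Rmult_le_compat_r _ _ _ r0 (Cmod_triangle _ _)) _.
rewrite !Cmod_mult Cmod_pow S_INR -[r ^ j.+1]/(r * r ^ j).
have hp : Cmod w ^ j <= r ^ j by apply: pow_incr; split=> //; exact: Cmod_ge_0.
have d0 := Cmod_ge_0 (z - w)%C; have e0 := Cmod_ge_0 (z ^ j - w ^ j)%C.
have h1 : Cmod z * (Cmod (z ^ j - w ^ j)%C * r) <= r * (INR j * r ^ j * Cmod (z - w)%C).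
  apply: Rmult_le_compat => //; [exact: Cmod_ge_0 | exact: Rmult_le_pos].
have h2 : Cmod (z - w)%C * r * Cmod w ^ j <= Cmod (z - w)%C * r * r ^ j.
  by apply: Rmult_le_compat_l => //; apply: Rmult_le_pos.
lra.
Qed.

Variables (f : nat -> C) (K : R).
Hypothesis f_bound : forall j, Cmod (f j) <= K * (4 / 7) ^ j.
Hypothesis f_nz : forall z, Cmod z <= 5 / 4 -> pser f z <> RtoC 0.

Lemma f_summ z : Cmod z <= 5 / 4 -> summ (fun j => f j * z ^ j)%C.
Proof. by move=> hz; apply: (summ_geo f_bound); lra. Qed.

Lemma K_ge0 : 0 <= K.
Proof. by have := f_bound 0; have := Cmod_ge_0 (f 0%N); rewrite /=; lra. Qed.

Lemma linear_geometric' j : INR j * (5 / 6) ^ j <= 5.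
Proof.
have H : 1 + INR j / 5 <= (6 / 5) ^ j.
  elim: j => [|j IH]; first by rewrite /=; lra.
  rewrite S_INR /=; have := pos_INR j; nra.
have E : (6 / 5) ^ j * (5 / 6) ^ j = 1.
  by rewrite -Rpow_mult_distr (_ : 6 / 5 * (5 / 6) = 1) ?pow1 //; field.
have p : 0 < (5 / 6) ^ j by apply: pow_lt; lra.
have := Rmult_le_compat_r _ _ _ (Rlt_le _ _ p) H; rewrite E; nra.
Qed.

Lemma pser_lip z w : Cmod z <= 5 / 4 -> Cmod w <= 5 / 4 ->
  Cmod (pser f z - pser f w)%C <= 28 * K * Cmod (z - w)%C.
Proof.
move=> hz hw; rewrite /pser -tot_sub; try exact: f_summ.
apply: Rle_trans (_ : (4 * K * Cmod (z - w)%C) / (1 - 6 / 7) <= _); last by right; field.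
apply: tot_norm; apply: geo_summ => [|j]; first lra.
have -> : (f j * z ^ j - f j * w ^ j = f j * (z ^ j - w ^ j))%C by ring.
rewrite Cmod_mult; have L := @Cpow_lip (5 / 4) z w j hz hw; have g := linear_geometric' j.
have d0 := Cmod_ge_0 (z - w)%C; have e0 := Cmod_ge_0 (z ^ j - w ^ j)%C; have K0 := K_ge0.
have p : 0 < (6 / 7) ^ j by apply: pow_lt; lra.
have q : 0 < (4 / 7) ^ j by apply: pow_lt; lra.
have E : (4 / 7) ^ j * (5 / 4) ^ j = (6 / 7) ^ j * (5 / 6) ^ j.
  by rewrite -!Rpow_mult_distr; congr (_ ^ _); field.
apply: Rle_trans (Rmult_le_compat_r _ _ _ e0 (f_bound j)) _.
have h1 : Cmod (z ^ j - w ^ j)%C <= 4 / 5 * (INR j * (5 / 4) ^ j * Cmod (z - w)%C) by lra.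
apply: Rle_trans (Rmult_le_compat_l (K * (4 / 7) ^ j) _ _ _ h1) _; first by apply: Rmult_le_pos; lra.
have -> : K * (4 / 7) ^ j * (4 / 5 * (INR j * (5 / 4) ^ j * Cmod (z - w)%C))
  = 4 / 5 * K * Cmod (z - w)%C * INR j * ((4 / 7) ^ j * (5 / 4) ^ j) by ring.
rewrite E.
have -> : 4 / 5 * K * Cmod (z - w)%C * INR j * ((6 / 7) ^ j * (5 / 6) ^ j)
  = (4 / 5 * K * Cmod (z - w)%C * (6 / 7) ^ j) * (INR j * (5 / 6) ^ j) by ring.
have c0 : 0 <= 4 / 5 * K * Cmod (z - w)%C * (6 / 7) ^ j.
  by apply: Rmult_le_pos; [apply: Rmult_le_pos; [lra | ] | lra].
have := Rmult_le_compat_l _ _ _ c0 g; lra.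
Qed.

(** Continuity without zeros on a compact disc; the uniform gap is what lets zero-freeness survive
    truncation. *)
Lemma pser_away : exists2 d, 0 < d & forall z, Cmod z <= 5 / 4 -> d <= Cmod (pser f z).
Proof.
have K0 := K_ge0; pose L := 28 * K.
(* The gauge. At a centre in the disc it is small against [|f|] there, and the Lipschitz bound keeps
   [|f|] above it nearby; at a centre outside it is too small for the disc to be reached. *)
pose delta0 (u v : R) := if Rle_dec (Cmod (u, v)) (5 / 4) then Cmod (pser f (u, v)) / (4 * (L + 1))
   else (Cmod (u, v) - 5 / 4) / 4.
have L1 : 0 < 4 * (L + 1) by rewrite /L; lra.
have dpos u v : 0 < delta0 u v.
  rewrite /delta0; case: Rle_dec => h /=; last lra.
  by apply: Rdiv_lt_0_compat => //; apply/Cmod_gt_0; apply: f_nz.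
have [d Hd] := compactness_value_2d (-2) 2 (-2) 2 (fun u v => mkposreal _ (dpos u v)).
exists d; first exact: cond_pos.
case=> x y hz; apply: NNPP => nd.
have rx := re_le_Cmod (x, y); have ry := im_le_Cmod (x, y); rewrite /Re /Im /= in rx ry.
have bx : -2 <= x <= 2.
  by have := Rle_abs x; have := Rle_abs (- x); rewrite Rabs_Ropp; lra.
have by_ : -2 <= y <= 2.
  by have := Rle_abs y; have := Rle_abs (- y); rewrite Rabs_Ropp; lra.
apply: (Hd x y bx by_) => -[u [v [_ [_ [hu [hv hd]]]]]]; rewrite /= in hu hv hd.
have near : Cmod ((x, y) - (u, v))%C <= 2 * delta0 u v.
  apply: Rle_trans (Cmod_le_ReIm _) _.
  have -> : Re ((x, y) - (u, v))%C = x - u by [].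
  have -> : Im ((x, y) - (u, v))%C = y - v by [].
  lra.
have near' : Cmod ((u, v) - (x, y))%C <= 2 * delta0 u v.
  by rewrite -Cmod_opp; have -> : (- ((u, v) - (x, y)) = (x, y) - (u, v))%C by ring.
have tri : Cmod (u, v) <= Cmod (x, y) + Cmod ((u, v) - (x, y))%C.
  have := Cmod_triangle (x, y) ((u, v) - (x, y))%C.
  by have -> : ((x, y) + ((u, v) - (x, y)) = (u, v))%C by ring.
move: near near' hd (dpos u v); rewrite /delta0; case: Rle_dec => h /= near near' hd dp; last lra.
apply: nd; apply: Rle_trans hd _.
have lip := pser_lip h hz.
have tri2 : Cmod (pser f (u, v)) <= Cmod (pser f (x, y)) + Cmod (pser f (u, v) - pser f (x, y))%C.
  have := Cmod_triangle (pser f (x, y)) (pser f (u, v) - pser f (x, y))%C.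
  by have -> : (pser f (x, y) + (pser f (u, v) - pser f (x, y)) = pser f (u, v))%C by ring.
set m := Cmod (pser f (u, v)) in near near' dp tri2 *.
pose t := m / (4 * (L + 1)); rewrite -/t in near near' dp *.
have mt : m = 4 * (L + 1) * t by rewrite /t; field; lra.
have := Rmult_le_compat_l (28 * K) _ _ ltac:(lra) near'; rewrite -/L => l2.
have L0 : 0 <= L by rewrite /L; lra.
have := Rmult_le_pos _ _ L0 (Rlt_le _ _ dp); rewrite -/L in lip; lra.
Qed.

Definition trunc (a : nat -> C) (N j : nat) : C := if (j <= N)%N then a j else RtoC 0.

Lemma trunc_fin a N : fin_supp (trunc a N) N.
Proof. by move=> j; rewrite /trunc ltnNge => /negbTE ->. Qed.

Lemma trunc_bound N j : Cmod (trunc f N j) <= K * (4 / 7) ^ j.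
Proof.
rewrite /trunc; case: ifP => _; first exact: f_bound.
by rewrite Cmod_0; apply: Rmult_le_pos; [exact: K_ge0 | apply: pow_le; lra].
Qed.

Lemma trunc_le N z : Cmod z <= 5 / 4 -> Cmod (pser (trunc f N) z) <= 7 / 2 * K.
Proof.
move=> hz; apply: Rle_trans (_ : K / (1 - 5 / 7) <= _); last by right; field.
apply: tot_norm; apply: geo_summ => [|j]; first lra.
rewrite Cmod_mult Cmod_pow.
have -> : (5 / 7) ^ j = (4 / 7) ^ j * (5 / 4) ^ j by rewrite -Rpow_mult_distr; congr (_ ^ _); field.
rewrite -Rmult_assoc; apply: Rmult_le_compat; [exact: Cmod_ge_0 | by apply: pow_le; exact: Cmod_ge_0 | exact: trunc_bound |].
by apply: pow_incr; split=> //; exact: Cmod_ge_0.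
Qed.

Lemma trunc_nz : exists N0, forall N, (N0 <= N)%N -> forall z, Cmod z <= 5 / 4 ->
  pser (trunc f N) z <> RtoC 0.
Proof.
have [d d0 Hd] := pser_away.
have [N0 HN0] := @pow_small (5 / 7) (K / (1 - 5 / 7)) d ltac:(lra) d0.
exists N0 => N hN z hz Z; have := Hd z hz.
have fb j : Cmod (f j * z ^ j)%C <= K * (5 / 7) ^ j.
  rewrite Cmod_mult Cmod_pow.
  have -> : (5 / 7) ^ j = (4 / 7) ^ j * (5 / 4) ^ j by rewrite -Rpow_mult_distr; congr (_ ^ _); field.
  rewrite -Rmult_assoc; apply: Rmult_le_compat; [exact: Cmod_ge_0 | by apply: pow_le; exact: Cmod_ge_0 | exact: f_bound |].
  by apply: pow_incr; split=> //; exact: Cmod_ge_0.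
have T := geo_tail N.+1 (ltac:(lra) : 0 <= 5 / 7 < 1) fb.
have E : \cs_(j < N.+1) (f j * z ^ j)%C = RtoC 0.
  apply: etrans Z; rewrite (fin_supp_tot _ (@trunc_fin f N)); apply: eq_bigr => j _.
  by rewrite /trunc -ltnS ltn_ord.
rewrite E -/(pser f z) in T; have -> : pser f z = (pser f z - 0)%C by ring.
have K0 := K_ge0.
have r : (5 / 7) ^ N.+1 <= (5 / 7) ^ N0.
  have EN : (N.+1 = N0 + (N.+1 - N0))%N by rewrite subnKC // ltnW.
  rewrite EN -plusE pow_add -[X in _ <= X]Rmult_1_r; apply: Rmult_le_compat_l; first by apply: pow_le; lra.
  by rewrite -(pow1 (N.+1 - N0)); apply: pow_incr; lra.
have q : 0 <= K / (1 - 5 / 7) by apply: Rmult_le_pos => //; lra.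
have := Rmult_le_compat_l _ _ _ q r.
have -> : K / (1 - 5 / 7) * (5 / 7) ^ N.+1 = K * (5 / 7) ^ N.+1 / (1 - 5 / 7) by rewrite /Rdiv; ring.
lra.
Qed.

(** A nonzero constant term lets the equation determine the coefficients one after the other, so
    agreement of [f] with [p] up to [N] suffices. *)
Lemma cauchy_left_cancel (p a b : nat -> C) N : p 0%N <> RtoC 0 -> f 0%N = p 0%N ->
  (forall i, (i <= N)%N -> f i = p i) ->
  (forall i, (i <= N)%N -> cauchy f a i = cauchy p b i) -> forall i, (i <= N)%N -> a i = b i.
Proof.
move=> p0 _ fp H; elim/ltn_ind => i IH iN; have := H i iN.
rewrite /cauchy !big_ord_recl /= subn0 fp //.
have -> : \cs_(l < i) (f (bump 0 l) * a (i - bump 0 l)%N)%C = \cs_(l < i) (p (bump 0 l) * b (i - bump 0 l)%N)%C.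
  apply: eq_bigr => l _; rewrite /bump add1n.
  have li : (l.+1 <= i)%N by [].
  rewrite fp; last exact: leq_trans iN.
  rewrite IH //; first by rewrite ltn_subrL /=; apply: leq_trans li.
  exact: leq_trans (leq_subr _ _) iN.
set S := bigop _ _ _ => E.
have E2 : (p 0%N * a i)%C = (p 0%N * b i)%C.
  transitivity (p 0%N * a i + S - S)%C; first ring.
  by rewrite E; ring.
transitivity (/ p 0%N * (p 0%N * a i))%C; first by field.
by rewrite E2; field.
Qed.

(* Borel-Caratheodory on the factored truncations of [f]; the exponent [L] is of size [k ln K]. *)
Theorem inverse_power_bound (D : nat -> nat -> C) (k L : nat) :
  D 0%N = sone -> (forall i, cauchy f (D i.+1) = D i) -> 1 / 4 <= Cmod (f 0%N) ->
  INR k * (2 * ln (14 * K)) * 24 <= INR L ->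
  forall j, Cmod (D k j) <= 4 ^ k * 16 ^ L * (8 / 9) ^ j.
Proof.
move=> D0 DS f0 hL j.
(* [N >= j], so that the coefficient [j] of [D k] can be computed from the truncation; no bound
   below depends on [N]. *)
have [N0 HN0] := trunc_nz; pose N := maxn N0 j.
have f00 : f 0%N <> RtoC 0 by move=> Z; rewrite Z Cmod_0 in f0; lra.
have nzN := HN0 N (leq_maxl _ _).
have t0 : trunc f N 0 = f 0%N by [].
have [ws EP Hws] := @factor_polynomial (5 / 4) N (trunc f N) ltac:(lra) (@trunc_fin f N) f00 nzN.
rewrite t0 in EP.
have K1 : 1 / 4 <= K by have := f_bound 0; rewrite /=; lra.
have T0 : 0 <= 2 * ln (14 * K).
  have : 0 < ln (14 * K) by rewrite -ln_1; apply: ln_increasing; lra.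
  lra.
(* [14 = (7/2) / (1/4)], from the upper bound for the truncation and the lower bound for [f 0]. *)
have lb z : Cmod z = 5 / 4 -> Cmod (pser (linprod ws) z) <= 14 * K.
  move=> hz; have := @trunc_le N z ltac:(lra).
  have -> : pser (trunc f N) z = (f 0%N * pser (linprod ws) z)%C.
    rewrite EP pser_cauchy.
    - congr Cmult; rewrite (@fin_supp_tot _ 0) ?big_ord_recl ?big_ord0 /=; first ring.
      by case.
    - by apply: (@fin_supp_summ _ 0); case.
    exact: fin_supp_summ (@linprod_fin ws).
  rewrite Cmod_mult; have := Cmod_ge_0 (pser (linprod ws) z); nra.
have pb m : (0 < m)%N -> Cmod (powsums ws m) <= INR m * (2 * ln (14 * K)) * (4 / 5) ^ m.
  move=> m0; have := powsums_bound (ltac:(lra) : 0 < 5 / 4) Hws lb m0 => h.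
  have q : 0 < (4 / 5) ^ m by apply: pow_lt; lra.
  have E : (5 / 4) ^ m * (4 / 5) ^ m = 1.
    by rewrite -Rpow_mult_distr (_ : 5 / 4 * (4 / 5) = 1) ?pow1 //; field.
  have := Rmult_le_compat_r _ _ _ (Rlt_le _ _ q) h.
  by rewrite Rmult_assoc E Rmult_1_r.
have sb := spow_geoprod_bound T0 hL pb j.
pose c := (/ f 0%N)%C.
have cc : Cmod c <= 4.
  rewrite /c Cmod_inv //; have -> : 4 = / (1 / 4) by field.
  by apply: Rinv_le_contravar; lra.
(* Up to index [N] both sides satisfy the recursion [cauchy f (D i.+1) = D i], which has only one
   solution there. *)
have key i : forall l, (l <= N)%N -> D i l = (c ^ i * spow (geoprod ws) i l)%C.
  elim: i => [|i IH]; first by move=> l _; rewrite D0 /=; ring.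
  apply: (@cauchy_left_cancel (trunc f N)) => [|||l lN]; rewrite ?t0 //.
    by move=> l lN; rewrite /trunc lN.
  rewrite DS IH // EP.
  have -> : (fun l => c ^ i.+1 * spow (geoprod ws) i.+1 l)%C = cauchy (constser (c ^ i.+1)%C) (spow (geoprod ws) i.+1).
    by apply: functional_extensionality => m; rewrite constser_cauchy.
  have -> : cauchy (cauchy (constser (f 0%N)) (linprod ws)) (cauchy (constser (c ^ i.+1)%C) (spow (geoprod ws) i.+1))
    = cauchy (constser (f 0%N)) (cauchy (constser (c ^ i.+1)%C) (spow (geoprod ws) i)).
    rewrite -cauchyA; congr (cauchy _ _); rewrite cauchyA [cauchy (linprod ws) _]cauchyC -cauchyA.
    congr (cauchy _ _); rewrite [spow _ i.+1]/= cauchyA linprod_geoprod; exact: cauchy1l.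
  by rewrite !constser_cauchy Cpow_S /c; field.
rewrite key ?leq_maxr // Cmod_mult Cmod_pow Rmult_assoc; apply: Rmult_le_compat => //.
- by apply: pow_le; exact: Cmod_ge_0.
- exact: Cmod_ge_0.
by apply: pow_incr; split=> //; exact: Cmod_ge_0.
Qed.

End InversePowers.

(** * Characters of the unit group separate residues *)

Section Separation.

Import mathcomp.algebra.all_algebra mathcomp.fingroup.all_fingroup.
Import mathcomp.field.all_field mathcomp.character.all_character.
Import GRing.Theory.

(* A character of [(Z/q)^*] not trivial at [a], through the exponents of its values relative to a
   primitive root of unity of order [N]. *)
Lemma separating_exponents (q a : nat) : (1 < q)%N -> coprime a q -> a != 1 %[mod q] ->
  exists (N : nat) (e : nat -> nat), [/\ (0 < N)%N,
    forall m n, coprime m q -> coprime n q -> (e (m * n)%N = e m + e n %[mod N])%N,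
    forall m, e (m + q)%N = e m & ~~ (N %| e a)%N].
Proof.
move=> q1 aq a1.
pose u (m : nat) : {unit 'Z_q} := insubd (1%g : {unit 'Z_q}) (m%:R%R : 'Z_q).
have uE m : coprime m q -> val (u m) = (m%:R%R : 'Z_q).
  by move=> mq; rewrite /u val_insubd unitZpE // coprime_sym mq.
have uM m n : coprime m q -> coprime n q -> u (m * n)%N = (u m * u n)%g.
  move=> mq nq; apply: val_inj; rewrite uE ?coprimeMl ?mq //=.
  by rewrite !uE // natrM.
have uq m : u (m + q)%N = u m.
  by rewrite /u natrD pchar_Zp // addr0.
pose G := [group of [set: {unit 'Z_q}]].
have abG : abelian G by apply: units_Zp_abelian.
have lin i : ('chi[G]_i)%R \is a linear_char by apply/char_abelianP.
(* The kernels of the irreducible characters intersect trivially, so one of them misses the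
   nontrivial element [u a]. *)
have [i ni] : exists i : Iirr G, u a \notin cfker ('chi[G]_i)%R.
  apply/existsP; rewrite -negb_forall; apply: contra a1 => /forallP H.
  have : u a \in (\bigcap_i cfker ('chi[G]_i)%R)%g by apply/bigcapP => i _; apply: H.
  rewrite TI_cfker_irr => /set1P E.
  have := congr1 val E; rewrite uE //= => /(congr1 val) /=.
  by rewrite val_Zp_nat // => ->; rewrite -(val_Zp_nat q1 1).
pose N := #|G|; have N0 : (0 < N)%N by apply: cardG_gt0.
have [z zN] := C_prim_root_exists N0.
have rt g : (('chi[G]_i g)%R ^+ N = 1)%R.
  by rewrite -lin_charX ?inE // /N mathcomp.solvable.cyclic.expg_cardG ?inE // lin_char1.
(* Only the exponent is kept: being a natural number, it carries the character over to the roots of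
   unity in [C]. *)
pose e m := nat_of_ord (sval (prim_rootP zN (rt (u m)))).
have eE m : (('chi[G]_i (u m)) = z ^+ e m)%R by rewrite /e; case: (prim_rootP _ _).
exists N, e; split=> //.
- move=> m n mq nq; apply/eqP; rewrite -(eq_prim_root_expr zN) exprD -!eE uM // lin_charM ?inE //.
- by move=> m; rewrite /e uq.
apply: contra ni => /dvdnP[k E]; rewrite cfkerEirr inE eE lin_char1 // E mulnC exprM.
by rewrite (prim_expr_order zN) expr1n.
Qed.

End Separation.

(** * Dirichlet characters: enumeration and orthogonality *)

Section DirichletCharacters.

Lemma gcdnE m n : Nat.gcd m n = gcdn m n.
Proof.
apply: Nat.gcd_unique.
- by have /dvdnP[k E] := dvdn_gcdl m n; exists k; rewrite multE.
- by have /dvdnP[k E] := dvdn_gcdr m n; exists k; rewrite multE.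
move=> d [x Ex] [y Ey].
have /dvdnP[k E] : (d %| gcdn m n)%N.
  by rewrite dvdn_gcd; apply/andP; split; apply/dvdnP; [exists x | exists y]; rewrite -multE.
by exists k; rewrite multE.
Qed.

Variable q : nat.
Hypothesis q1 : (1 < q)%N.

Let q0 : (0 < q)%N. Proof. exact: ltnW. Qed.

Section OneCharacter.

Variable chi : nat -> C.
Hypothesis chiD : is_dirichlet_char q chi.

Lemma char_mul m n : chi (m * n)%N = (chi m * chi n)%C.
Proof. by case: chiD. Qed.

Lemma char1 : chi 1%N = RtoC 1.
Proof. by case: chiD => _ [_ []]. Qed.

Lemma char_periodic n : chi (n + q)%N = chi n.
Proof. by case: chiD => _ []. Qed.

Lemma char_modn n : chi (n %% q)%N = chi n.
Proof.
rewrite {2}(divn_eq n q); elim: (n %/ q)%N => [|k IH]; first by rewrite add0n.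
by rewrite mulSn -addnA addnC char_periodic.
Qed.

Lemma char_eqmod m n : (m = n %[mod q])%N -> chi m = chi n.
Proof. by move=> E; rewrite -char_modn E char_modn. Qed.

Lemma char_eq0 n : ~~ coprime n q -> chi n = RtoC 0.
Proof.
move=> nc; case: chiD => _ [_ [H _]]; apply/H; rewrite gcdnE => E.
by case/negP: nc; rewrite /coprime E.
Qed.

Lemma char_neq0 n : coprime n q -> chi n <> RtoC 0.
Proof. by move=> c; case: chiD => _ [_ [H _]] /H; rewrite gcdnE; apply; apply/eqP. Qed.

Lemma char_pow n j : chi (n ^ j)%N = (chi n ^ j)%C.
Proof. by elim: j => [|j IH]; [rewrite expn0 char1 | rewrite expnS char_mul IH]. Qed.

Lemma Cmod_char n : coprime n q -> Cmod (chi n) = 1.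
Proof.
move=> c; have E := mathcomp.solvable.cyclic.Euler_exp_totient c.
have : Cmod (chi n) ^ totient q = 1.
  by rewrite -Cmod_pow -char_pow (char_eqmod E) char1 Cmod_1.
have t0 : (0 < totient q)%N by rewrite totient_gt0.
have := Cmod_ge_0 (chi n); set x := Cmod _ => x0 xp.
case: (Rtotal_order x 1) => [lt|[//|gt]].
  case: (totient q) t0 xp => // k _ /= xp.
  have : x ^ k <= 1 by rewrite -(pow1 k); apply: pow_incr; lra.
  have : 0 <= x ^ k by apply: pow_le.
  nra.
have := Rlt_pow_R1 x (totient q) gt (ltP t0); lra.
Qed.

Lemma char_unit n : chi n = RtoC 0 \/ Cmod (chi n) = 1.
Proof. by case: (boolP (coprime n q)) => c; [right; exact: Cmod_char | left; exact: char_eq0]. Qed.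

Lemma char_le1 n : Cmod (chi n) <= 1.
Proof. by case: (char_unit n) => ->; rewrite ?Cmod_0; lra. Qed.

Lemma char_completely_mult : completely_mult chi.
Proof. by split; [exact: char1 | move=> m n _ _; exact: char_mul]. Qed.

End OneCharacter.

Lemma period_shift (g : nat -> C) a : coprime a q ->
  \cs_(n <- iota 0 q) g ((a * n) %% q)%N = \cs_(n <- iota 0 q) g n.
Proof.
move=> aq; rewrite -(big_map (fun n => (a * n) %% q)%N xpredT g).
have inj : {in iota 0 q &, injective (fun n => (a * n) %% q)%N}.
  move=> m n; rewrite !mem_iota !add0n /= => hm hn /eqP E; apply/eqP.
  wlog le : m n hm hn E / (m <= n)%N.
    by case: (leqP m n) => [h|/ltnW h] H; [exact: H | rewrite eq_sym; apply: H; rewrite // eq_sym].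
  move: E; rewrite eq_sym eqn_mod_dvd ?leq_mul2l ?le ?orbT // -mulnBr Gauss_dvdr; last by rewrite coprime_sym.
  move=> d; rewrite eqn_leq le /= -subn_eq0; apply/negPn/negP; rewrite -lt0n => p.
  by have := dvdn_leq p d; rewrite leqNgt (leq_ltn_trans (leq_subr _ _) hn).
have un : uniq (map (fun n => (a * n) %% q)%N (iota 0 q)) by rewrite map_inj_in_uniq ?iota_uniq.
apply: perm_big; apply: uniq_perm; rewrite ?iota_uniq //.
have sub : {subset map (fun n => (a * n) %% q)%N (iota 0 q) <= iota 0 q}.
  by move=> y /mapP[x _ ->]; rewrite mem_iota add0n ltn_mod.
by have [|_ E] := uniq_min_size un sub; rewrite ?size_map.
Qed.

Lemma period_sum_shift chi a : is_dirichlet_char q chi -> coprime a q ->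
  (chi a * \cs_(n <- iota 0 q) chi n)%C = \cs_(n <- iota 0 q) chi n.
Proof.
move=> hc aq; rewrite -[RHS](period_shift chi aq) big_distrr /=; apply: eq_bigr => n _.
by rewrite char_modn // char_mul.
Qed.

Lemma Cmult_fix0 (c x : C) : c <> RtoC 1 -> (c * x)%C = x -> x = RtoC 0.
Proof.
move=> c1 E; have nz : (c - 1)%C <> RtoC 0 by move/Csub_eq0.
have -> : x = ((c * x - x) / (c - 1))%C by field.
by rewrite E; field.
Qed.

Lemma nonprincipal_witness chi : is_nonprincipal_char q chi -> exists2 a, coprime a q & chi a <> RtoC 1.
Proof.
case=> _ np; apply: NNPP => H; apply: np => n; rewrite gcdnE => g.
by apply: NNPP => ne; apply: H; exists n => //; apply/eqP.
Qed.

Lemma nonprincipal_sum0 chi : is_nonprincipal_char q chi -> \cs_(n <- iota 0 q) chi n = RtoC 0.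
Proof.
move=> h; have [a aq a1] := nonprincipal_witness h.
by apply: (Cmult_fix0 a1); apply: period_sum_shift aq; case: h.
Qed.

(** Complete periods sum to zero, so at most [q] terms of modulus at most [1] remain. *)
Lemma nonprincipal_psum chi : is_nonprincipal_char q chi -> psum_le chi (INR q).
Proof.
move=> h N; have [hc _] := h; elim/ltn_ind: N => N IH.
case: (leqP N q) => Nq.
  apply: Rle_trans (Cmod_csum _ _ _) _; apply: Rle_trans (_ : \rs_(i < N) 1 <= _).
    by apply: rsum_le => i; exact: char_le1.
  by rewrite rsum_const /index_enum -enumT size_enum_ord Rmult_1_r; apply: le_INR; apply/leP.
rewrite -(big_mkord xpredT chi) (@big_cat_nat _ _ _ q) //=; last exact: ltnW.
rewrite {1}/index_iota subn0 nonprincipal_sum0 // Cplus_0_l.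
rewrite -{1}(add0n q) big_addn (eq_bigr chi) => [|i _]; last by rewrite char_periodic.
by rewrite big_mkord; apply: IH; rewrite ltn_subrL q0 (ltn_trans q0 Nq).
Qed.

Definition principal (n : nat) : C := if coprime n q then RtoC 1 else RtoC 0.

Lemma principal_char : is_dirichlet_char q principal.
Proof.
rewrite /principal; split; [|split; [|split]].
- move=> m n; rewrite multE coprimeMl; do 2 case: coprime => /=; ring.
- by move=> n; rewrite plusE -coprime_modl modnDr coprime_modl.
- move=> n; rewrite gcdnE /coprime; case: eqP => E; split=> //.
  by move/RtoC_inj; lra.
by rewrite coprime1n.
Qed.

Lemma principal_principal : is_principal_char q principal.
Proof. by move=> n; rewrite gcdnE => /eqP c; rewrite /principal /coprime c. Qed.

Lemma principal_unique chi : is_dirichlet_char q chi -> is_principal_char q chi -> chi = principal.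
Proof.
move=> hc hp; apply: functional_extensionality => n; rewrite /principal.
case: (boolP (coprime n q)) => c; last exact: char_eq0.
by apply: hp; rewrite gcdnE; apply/eqP.
Qed.

Lemma char_prod chi psi : is_dirichlet_char q chi -> is_dirichlet_char q psi ->
  is_dirichlet_char q (fun n => chi n * psi n)%C.
Proof.
move=> h1 h2; split; [|split; [|split]].
- by move=> m n; rewrite !char_mul //; ring.
- by move=> n; rewrite !char_periodic.
- move=> n; rewrite gcdnE; split=> [Z E | ne].
    have c : coprime n q by apply/eqP.
    have /Cmod_eq_0 : Cmod (chi n * psi n)%C = 0 by rewrite Z Cmod_0.
    by move=> _; have := f_equal Cmod Z; rewrite Cmod_mult !Cmod_char // Cmod_0; lra.
  by rewrite (char_eq0 h1) ?Cmult_0_l //; apply/negP => /eqP.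
by rewrite !char1 // Cmult_1_l.
Qed.

Lemma char_conj chi : is_dirichlet_char q chi -> is_dirichlet_char q (fun n => Cconj (chi n)).
Proof.
move=> h; split; [|split; [|split]].
- by move=> m n; rewrite char_mul // Cmult_conj.
- by move=> n; rewrite char_periodic.
- move=> n; have [_ [_ [H _]]] := h; rewrite -H; split=> E.
    by rewrite -(Cconj_conj (chi n)) E Cconj_R.
  by rewrite E Cconj_R.
by rewrite char1 // Cconj_R.
Qed.

Lemma char_conj_mul chi n : is_dirichlet_char q chi -> coprime n q -> (chi n * Cconj (chi n))%C = RtoC 1.
Proof. by move=> h c; rewrite -Cmod2_conj (Cmod_char h c) pow1. Qed.

Lemma separating_char a : coprime a q -> (a != 1 %[mod q])%N ->
  exists2 psi, is_dirichlet_char q psi & psi a <> RtoC 1.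
Proof.
move=> aq a1; have [N [e [N0 eM eq en]]] := separating_exponents q1 aq a1.
pose psi n := if coprime n q then (root1 N ^ e n)%C else RtoC 0.
have rmod i : (root1 N ^ i)%C = (root1 N ^ (i %% N)%N)%C.
  rewrite {1}(divn_eq i N) Cpow_add mulnC -multE Cpow_mult_r root1_n // Cpow_1_l; ring.
have c1 : coprime 1 q by rewrite coprime1n.
have e1 : (e 1%N %% N = 0)%N.
  have := eM 1%N 1%N c1 c1; rewrite muln1 => /eqP; rewrite -{1}(addn0 (e 1%N)) eqn_modDl => /eqP <-.
  by rewrite mod0n.
exists psi; last first.
  rewrite /psi aq rmod; apply: root1_neq1; rewrite ltn_mod N0 andbT lt0n.
  exact: en.
rewrite /psi; split; [|split; [|split]].
- move=> m n; rewrite multE coprimeMl; case: (boolP (coprime m q)) => cm /=; last ring.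
  case: (boolP (coprime n q)) => cn /=; last ring.
  by rewrite rmod eM // -rmod Cpow_add.
- by move=> n; rewrite plusE eq -coprime_modl modnDr coprime_modl.
- move=> n; rewrite gcdnE /coprime; case: eqP => E; split=> //.
  by move=> /(f_equal Cmod); rewrite Cmod_pow Cmod_root1 pow1 Cmod_0; lra.
by rewrite c1 rmod e1.
Qed.

Lemma char_orthogonal chi psi : is_dirichlet_char q chi -> is_dirichlet_char q psi -> chi <> psi ->
  \cs_(n <- iota 0 q) (chi n * Cconj (psi n))%C = RtoC 0.
Proof.
move=> h1 h2 ne; have h := char_prod h1 (char_conj h2).
apply: nonprincipal_sum0; split=> // hp; apply: ne; apply: functional_extensionality => n.
case: (boolP (coprime n q)) => c; last by rewrite !char_eq0.
have E := principal_unique h hp; have En := f_equal (fun g => g n) E.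
rewrite /principal c in En.
transitivity (chi n * Cconj (psi n) * psi n)%C; last by rewrite En Cmult_1_l.
by rewrite -Cmult_assoc [(Cconj _ * _)%C]Cmult_comm char_conj_mul // Cmult_1_r.
Qed.

Definition phi : nat := size [seq n <- iota 0 q | coprime n q].

Lemma char_norm2 chi : is_dirichlet_char q chi ->
  \cs_(n <- iota 0 q) (chi n * Cconj (chi n))%C = RtoC (INR phi).
Proof.
move=> h; rewrite (eq_bigr (fun n => if coprime n q then RtoC 1 else RtoC 0)) => [|n _].
  by rewrite -big_mkcond -big_filter csum_const Cmult_1_r.
by case: ifP => [c|/negbT c]; [exact: char_conj_mul | rewrite char_eq0 // Cmult_0_l].
Qed.

Lemma csum_in (T : Type) (l : seq T) (F G : T -> C) : (forall y, List.In y l -> F y = G y) ->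
  \cs_(y <- l) F y = \cs_(y <- l) G y.
Proof.
elim: l => [|y l IH] H; first by rewrite !big_nil.
rewrite !big_cons H; last by left.
by rewrite IH // => z hz; apply: H; right.
Qed.

Lemma csum_delta (T : Type) (l : seq T) (G : T -> C) x : List.NoDup l -> List.In x l ->
  (forall y, List.In y l -> y <> x -> G y = RtoC 0) -> \cs_(y <- l) G y = G x.
Proof.
move=> nd; elim: nd => //= y s ny _ IH Hx H0; rewrite big_cons.
case: (classic (y = x)) => [E|ne].
  rewrite -E (@csum_in _ s G (fun=> RtoC 0)) => [|z hz].
    by rewrite big1_eq; exact: Cplus_0_r.
  by apply: H0; [right | move=> zx; apply: ny; rewrite E -zx].
rewrite H0 //; last by left.
rewrite IH ?Cplus_0_l // => [|z hz nz]; first by case: Hx.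
by apply: H0 => //; right.
Qed.

(* Bessel's inequality for [sum chi] at [n = 1]. *)
Lemma char_list_size l : List.NoDup l -> (forall chi, List.In chi l -> is_dirichlet_char q chi) ->
  (size l <= phi)%N.
Proof.
move=> nd hl; pose F n := \cs_(chi <- l) chi n.
have p0 : 0 <= INR phi by apply: pos_INR.
have S : \cs_(n <- iota 0 q) (F n * Cconj (F n))%C = RtoC (INR (size l) * INR phi).
  have cj n : Cconj (F n) = \cs_(psi <- l) Cconj (psi n).
    rewrite /F; elim/big_rec2: _ => [|i x y _ <-]; first exact: Cconj_R.
    exact: Cplus_conj.
  rewrite (eq_bigr (fun n => \cs_(chi <- l) \cs_(psi <- l) (chi n * Cconj (psi n))%C)) => [|n _]; last first.
    by rewrite cj /F big_distrl /=; apply: eq_bigr => chi _; rewrite big_distrr.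
  rewrite exchange_big /= (@csum_in _ l _ (fun=> RtoC (INR phi))) => [|chi hchi].
    by rewrite csum_const RtoC_mult.
  rewrite exchange_big /= (@csum_delta _ l _ chi) //; first exact/char_norm2/hl.
  by move=> psi hpsi ne; apply: char_orthogonal; [exact: hl | exact: hl | exact: not_eq_sym].
have F1 : F 1%N = RtoC (INR (size l)).
  by rewrite /F (@csum_in _ l _ (fun=> RtoC 1)) ?csum_const ?Cmult_1_r // => chi /hl/char1.
have S' : \rs_(n <- iota 0 q) Cmod (F n) ^ 2 = INR (size l) * INR phi.
  apply: RtoC_inj; rewrite -S RtoC_rsum; apply: eq_bigr => n _; exact: Cmod2_conj.
have le : Cmod (F 1%N) ^ 2 <= INR (size l) * INR phi.
  rewrite -S' (big_rem 1%N) /=; last by rewrite mem_iota add0n.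
  set x := bigop _ _ _; have : 0 <= x; last lra.
  by apply: rsum_ge0 => n _; apply: pow2_ge_0.
rewrite F1 Cmod_R Rabs_pos_eq in le; last exact: pos_INR.
apply/leP; apply: INR_le; case: (Req_dec (INR (size l)) 0) => [->|ne]; first exact: p0.
have s0 : 0 < INR (size l) by have := pos_INR (size l); lra.
by apply: (Rmult_le_reg_l (INR (size l))) => //; move: le; rewrite /= Rmult_1_r.
Qed.

(** A list that misses a character can be extended by it, and [char_list_size] stops this process.
    The epsilon in [nonprincipal_chars] thereby receives its meaning. *)
Lemma nonprincipal_list_exists : exists l, List.NoDup l /\
  forall chi, List.In chi l <-> is_nonprincipal_char q chi.
Proof.
pose P l := List.NoDup l /\ forall chi, List.In chi l -> is_nonprincipal_char q chi.
have grow m : (exists l, P l /\ (m <= size l)%N) \/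
    (exists l, P l /\ forall chi, is_nonprincipal_char q chi -> List.In chi l).
  elim: m => [|m [[l [[nd hl] hm]]|IH]]; last by right.
    by left; exists [::]; split=> //; split=> //; exact: List.NoDup_nil.
  case: (classic (forall chi, is_nonprincipal_char q chi -> List.In chi l)) => [H|/not_all_ex_not[chi]].
    by right; exists l.
  move=> himp; have [hchi nin] := imply_to_and _ _ himp; left; exists (chi :: l); split; last by rewrite /= ltnS.
  split; first exact (@List.NoDup_cons _ chi l nin nd).
  by move=> psi [<-|/hl].
case: (grow phi.+1) => [[l [[nd hl]]]|[l [[nd hl] H]]]; last first.
  by exists l; split=> // chi; split; [exact: hl | exact: H].
by rewrite ltnNge char_list_size // => chi /hl[].
Qed.

Lemma nonprincipal_chars_spec : List.NoDup (nonprincipal_chars q) /\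
  forall chi, List.In chi (nonprincipal_chars q) <-> is_nonprincipal_char q chi.
Proof. exact: (epsilon_spec (inhabits nil) _ nonprincipal_list_exists). Qed.

Definition all_chars : seq (nat -> C) := principal :: nonprincipal_chars q.

Lemma all_chars_spec chi : List.In chi all_chars <-> is_dirichlet_char q chi.
Proof.
have [_ H] := nonprincipal_chars_spec; rewrite /= H; split=> [[<-|[]//]|h]; first exact: principal_char.
case: (classic (is_principal_char q chi)) => hp; [left | by right].
by symmetry; apply: principal_unique.
Qed.

Lemma all_chars_nodup : List.NoDup all_chars.
Proof.
have [nd H] := nonprincipal_chars_spec; apply: List.NoDup_cons => //.
by move/H => [_]; apply; exact: principal_principal.
Qed.

Lemma csum_perm (T : Type) (l l' : seq T) (G : T -> C) : Permutation.Permutation l l' ->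
  \cs_(y <- l) G y = \cs_(y <- l') G y.
Proof.
elim=> {l l'} [//|x l l' _ IH|x y l|l m n _ IH1 _ IH2]; rewrite ?big_cons ?IH1 // ?IH //.
by rewrite /= !Cplus_assoc [(G y + _)%C]Cplus_comm.
Qed.

(** Multiplication by a character [psi] with [psi a <> 1] permutes all characters, so the sum is
    unchanged by a factor other than [1] and must vanish. *)
Lemma char_sum_column a : \cs_(chi <- all_chars) chi a =
  if (a == 1 %[mod q])%N then RtoC (INR (size all_chars)) else RtoC 0.
Proof.
case: (boolP (a == 1 %[mod q])%N) => [/eqP E|ne].
  rewrite (@csum_in _ _ _ (fun=> RtoC 1)) ?csum_const ?Cmult_1_r // => chi /all_chars_spec h.
  by rewrite (char_eqmod h E) char1.
case: (boolP (coprime a q)) => c; last first.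
  by rewrite (@csum_in _ _ _ (fun=> RtoC 0)) ?big1_eq // => chi /all_chars_spec h; exact: char_eq0.
have [psi hpsi p1] := separating_char c ne.
apply: (Cmult_fix0 p1).
rewrite big_distrr /= -(big_map (fun chi n => psi n * chi n)%C xpredT (fun chi => chi a)).
have emap (f : (nat -> C) -> nat -> C) s : [seq f x | x <- s] = List.map f s by elim: s => //= x s ->.
apply: csum_perm; rewrite emap; apply: Permutation.Permutation_map_same_l.
  apply: FinFun.Injective_map_NoDup_in; last exact: all_chars_nodup.
  move=> f g /all_chars_spec hf /all_chars_spec hg E; apply: functional_extensionality => n.
  case: (boolP (coprime n q)) => cn; last by rewrite !char_eq0.
  have En := f_equal (fun h => h n) E; rewrite /= in En.
  have pn := char_neq0 hpsi cn.
  transitivity (/ psi n * (psi n * f n))%C; first by field.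
  by rewrite En; field.
move=> f /List.in_map_iff[g [<- /all_chars_spec hg]].
by apply/all_chars_spec; apply: char_prod.
Qed.

(** Double summation of [chi n] over residues and characters: one order leaves only [n = 1], the
    other only the principal character. *)
Lemma size_all_chars : size all_chars = phi.
Proof.
apply: INR_eq; apply: RtoC_inj.
transitivity (\cs_(n <- iota 0 q) \cs_(chi <- all_chars) chi n).
  rewrite (big_rem 1%N) /=; last by rewrite mem_iota add0n.
  rewrite char_sum_column eqxx big1_seq ?Cplus_0_r // => n /=.
  rewrite (rem_filter _ (iota_uniq 0 q)) mem_filter /= mem_iota add0n /= => /andP[n1 nq].
  by rewrite char_sum_column !modn_small // (negbTE n1).
rewrite exchange_big /= (@csum_delta _ all_chars _ principal) //.
- rewrite -(char_norm2 principal_char); apply: eq_bigr => n _; rewrite /principal.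
  by case: coprime; rewrite Cconj_R ?Cmult_1_r ?Cmult_0_l.
- exact: all_chars_nodup.
- by left.
move=> chi /all_chars_spec h ne; apply: nonprincipal_sum0; split=> // hp.
by apply: ne; apply: principal_unique.
Qed.

(** For [n'] inverse to [n] modulo [q], [Cconj (chi n)] equals [chi n'], and the sum becomes
    [char_sum_column] at [m * n']. *)
Lemma char_orthogonality m n : \cs_(chi <- all_chars) (chi m * Cconj (chi n))%C =
  if coprime n q && (m == n %[mod q])%N then RtoC (INR phi) else RtoC 0.
Proof.
case: (boolP (coprime n q)) => c /=; last first.
  rewrite (@csum_in _ _ _ (fun=> RtoC 0)) ?big1_eq // => chi /all_chars_spec h.
  by rewrite (char_eq0 h c) Cconj_R Cmult_0_r.
have [n' hn'] : exists n', (n * n' = 1 %[mod q])%N.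
  exists (n ^ (totient q).-1)%N; rewrite -expnS prednK ?totient_gt0 //.
  exact: mathcomp.solvable.cyclic.Euler_exp_totient.
rewrite (@csum_in _ _ _ (fun chi => chi (m * n')%N)) => [|chi /all_chars_spec h]; last first.
  have cn' : (chi n * chi n')%C = RtoC 1 by rewrite -char_mul // (char_eqmod h hn') char1.
  rewrite char_mul //; congr Cmult.
  transitivity (Cconj (chi n) * (chi n * chi n'))%C; first by rewrite cn' Cmult_1_r.
  by rewrite Cmult_assoc [(Cconj _ * _)%C]Cmult_comm char_conj_mul // Cmult_1_l.
rewrite char_sum_column size_all_chars; congr (if _ then _ else _); apply/eqP/eqP => E.
  by rewrite -(muln1 m) -modnMmr -hn' modnMmr mulnCA -modnMmr E modnMmr muln1.
by rewrite -modnMml E modnMml.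
Qed.

Lemma phi_totient : phi = totient q.
Proof.
by rewrite totient_count_coprime /phi size_filter -sum1_count /index_iota subn0 big_mkcond /=;
  apply: eq_bigr => n _; rewrite coprime_sym; case: coprime.
Qed.

(** The two counts run over [1..q] and [0..q-1]; as [q > 1], neither [q] nor [0] is coprime to
    [q]. *)
Lemma Defs_totient : Defs.totient q = phi.
Proof.
have sq : iota 0 q = 0%N :: iota 1 q.-1 by rewrite -{1}(prednK q0).
have E1 : Defs.totient q = size [seq n <- iota 1 q | coprime n q].
  rewrite /Defs.totient.
  have -> : List.seq 1 q = iota 1 q by elim: (q) 1%N => //= k IH s; rewrite IH.
  elim: (iota 1 q) => //= n s IH; rewrite /coprime -gcdnE.
  by case: Nat.eqb_spec => E; [rewrite E eqxx /= -IH | move/eqP/negbTE: E => ->].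
have c0 : coprime 0 q = false by rewrite /coprime gcd0n gtn_eqF.
have cq : coprime q q = false by rewrite /coprime gcdnn gtn_eqF.
rewrite E1; have -> : size [seq n <- iota 1 q | coprime n q] = size [seq n <- iota 1 q.-1 ++ [:: q] | coprime n q].
  have iotaS k : (0 < k)%N -> iota 1 k = iota 1 k.-1 ++ [:: k].
    by case: k => // k _; rewrite -{1}(addn1 k) iotaD add1n.
  by rewrite -iotaS.
by rewrite /phi sq filter_cat /= c0 cq cats0.
Qed.

Lemma INR_prod (s : seq nat) (F : nat -> nat) :
  INR (\prod_(p <- s) F p)%N = \big[Rmult/1]_(p <- s) INR (F p).
Proof.
elim: s => [|p s IH]; first by rewrite !big_nil.
by rewrite !big_cons -multE mult_INR IH.
Qed.

(** Prime by prime, [p <= 2 (p - 1)]. *)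
Lemma totient_lower : INR q <= INR phi * \big[Rmult/1]_(p <- primes q) 2.
Proof.
rewrite phi_totient (totientE q0) {1}(prod_prime_decomp q0) prime_decompE big_map !INR_prod -big_split /=.
apply: (proj2 (rprod_le _)) => p pq; split; first exact: pos_INR.
have pp : prime p by move: pq; rewrite mem_primes => /and3P[].
have e0 : (0 < logn p q)%N by rewrite logn_gt0.
have -> : INR (p.-1 * p ^ (logn p q).-1)%N * 2 = INR (p.-1 * p ^ (logn p q).-1 * 2)%N.
  by rewrite -[in RHS]multE mult_INR.
apply: le_INR; apply/leP; rewrite -{1}(prednK e0) expnS mulnAC leq_mul2r; apply/orP; right.
by case: p pp {pq e0} => [|[|p]] //= _; rewrite muln2 doubleS !ltnS -addnn leq_addr.
Qed.

End DirichletCharacters.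

(** * The Euler product of the main term *)

Section EulerProduct.

Lemma dvdn_divide d n : (d %| n)%N <-> Nat.divide d n.
Proof.
split=> [/dvdnP[k E]|[k E]]; first by exists k; rewrite multE.
by apply/dvdnP; exists k; rewrite -multE.
Qed.

Lemma primebE p : primeb p = prime p.
Proof.
rewrite /primeb; case: Znumtheory.prime_dec => h; symmetry.
  have [h1 h2] := proj2 (Znumtheory.prime_alt _) h.
  have p1 : (1 < p)%N by apply/ltP; lia.
  apply/primeP; split=> // d dp; have d0 : (0 < d)%N by apply: dvdn_gt0 dp; exact: ltnW.
  have dlep := dvdn_leq (ltnW p1) dp.
  apply: contraT; rewrite negb_or => /andP[d1 dnp].
  have lt1 : (1 < d)%N by rewrite ltn_neqAle eq_sym d1.
  have lt2 : (d < p)%N by rewrite ltn_neqAle dnp.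
  case: (h2 (Z.of_nat d)); first by move/ltP: lt1; move/ltP: lt2; lia.
  by case/dvdn_divide: dp => k ->; exists (Z.of_nat k); rewrite Znat.Nat2Z.inj_mul.
apply/negP => pp; apply: h; apply/Znumtheory.prime_alt; split.
  by have /ltP := prime_gt1 pp; lia.
move=> n hn [k E].
have k0 : BinInt.Z.le BinNums.Z0 k.
  by have := Znat.Nat2Z.is_nonneg p; case: (BinInt.Z.lt_ge_cases k BinNums.Z0) => //; nia.
have dv : (Z.to_nat n %| p)%N.
  apply/dvdn_divide; exists (Z.to_nat k); apply: Znat.Nat2Z.inj; rewrite Znat.Nat2Z.inj_mul !Znat.Z2Nat.id //; lia.
case/primeP: pp => _ /(_ _ dv)/orP[/eqP|/eqP]; lia.
Qed.

Lemma mod_eqb_dvdn q p : (0 < p)%N -> Nat.eqb (Nat.modulo q p) 0 = (p %| q)%N.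
Proof.
move=> p0; apply/idP/idP.
  move/Nat.eqb_spec => E; apply/dvdn_divide/Nat.Lcm0.mod_divide; exact: E.
by move/dvdn_divide/Nat.Lcm0.mod_divide => E; apply/Nat.eqb_spec.
Qed.

Variables (k q : nat).
Hypothesis q0 : (0 < q)%N.

(** The term at [p ^ j] of the Euler factor of [ecoef]; for [p] dividing [q] only [j = 0]
    survives. *)
Definition eloc (p j : nat) : R :=
  if j is 0%N then 1 else if (p %| q)%N then 0 else mob k j ^ 2 * npow (p ^ j)%N (-2).

Definition ecoef (n : nat) : R := if coprime n q then muk k n ^ 2 * npow n (-2) else 0.

Lemma ecoef_ge0 n : 0 <= ecoef n.
Proof.
rewrite /ecoef; case: ifP => _; last lra.
by apply: Rmult_le_pos; [exact: pow2_ge_0 | exact: npow_ge0].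
Qed.

Lemma npow_1 x : npow 1 x = 1. Proof. by rewrite /= ln_1 Rmult_0_r exp_0. Qed.

Lemma ecoef_pfactor m p a : prime p -> coprime p m -> (0 < m)%N ->
  ecoef (m * p ^ a)%N = ecoef m * eloc p a.
Proof.
move=> pp cp m0; case: a => [|a]; first by rewrite expn0 muln1 /= Rmult_1_r.
have E : muk k (m * p ^ a.+1)%N = muk k m * mob k a.+1.
  apply: RtoC_inj; rewrite RtoC_mult !muk_mulf mulf_pfactor // => r; by rewrite mob0.
rewrite /ecoef /eloc coprimeMl coprime_pexpl // (prime_coprime _ pp) E npow_mul.
by case: (coprime m q); case: (p %| q)%N => /=; ring.
Qed.

Lemma ecoef1 : ecoef 1 = 1.
Proof. by rewrite /ecoef coprime1n muk1 npow_1; ring. Qed.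

Lemma mob_big j : (k < j)%N -> mob k j = 0.
Proof.
suff H : forall k j, (k < j)%N -> Defs.binom k j = 0%N by move=> kj; rewrite /mob H //= Rmult_0_r.
elim=> [|i IH] [|l] // il.
have -> : Defs.binom i.+1 l.+1 = (Defs.binom i l + Defs.binom i l.+1)%N by [].
by rewrite !IH // ltnW.
Qed.

Lemma npow_N2 n : (0 < n)%N -> npow n (-2) = / INR n * / INR n.
Proof. by move=> n0; rewrite -npowN1 // -npow_add; congr npow; ring. Qed.

Lemma eloc_sum p : (0 < p)%N -> ~~ (p %| q)%N ->
  \rs_(j <- iota 0 k.+1) eloc p j = local_factor k p.
Proof.
move=> p0 pq; rewrite /local_factor sum_f_R0_big.
rewrite -(big_mkord xpredT (fun j => INR (Defs.binom k j) ^ 2 / INR p ^ (2 * j))).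
rewrite /index_iota subn0; apply: eq_bigr => j _.
have ip : INR p <> 0 by apply: not_0_INR; move/ltP: p0; lia.
have E : eloc p j = mob k j ^ 2 * npow (p ^ j)%N (-2).
  rewrite /eloc; case: j => [|j]; last by rewrite (negbTE pq).
  by rewrite expn0 npow_1 mob0; ring.
have pe : INR (p ^ j)%N = INR p ^ j.
  by elim: (j) => [|i IH] //; rewrite expnS -multE mult_INR IH.
have e2 : INR p ^ (Nat.mul 2 j) = (INR p ^ j) ^ 2 by rewrite Nat.mul_comm pow_mult.
have sq : mob k j ^ 2 = INR (Defs.binom k j) ^ 2.
  rewrite /mob Rpow_mult_distr -pow_mult Nat.mul_comm pow_mult.
  have -> : (-1) ^ 2 = 1 by ring.
  by rewrite pow1 Rmult_1_l.
transitivity (INR (Defs.binom k j) ^ 2 / (INR p ^ j) ^ 2); last by rewrite -e2.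
by rewrite E sq npow_N2 ?expn_gt0 ?p0 // pe; field; exact: pow_nonzero.
Qed.

Lemma eloc_sum_dvd p : (p %| q)%N -> \rs_(j <- iota 0 k.+1) eloc p j = 1.
Proof.
move=> pq; rewrite [iota 0 k.+1]/= big_cons big1_seq /=; first ring.
by move=> [|j] /=; rewrite ?pq // mem_iota.
Qed.

Definition eprod (N : nat) : R :=
  prod_primes_le (fun p => if (p %| q)%N then 1 else local_factor k p) N.

Lemma eprodS N : eprod N.+1 = eprod N * (if prime N.+1 then \rs_(j <- iota 0 k.+1) eloc N.+1 j else 1).
Proof.
rewrite /eprod /= primebE; case: ifP => // _; congr Rmult.
by case: (boolP (N.+1 %| q)%N) => pq; [rewrite eloc_sum_dvd | rewrite eloc_sum].
Qed.

(** Since [mob k j] vanishes for [j > k], the product up to [N] expands into a finite sum over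
    smooth numbers. In the induction a prime [N.+1] multiplies the list by its powers up to the
    [k]-th. *)
Lemma eprod_smooth N : exists s : seq nat, [/\ uniq s,
  forall n, n \in s -> (0 < n)%N /\ (forall p, prime p -> (p %| n)%N -> (p <= N)%N),
  \rs_(n <- s) ecoef n = eprod N &
  forall n, (0 < n)%N -> (forall p, prime p -> (p %| n)%N -> (p <= N)%N) -> n \notin s -> ecoef n = 0].
Proof.
elim: N => [|N [s [us hs Es Zs]]].
  exists [:: 1%N]; split=> //.
  - move=> n; rewrite inE => /eqP ->; split=> // p pp; rewrite dvdn1 => /eqP E; by rewrite E in pp.
  - by rewrite big_seq1 ecoef1.
  move=> n n0 H; rewrite inE => n1; exfalso.
  have n2 : (1 < n)%N by rewrite ltn_neqAle eq_sym n1.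
  have := H _ (pdiv_prime n2) (pdiv_dvd n).
  by rewrite leqn0 => /eqP E; have := pdiv_prime n2; rewrite E.
rewrite eprodS; case: (boolP (prime N.+1)) => pp; last first.
  have le p : prime p -> ((p <= N.+1)%N = (p <= N)%N).
    by move=> pp'; rewrite leq_eqVlt ltnS; case: eqP => // E; rewrite E (negbTE pp) in pp'.
  exists s; split=> //; last 1 first.
  - by move=> n n0 H; apply: Zs => // p pp' pn; rewrite -(le p pp'); apply: H.
  - by move=> n /hs[n0 H]; split=> // p pp' pn; rewrite (le p pp'); apply: H.
  by rewrite Rmult_1_r.
set p := N.+1 in pp *.
have cps m : m \in s -> coprime p m.
  by case/hs=> m0 H; rewrite prime_coprime //; apply/negP => /(H p pp); rewrite ltnn.
exists [seq (m * p ^ j)%N | m <- s, j <- iota 0 k.+1]; split.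
- apply: allpairs_uniq; rewrite ?iota_uniq //.
  move=> [m i] [m' i'] h1 h2 E.
  have {h1} ms : m \in s by case/allpairsPdep: h1 => x [y [hx _ [-> _]]].
  have {h2} ms' : m' \in s by case/allpairsPdep: h2 => x [y [hx _ [-> _]]].
  have /= E' : (m * p ^ i = m' * p ^ i')%N by [].
  have L z e : z \in s -> logn p (z * p ^ e)%N = e.
    move=> zs; have [z0 _] := hs z zs.
    have pe0 : (0 < p ^ e)%N by rewrite expn_gt0.
    by rewrite (lognM p z0 pe0) (pfactorK e pp) (logn_coprime (cps z zs)).
  have ii : i = i' by rewrite -(L m i) // E' L.
  by move: E'; rewrite ii => /eqP; rewrite eqn_pmul2r ?expn_gt0 ?prime_gt0 // => /eqP ->.
- move=> n /allpairsPdep[m [j [ms _ ->]]]; have [m0 H] := hs m ms; split.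
    by rewrite muln_gt0 m0 expn_gt0 prime_gt0.
  move=> r rp; rewrite Euclid_dvdM // => /orP[/(H r rp)/leqW //|].
  by rewrite Euclid_dvdX // => /andP[/(dvdn_leq (prime_gt0 pp))].
- rewrite big_allpairs_dep -Es big_distrl; rewrite big_seq [RHS]big_seq; apply: eq_bigr => m ms.
  rewrite [RHS]/= big_distrr; apply: eq_bigr => j _.
  by rewrite ecoef_pfactor //; [exact: cps | case: (hs m ms)].
move=> n n0 H nin; have [m cp E] := pfactor_coprime pp n0; set a := logn p n in E.
have m0 : (0 < m)%N by move: n0; rewrite E muln_gt0 => /andP[].
rewrite E ecoef_pfactor //; case: (leqP a k) => ak; last first.
  rewrite /eloc; case: a ak {E} => // a ak; case: ifP => _; first ring.
  by rewrite mob_big //; ring.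
rewrite Zs ?Rmult_0_l //.
  move=> r rp rm; have := H r rp; rewrite E dvdn_mulr // => /(_ isT).
  rewrite leq_eqVlt => /orP[/eqP Er|]; last by rewrite ltnS.
  by move: cp; rewrite -Er prime_coprime // rm.
apply: contra nin => ms; rewrite E; apply/allpairsPdep; exists m, a; split=> //.
by rewrite mem_iota add0n ltnS.
Qed.

Lemma ecoef_summ : summ (fun n => RtoC (ecoef n)).
Proof.
have [K K1 HK] := @muk_bound k (1 / 4) ltac:(lra).
apply: summ_le (summ_scal (RtoC (K * K)) (@summ_npow (-3 / 2) ltac:(lra))) _ => n.
rewrite Cmod_mult !Cmod_R !Rabs_pos_eq; try exact: npow_ge0; try exact: ecoef_ge0; last nra.
have K0 : 0 <= K * K * npow n (-3 / 2) by apply: Rmult_le_pos; [nra | exact: npow_ge0].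
rewrite /ecoef; case: ifP => // _.
have -> : npow n (-2) = (npow n (- (1 / 4)) * npow n (- (1 / 4))) * npow n (-3 / 2).
  by rewrite -!npow_add; congr npow; field.
have h := HK n; have h0 : 0 <= Rabs (muk k n) * npow n (- (1 / 4)).
  by apply: Rmult_le_pos; [exact: Rabs_pos | exact: npow_ge0].
rewrite -pow2_abs; have -> : Rabs (muk k n) ^ 2 * (npow n (- (1 / 4)) * npow n (- (1 / 4)) * npow n (-3 / 2))
  = ((Rabs (muk k n) * npow n (- (1 / 4))) * (Rabs (muk k n) * npow n (- (1 / 4)))) * npow n (-3 / 2) by ring.
apply: Rmult_le_compat_r; first exact: npow_ge0.
exact: Rmult_le_compat.
Qed.

Definition esum : R := rtot ecoef.

Lemma ecoef0 : ecoef 0 = 0.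
Proof. by rewrite /ecoef /=; case: ifP => _; ring. Qed.

(** Every [n <= N] has its prime factors up to [N] and all terms are nonnegative, so the product
    lies between the partial sum up to [N] and the full sum. *)
Lemma eprod_lim : is_lim_seq eprod (Rbar.Finite esum).
Proof.
apply/is_lim_seq_spec => eps.
have [N0 HN] := usum_Ccv (totP ecoef_summ) (cond_pos eps).
exists N0 => N hN; have := HN N.+1 ltac:(lia).
rewrite (tot_real ecoef_summ) -/(rtot ecoef) -/esum -RtoC_rsum -RtoC_minus Cmod_R.
have [s [us hs Es Zs]] := eprod_smooth N.
have up : eprod N <= esum.
  by rewrite -Es; apply: rtot_ge_fin ecoef_summ ecoef_ge0 us.
have lo : \rs_(n < N.+1) ecoef n <= eprod N.
  rewrite -Es -(big_mkord xpredT ecoef) (bigID (fun n => n \in s)) /= [X in _ + X]big1_seq ?Rplus_0_r.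
    rewrite -big_filter; apply: rsum_subset => //; last exact: ecoef_ge0.
      by rewrite filter_uniq ?iota_uniq.
    by move=> n; rewrite mem_filter => /andP[].
  move=> n /andP[nin]; rewrite mem_index_iota /= => nN.
  case: (posnP n) => [->|n0]; first exact: ecoef0.
  by apply: Zs => // p pp pn; apply: leq_trans (dvdn_leq n0 pn) _; rewrite -ltnS.
set S := \rs_(n < N.+1) ecoef n in lo; move=> h.
have {}h : Rabs (S - esum) < eps by exact: h.
have := Rle_abs (- (S - esum)); rewrite Rabs_Ropp => h2.
by have := cond_pos eps; move=> e0; apply: Rabs_def1; lra.
Qed.

Lemma esum_ge1 : 1 <= esum.
Proof.
have := rtot_ge_fin ecoef_summ ecoef_ge0 (isT : uniq [:: 1%N]).
by rewrite big_seq1 ecoef1.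
Qed.

Lemma local_factor_pos p : (0 < p)%N -> 0 < local_factor k p.
Proof.
move=> p0; rewrite /local_factor sum_f_R0_big big_ord_recl.
have ip : 0 < INR p by apply: lt_0_INR; apply/ltP.
apply: (@Rlt_le_trans _ (1 + 0)); first lra; apply: Rplus_le_compat.
  have b0 : Defs.binom k 0 = 1%N by case: (k).
  by rewrite [nat_of_ord _]/= b0 Nat.mul_0_r /=; right; field.
apply: rsum_ge0 => i _; apply: Rmult_le_pos; first exact: pow2_ge_0.
by apply: Rlt_le; apply: Rinv_0_lt_compat; apply: pow_lt.
Qed.

Definition dprod (N : nat) : R := prod_primes_le (fun p => if (p %| q)%N then local_factor k p else 1) N.

Lemma dprod_pos N : 0 < dprod N.
Proof.
elim: N => [|N IH]; first by rewrite /dprod /=; lra.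
rewrite /dprod /= -/(dprod N); apply: Rmult_lt_0_compat => //.
by case: primeb; [case: ifP => _; [exact: local_factor_pos | lra] | lra].
Qed.

Lemma prod_split N : prod_primes_le (local_factor k) N = eprod N * dprod N.
Proof.
elim: N => [|N IH]; first by rewrite /eprod /dprod /=; ring.
rewrite /eprod /dprod /= -/(eprod N) -/(dprod N) IH.
by case: primeb; [case: ifP => _; ring | ring].
Qed.

Lemma dprod_stable N : (q <= N)%N -> dprod N = dprod q.
Proof.
elim: N => [|N IH]; first by rewrite leqn0 => /eqP ->.
rewrite leq_eqVlt => /orP[/eqP -> //|]; rewrite ltnS => qN; rewrite -IH // /dprod /= -/(dprod N).
by rewrite gtnNdvd //; case: primeb; rewrite Rmult_1_r.
Qed.

(** The factors at primes not dividing [q] converge to [esum]; those at primes dividing [q] no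
    longer change beyond [q]. *)
Lemma Cconst_esum : Cconst k = esum * dprod q.
Proof.
have L : is_lim_seq (fun N => prod_primes_le (local_factor k) N) (Rbar.Finite (esum * dprod q)).
  apply: (is_lim_seq_ext_loc (fun N => dprod q * eprod N)).
    by exists q => N /leP qN; rewrite prod_split (dprod_stable qN) Rmult_comm.
  rewrite Rmult_comm; exact: (is_lim_seq_scal_l eprod (dprod q) (Rbar.Finite esum) eprod_lim).
by rewrite /Cconst (is_lim_seq_unique _ _ L).
Qed.

Lemma prod_inv N : prod_primes_le (fun p => if Nat.eqb (Nat.modulo q p) 0 then / local_factor k p else 1) N
  = / dprod N.
Proof.
elim: N => [|N IH]; first by rewrite /dprod /= Rinv_1.
rewrite /dprod; set F := (fun p => if Nat.eqb _ _ then _ else _) in IH *.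
change (prod_primes_le F N.+1) with (prod_primes_le F N * (if primeb N.+1 then F N.+1 else 1)).
rewrite IH; set G := (fun p => _); change (prod_primes_le G N.+1) with (dprod N * (if primeb N.+1 then G N.+1 else 1)).
rewrite Rinv_mult; congr Rmult; case: primeb; last by rewrite Rinv_1.
rewrite /F /G mod_eqb_dvdn //; case: ifP => //; by rewrite Rinv_1.
Qed.

Lemma main_termE : (1 < q)%N -> main_term k q = INR (phi q) * esum.
Proof.
move=> q1; rewrite /main_term Cconst_esum (Defs_totient q1) /prod_primes_dvd prod_inv.
by field; have := dprod_pos q; lra.
Qed.

End EulerProduct.

(** * The weights produced by cutting the Taylor expansion *)

Section TruncatedWeights.

Definition wsum (J n : nat) : R := \rs_(j < J) tcoef j n.

Lemma wsum_ge0 J n : 0 <= wsum J n.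
Proof. by apply: rsum_ge0 => j _; exact: tcoef_ge0. Qed.

Lemma wsumE J n : wsum J n = npow n (-2) * \rs_(j < J) expterm j (ln (INR n)).
Proof. by rewrite /wsum big_distrr. Qed.

Lemma inv_pow_le z i J : 0 < z < 1 -> (i <= J)%N -> (/ z) ^ i <= (/ z) ^ J.
Proof.
move=> hz iJ; apply: Rle_pow; last exact/leP.
by rewrite -Rinv_1; apply: Rinv_le_contravar; lra.
Qed.

(** Inserting [z^(j-J) >= 1] into each term completes the sum to the exponential series of [z ln n].
    The exponent [-2 + z < -1] yields absolute convergence, at the price [z^(-J)], which is kept
    small by [z] close to [1]. *)
Lemma wsum_le z J n : 0 < z < 1 -> wsum J n <= (/ z) ^ J * npow n (-2 + z).
Proof.
move=> hz; rewrite wsumE npow_add.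
have l0 := ln_nat_ge0 n.
have h : \rs_(j < J) expterm j (ln (INR n)) <= (/ z) ^ J * exp (z * ln (INR n)).
  apply: Rle_trans (_ : \rs_(j < J) ((/ z) ^ J * expterm j (z * ln (INR n))) <= _).
    apply: rsum_le => j; rewrite expterm_scal -Rmult_assoc -[X in X <= _]Rmult_1_l.
    apply: Rmult_le_compat_r; first exact: expterm_ge0.
    have -> : 1 = (/ z) ^ j * z ^ j by rewrite -Rpow_mult_distr Rinv_l ?pow1; lra.
    apply: Rmult_le_compat_r; first by apply: pow_le; lra.
    by apply: inv_pow_le => //; apply: ltnW.
  rewrite -big_distrr /=; apply: Rmult_le_compat_l.
    by apply: pow_le; apply: Rlt_le; apply: Rinv_0_lt_compat; lra.
  by apply: expterm_sum_le; apply: Rmult_le_pos; lra.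
case: n l0 h => [|n] l0 h; first by rewrite /=; lra.
rewrite [npow n.+1 z]npowE //.
have := Rmult_le_compat_l _ _ _ (npow_ge0 n.+1 (-2)) h; lra.
Qed.

Lemma wsum_le_inv J n : wsum J n <= npow n (-1).
Proof.
rewrite wsumE; have l0 := ln_nat_ge0 n.
have -> : -1 = -2 + 1 by ring.
rewrite npow_add; case: n l0 => [|n] l0; first by rewrite /=; lra.
apply: Rmult_le_compat_l; first exact: npow_ge0.
by rewrite npowE // Rmult_1_l; apply: expterm_sum_le.
Qed.

(** For [j >= J] the factor [(4/5)^J (5/4)^j] is at least [1], and with it the terms belong to the
    exponential series of [(5/4) ln n]. The remaining [n^(-3/4)] is summable after a further factor
    [1/n]. *)
Lemma wsum_tail J n : npow n (-1) - wsum J n <= (4 / 5) ^ J * npow n (-3 / 4).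
Proof.
case: n => [|n].
  have -> : wsum J 0 = 0 by rewrite /wsum big1 // => j _; exact: tcoef_at0.
  by rewrite /=; lra.
have L := tcoef_series 1 (ltn0Sn n); have e : 1 - 2 = -1 by ring.
rewrite e in L.
have l0 := ln_nat_ge0 n.+1.
have T M : Cmod (\cs_(j < J + M) (RtoC (tcoef j n.+1) * RtoC 1 ^ j) + - RtoC (wsum J n.+1))%C
   <= (4 / 5) ^ J * npow n.+1 (-3 / 4).
  have -> : \cs_(j < J + M) (RtoC (tcoef j n.+1) * RtoC 1 ^ j)%C = RtoC (\rs_(j < J + M) tcoef j n.+1).
    by rewrite RtoC_rsum; apply: eq_bigr => j _; rewrite Cpow_1_l Cmult_1_r.
  rewrite -RtoC_opp -RtoC_plus Cmod_R /wsum.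
  rewrite -!(big_mkord xpredT (fun j => tcoef j n.+1)) (@big_cat_nat _ _ _ J) ?leq_addr //.
  rewrite [X in X <= _]/=.
  set x := bigop _ _ _; set y := bigop _ _ _.
  have -> : x + y + - x = y by ring.
  rewrite Rabs_pos_eq; last by apply: rsum_ge0 => j _; exact: tcoef_ge0.
  have -> : npow n.+1 (-3 / 4) = npow n.+1 (-2) * exp (5 / 4 * ln (INR n.+1)).
    by rewrite -(npowE (5 / 4)) // -npow_add; congr npow; field.
  apply: Rle_trans (_ : (4 / 5) ^ J * npow n.+1 (-2) * \big[Rplus/0]_(J <= j < J + M) expterm j (5 / 4 * ln (INR n.+1)) <= _).
    rewrite big_distrr; apply: rsum_le_in => j; rewrite mem_index_iota => /andP[Jj _].
    apply: Rle_trans (_ : (4 / 5) ^ J * npow n.+1 (-2) * ((5 / 4) ^ j * expterm j (ln (INR n.+1))) <= _); last first.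
      by rewrite -expterm_scal; exact: Rle_refl.
    rewrite /tcoef.
    have E : (4 / 5) ^ j * (5 / 4) ^ j = 1.
      by rewrite -Rpow_mult_distr (_ : 4 / 5 * (5 / 4) = 1) ?pow1 //; field.
    have r : (4 / 5) ^ j <= (4 / 5) ^ J.
      rewrite -(subnKC Jj) -plusE pow_add -[X in _ <= X]Rmult_1_r; apply: Rmult_le_compat_l; first by apply: pow_le; lra.
      by rewrite -(pow1 (j - J)); apply: pow_incr; lra.
    have p : 0 <= (5 / 4) ^ j by apply: pow_le; lra.
    have r1 : 1 <= (4 / 5) ^ J * (5 / 4) ^ j by rewrite -E; apply: Rmult_le_compat_r.
    have c0 : 0 <= npow n.+1 (-2) * expterm j (ln (INR n.+1)).
      by apply: Rmult_le_pos; [exact: npow_ge0 | exact: expterm_ge0].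
    have := Rmult_le_compat_l _ _ _ c0 r1; lra.
  rewrite -Rmult_assoc; apply: Rmult_le_compat_l.
    by apply: Rmult_le_pos; [apply: pow_le; lra | exact: npow_ge0].
  have x0 : 0 <= 5 / 4 * ln (INR n.+1) by lra.
  apply: Rle_trans (expterm_sum_le (J + M) x0).
  rewrite -!(big_mkord xpredT (fun j => expterm j _)) [X in _ <= X](@big_cat_nat _ _ _ J) ?leq_addr //.
  rewrite -[X in X <= _]Rplus_0_l; apply: Rplus_le_compat; last exact: Rle_refl.
  by apply: rsum_ge0 => j _; exact: expterm_ge0.
have L2 := Ccv_add L (Ccv_const (- RtoC (wsum J n.+1))%C).
have B : Cmod (RtoC (npow n.+1 (-1)) + - RtoC (wsum J n.+1))%C <= (4 / 5) ^ J * npow n.+1 (-3 / 4).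
  apply: (@Ccv_bound (fun M => \cs_(j < J + M) (RtoC (tcoef j n.+1) * RtoC 1 ^ j) + - RtoC (wsum J n.+1))%C) => //.
  move=> eps e0; have [N HN] := L2 eps e0; exists N => M hM.
  by apply: HN; rewrite -plusE; lia.
rewrite -RtoC_opp -RtoC_plus Cmod_R in B; apply: Rle_trans B; exact: Rle_abs.
Qed.

Definition bcoef (k J n : nat) : R := muk k n * wsum J n.

(** [-2 + z = -1 - 4 d]: one [d] absorbs [muk], three are left for convergence. *)
Lemma bcoef_bound z d K k J n : 0 < z < 1 -> d = (1 - z) / 4 -> 1 <= K ->
  (forall n, Rabs (muk k n) * npow n (- d) <= K) ->
  Rabs (bcoef k J n) <= K * (/ z) ^ J * npow n (-1 - 3 * d).
Proof.
move=> hz hd K1 HK; rewrite /bcoef Rabs_mult (Rabs_pos_eq (wsum J n)); last exact: wsum_ge0.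
have h := wsum_le J n hz.
have z0 : 0 <= (/ z) ^ J by apply: pow_le; apply: Rlt_le; apply: Rinv_0_lt_compat; lra.
have E : npow n (-2 + z) = npow n (- d) * npow n (-1 - 3 * d).
  by rewrite -npow_add; congr npow; rewrite hd; field.
apply: Rle_trans (Rmult_le_compat_l _ _ _ (Rabs_pos _) h) _; rewrite E.
have -> : Rabs (muk k n) * ((/ z) ^ J * (npow n (- d) * npow n (-1 - 3 * d)))
  = (Rabs (muk k n) * npow n (- d)) * ((/ z) ^ J * npow n (-1 - 3 * d)) by ring.
rewrite [X in _ <= X]Rmult_assoc; apply: Rmult_le_compat_r => //.
by apply: Rmult_le_pos => //; exact: npow_ge0.
Qed.

(** The Taylor polynomial of degree below [J] at [z = 1], with the sum over [j] moved inside the sum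
    over [n]. *)
Lemma bcoef_sum k J u : (forall n, Cmod (u n) <= 1) ->
  \cs_(j < J) dmuk u k j = tot (fun n => RtoC (bcoef k J n) * u n)%C.
Proof.
move=> u1; rewrite -(@tot_sum _ _ _ (fun (j : 'I_J) n => RtoC (muk k n) * u n * RtoC (tcoef j n))%C).
  apply: tot_ext => n; rewrite /bcoef /wsum RtoC_mult RtoC_rsum -big_distrr /=; ring.
by move=> j; apply: (@summ_tcoef (1 / 2)); [lra | apply: adm_muk => //; lra].
Qed.

End TruncatedWeights.

(** * The second moment over characters and its off-diagonal terms *)

Section OffDiagonal.

Variables (q : nat) (b : nat -> R) (Kb d : R).
Hypothesis q1 : (1 < q)%N.
Hypothesis Kb0 : 0 <= Kb.
Hypothesis d0 : 0 < d.
Hypothesis b_le : forall n, Rabs (b n) <= Kb * npow n (-1 - d).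

Let beta (n : nat) : R := Kb * npow n (-1 - d).
Let Z : R := Kb * (1 + / d).

Lemma beta_ge0 n : 0 <= beta n.
Proof. by apply: Rmult_le_pos => //; exact: npow_ge0. Qed.

Lemma beta_summ : summ_by (fun n => RtoC (beta n)) Z.
Proof.
move=> s us; have h := @summ_by_npow d d0 s us.
rewrite (eq_bigr (fun n => Kb * Cmod (RtoC (npow n (-1 - d))))) => [|n _].
  by rewrite -big_distrr /=; apply: Rmult_le_compat_l.
by rewrite /beta RtoC_mult Cmod_mult (Cmod_R Kb) Rabs_pos_eq.
Qed.

Lemma b_summ : summ (fun n => RtoC (b n)).
Proof.
have := beta_summ => h; apply: (summ_le (ex_intro _ Z h)) => n.
rewrite !Cmod_R (Rabs_pos_eq (beta n)); [exact: b_le | exact: beta_ge0].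
Qed.

Let up (p : nat * nat) : C := if (p.1 < p.2)%N && (p.1 == p.2 %[mod q])%N then RtoC (beta p.1 * beta p.2) else RtoC 0.

Lemma npow_anti m n x : (0 < m)%N -> (m <= n)%N -> x <= 0 -> npow n x <= npow m x.
Proof.
move=> m0 mn x0; have h := @npow_leq m n (- x) m0 mn ltac:(lra).
have n0 : (0 < n)%N by apply: leq_trans mn.
have e r : (0 < r)%N -> npow r x * npow r (- x) = 1.
  by move=> r0; rewrite -npow_add npowE // Rplus_opp_r Rmult_0_l exp_0.
have em := e m m0; have en := e n n0; have v0 := npow_ge0 n x; have u0 := npow_ge0 m x.
have h1 := Rmult_le_compat_l _ _ _ v0 h; rewrite en in h1.
have := Rmult_le_compat_l _ _ _ u0 h1.
have -> : npow m x * (npow n x * npow m (- x)) = npow n x * (npow m x * npow m (- x)) by ring.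
by rewrite em; lra.
Qed.

Lemma up_summ : summ_by up (Z * (Z * / INR q)).
Proof.
have q0 : (0 < q)%N by apply: ltnW.
(* Congruent pairs [m < n] have the form [n = m + q (l + 1)]. From [n >= q (l + 1)] follows
   [n^(-1-d) <= q^(-1) (l + 1)^(-1-d)], the source of the factor [/ INR q]. *)
pose h (p : nat * nat) := (p.1, (p.1 + q * p.2.+1)%N).
have hi : injective h.
  by move=> [m l] [m' l'] [-> /addnI/eqP]; rewrite eqn_pmul2l // => /eqP[->].
have f0 i : (forall p, h p != i) -> up i = RtoC 0.
  case: i => m n H; rewrite /up /=; case: ifP => // /andP[mn E]; exfalso.
  have dv : (q %| n - m)%N by rewrite -eqn_mod_dvd ?(ltnW mn) // eq_sym.
  have [l El] := dvdnP dv; have l0 : (0 < l)%N.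
    by case: l El => // El; move: mn; rewrite -subn_gt0 El.
  have := H (m, l.-1); rewrite /h /= prednK // mulnC -El subnKC ?eqxx //; exact: ltnW.
rewrite -(fiber_sum_inj hi f0); apply: summ_by_fiber.
have G : summ_by (fun p : nat * nat => RtoC (beta p.1) * RtoC (beta p.2.+1 * / INR q))%C (Z * (Z * / INR q)).
  apply: (summ_by_prod beta_summ (g := fun l => RtoC (beta l.+1 * / INR q))) => s us.
  have hq := @summ_by_comp _ _ S _ _ succn_inj beta_summ s us.
  move: hq; rewrite (eq_bigr (fun l => Cmod (RtoC (beta l.+1 * / INR q)) * INR q)).
    rewrite -big_distrl /= => hq; have iq : 0 < INR q by apply: lt_0_INR; apply/ltP.
    apply: (Rmult_le_reg_r (INR q)) => //.
    by have -> : Z * / INR q * INR q = Z by field; lra.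
  move=> l _; have iq : 0 < INR q by apply: lt_0_INR; apply/ltP.
  rewrite !Cmod_R Rabs_mult (Rabs_pos_eq (/ INR q)); last by apply: Rlt_le; apply: Rinv_0_lt_compat.
  by field; lra.
apply: summ_by_le G _ => -[m l]; rewrite /up /h /=; case: ifP => _; last first.
  by rewrite Cmod_0; exact: Cmod_ge_0.
have iq : 0 < / INR q by apply: Rinv_0_lt_compat; apply: lt_0_INR; apply/ltP.
rewrite -RtoC_mult !Cmod_R !Rabs_pos_eq; last first.
- by apply: Rmult_le_pos; exact: beta_ge0.
- by apply: Rmult_le_pos; [exact: beta_ge0 | apply: Rmult_le_pos; [exact: beta_ge0 | lra]].
apply: Rmult_le_compat_l; first exact: beta_ge0.
rewrite /beta Rmult_assoc; apply: Rmult_le_compat_l => //.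
apply: Rle_trans (_ : npow (q * l.+1)%N (-1 - d) <= _).
  by apply: npow_anti; rewrite ?muln_gt0 ?q0 ?leq_addl //; lra.
rewrite npow_mul Rmult_comm; apply: Rmult_le_compat_l; first exact: npow_ge0.
by rewrite -npowN1 //; apply: npow_le; lra.
Qed.

Let off (p : nat * nat) : C :=
  if [&& coprime p.2 q, p.1 != p.2 & (p.1 == p.2 %[mod q])%N] then RtoC (b p.1 * b p.2) else RtoC 0.

(** Either [m < n] or [n < m], so [off] is dominated by [up] and its transpose; hence the factor
    [2]. *)
Lemma off_summ : summ_by off (2 * (Z * (Z * / INR q))).
Proof.
move=> s us; pose sw (p : nat * nat) := (p.2, p.1).
have swi : injective sw by move=> [x y] [x' y'] [-> ->].
have h1 := up_summ us.
have h2 := summ_by_comp swi up_summ us.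
apply: Rle_trans (_ : \rs_(p <- s) (Cmod (up p) + Cmod (up (sw p))) <= _); last first.
  by rewrite big_split; apply: Rle_trans (Rplus_le_compat _ _ _ _ h1 h2) _; lra.
have bb m n : Rabs (b m * b n) <= beta m * beta n.
  by rewrite Rabs_mult; apply: Rmult_le_compat => //; exact: Rabs_pos.
have bp m n : Rabs (beta m * beta n) = beta m * beta n.
  by rewrite Rabs_pos_eq //; apply: Rmult_le_pos; exact: beta_ge0.
apply: rsum_le => -[m n]; rewrite /off /up /sw /=.
case: ifP => [/and3P[_ ne E]|_]; last first.
  rewrite Cmod_0; have := Cmod_ge_0; move=> H.
  exact: Rplus_le_le_0_compat.
case: (ltngtP m n) ne => [mn|nm|->] // _; rewrite ?E ?(eq_sym (n %% q)%N) ?E /= Cmod_0 ?Rplus_0_r ?Rplus_0_l !Cmod_R bp.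
  exact: bb.
by rewrite Rmult_comm; exact: bb.
Qed.

Definition cdiag : R := rtot (fun n => if coprime n q then b n ^ 2 else 0).

Lemma b2_summ : summ (fun n => RtoC (if coprime n q then b n ^ 2 else 0)).
Proof.
have := summ_comp (h := fun n : nat => (n, n)) _ (summ_prod b_summ b_summ) => /(_ _)/summ_le.
move=> H; apply: H; first by move=> x y [].
move=> n; rewrite /= -RtoC_mult; case: ifP => _; last by rewrite Cmod_0; exact: Cmod_ge_0.
by rewrite Rmult_1_r; lra.
Qed.

(* Orthogonality reduces the second moment to the diagonal up to the congruent pairs [m <> n]. *)
Lemma second_moment :
  Rabs (\rs_(chi <- all_chars q) Cmod (tot (fun n => RtoC (b n) * chi n)%C) ^ 2 - INR (phi q) * cdiag)
  <= INR (phi q) * (2 * (Z * (Z * / INR q))).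
Proof.
have sb chi : is_dirichlet_char q chi -> summ (fun n => RtoC (b n) * chi n)%C.
  move=> h; apply: summ_le b_summ _ => n; rewrite Cmod_mult -[X in _ <= X]Rmult_1_r.
  by apply: Rmult_le_compat_l; [exact: Cmod_ge_0 | exact: char_le1 h n].
pose P (chi : nat -> C) (p : nat * nat) : C := (RtoC (b p.1) * chi p.1 * (RtoC (b p.2) * Cconj (chi p.2)))%C.
have sP chi : is_dirichlet_char q chi -> summ (P chi).
  by move=> h; exact: (summ_prod (sb chi h) (sb _ (char_conj h))).
have E1 chi : is_dirichlet_char q chi -> RtoC (Cmod (tot (fun n => RtoC (b n) * chi n)%C) ^ 2) = tot (P chi).
  move=> h; rewrite Cmod2_conj /P (tot_prod (sb chi h) (sb _ (char_conj h))); congr Cmult.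
  symmetry; apply: usum_tot; apply: usum_ext (usum_conj (totP (sb chi h))) => n.
  by rewrite Cmult_conj Cconj_R.
(* Extended by zero to functions that are not characters, because [tot_sum] asks for summability at
   every index. *)
pose P' chi p := if excluded_middle_informative (is_dirichlet_char q chi) then P chi p else RtoC 0.
have sP' chi : summ (P' chi).
  rewrite /P'; case: excluded_middle_informative => h; first exact: sP.
  by apply: (@summ_fin _ _ [::]).
pose D (p : nat * nat) : C := if p.1 == p.2 then (if coprime p.2 q then RtoC (b p.2 ^ 2) else RtoC 0) else RtoC 0.
have E2 : RtoC (\rs_(chi <- all_chars q) Cmod (tot (fun n => RtoC (b n) * chi n)%C) ^ 2)
   = tot (fun p => RtoC (INR (phi q)) * (D p + off p))%C.
  rewrite RtoC_rsum (@csum_in _ _ _ (fun chi => tot (P' chi))) => [|chi /(all_chars_spec q1) h]; last first.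
    rewrite E1 //; apply: tot_ext => p; rewrite /P'; by case: excluded_middle_informative.
  rewrite -tot_sum //; apply: tot_ext => -[m n].
  rewrite (@csum_in _ _ _ (fun chi => RtoC (b m * b n) * (chi m * Cconj (chi n)))%C) => [|chi /(all_chars_spec q1) h]; last first.
    by rewrite /P'; case: excluded_middle_informative => [hd|] //; rewrite /P /= RtoC_mult; ring.
  rewrite -big_distrr /= char_orthogonality // /D /off /=.
  case: (coprime n q) => /=; last by case: (m =P n) => _; ring.
  case: (m =P n) => [->|ne] /=; first by rewrite eqxx /= Rmult_1_r; ring.
  by case: ifP => _; ring.
have so : summ off by eexists; exact: off_summ.
have di : injective (fun n : nat => (n, n)) by move=> x y [].
have dz i : (forall n : nat, (n, n) != i) -> D i = RtoC 0.
  by case: i => m n H; rewrite /D /=; case: eqP => // E; have := H n; rewrite E eqxx.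
have Dn n : RtoC (if coprime n q then b n ^ 2 else 0) = D (n, n).
  by rewrite /D /= eqxx; case: ifP.
have sD' : summ (fun n : nat => D (n, n)) by apply: summ_ext Dn b2_summ.
have sD : summ D by exact: (summ_inj di dz sD').
have E3 : tot D = RtoC cdiag.
  rewrite (tot_inj di dz sD') -(tot_ext Dn) tot_real //; exact: b2_summ.
rewrite tot_scal in E2; last exact: summ_add.
rewrite tot_add // E3 in E2.
rewrite -Cmod_R RtoC_minus E2 RtoC_mult.
set ph := RtoC (INR (phi q)).
have -> : (ph * (RtoC cdiag + tot off) - ph * RtoC cdiag = ph * tot off)%C by ring.
rewrite Cmod_mult Cmod_R Rabs_pos_eq; last exact: pos_INR.
by apply: Rmult_le_compat_l; [exact: pos_INR | apply: tot_norm; exact: off_summ].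
Qed.

End OffDiagonal.


(** * Diagonal term, error terms and the asymptotic formula *)

Lemma diag_error k J q K : (0 < q)%N -> (forall n, Rabs (muk k n) * npow n (- (1 / 4)) <= K) ->
  summ (fun n => RtoC (if coprime n q then bcoef k J n ^ 2 else 0)) ->
  Rabs (cdiag q (bcoef k J) - esum k q) <= 10 * K ^ 2 * (4 / 5) ^ J.
Proof.
move=> q0 HK sb; rewrite /cdiag /esum -rtot_sub //; last exact: ecoef_summ.
have r0 : 0 <= (4 / 5) ^ J by apply: pow_le; lra.
have c0 : 0 <= 2 * K ^ 2 * (4 / 5) ^ J by have := pow2_ge_0 K; nra.
rewrite /rtot; apply: Rle_trans (re_le_Cmod _) _.
have -> : 10 * K ^ 2 * (4 / 5) ^ J = 2 * K ^ 2 * (4 / 5) ^ J * (1 + / (1 / 4)) by field.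
apply: tot_norm => s us.
apply: Rle_trans (_ : \rs_(n <- s) (2 * K ^ 2 * (4 / 5) ^ J * Cmod (RtoC (npow n (-1 - 1 / 4)))) <= _); last first.
  by rewrite -big_distrr; apply: Rmult_le_compat_l => //; apply: summ_by_npow => //; lra.
apply: rsum_le => n; rewrite !Cmod_R (Rabs_pos_eq (npow _ _)); last exact: npow_ge0.
rewrite /ecoef; case: ifP => _; last first.
  by rewrite Rminus_0_r Rabs_R0; apply: Rmult_le_pos => //; exact: npow_ge0.
have w0 := wsum_ge0 J n; have w1 := wsum_le_inv J n; have wt := wsum_tail J n.
have x0 := npow_ge0 n (-1).
have -> : npow n (-2) = npow n (-1) * npow n (-1) by rewrite -npow_add; congr npow; ring.
rewrite /bcoef; set m := muk k n; set x := npow n (-1) in w1 wt x0 *; set w := wsum J n in w0 w1 wt *.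
(* Here [x = 1/n], [x - w <= (4/5)^J n^(-3/4)] and [x + w <= 2/n]. Of [n^(-7/4)], a part [n^(-1/2)]
   pays for [muk^2] and the rest [n^(-5/4)] sums to at most [5], whence [10 = 2 * 5]. *)
have -> : (m * w) ^ 2 - m ^ 2 * (x * x) = - (m ^ 2 * ((x - w) * (x + w))) by ring.
rewrite Rabs_Ropp Rabs_pos_eq; last first.
  by apply: Rmult_le_pos; [exact: pow2_ge_0 | apply: Rmult_le_pos; lra].
set y := npow n (-3 / 4) in wt.
have y0 : 0 <= y by exact: npow_ge0.
have h1 : (x - w) * (x + w) <= (4 / 5) ^ J * y * (2 * x) by apply: Rmult_le_compat; lra.
have E : x * y = npow n (- (1 / 4)) * npow n (- (1 / 4)) * npow n (-1 - 1 / 4).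
  by rewrite /x /y -!npow_add; congr npow; field.
have hK := HK n; rewrite -/m in hK; rewrite -pow2_abs.
set v := npow n (- (1 / 4)) in hK E *; set a := Rabs m in hK *; set t := npow n (-1 - 1 / 4) in E *.
have v0 : 0 <= v by exact: npow_ge0.
have t0 : 0 <= t by exact: npow_ge0.
have a0 : 0 <= a by exact: Rabs_pos.
apply: Rle_trans (Rmult_le_compat_l _ _ _ (pow2_ge_0 a) h1) _.
have -> : a ^ 2 * ((4 / 5) ^ J * y * (2 * x)) = 2 * (4 / 5) ^ J * a ^ 2 * (x * y) by ring.
rewrite E.
have -> : 2 * (4 / 5) ^ J * a ^ 2 * (v * v * t) = (a * v) ^ 2 * (2 * (4 / 5) ^ J * t) by ring.
have -> : 2 * K ^ 2 * (4 / 5) ^ J * t = K ^ 2 * (2 * (4 / 5) ^ J * t) by ring.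
apply: Rmult_le_compat_r; first by apply: Rmult_le_pos; lra.
by apply: pow_incr; split=> //; apply: Rmult_le_pos.
Qed.

Lemma nat_ceil r : 0 <= r -> exists L : nat, r <= INR L <= r + 1.
Proof.
move=> r0; have [n [h1 h2]] := nfloor_ex r r0; exists n.+1.
by rewrite S_INR; lra.
Qed.

Lemma pow_exp_ln x J : 0 < x -> x ^ J = exp (INR J * ln x).
Proof. by move=> x0; rewrite -Rpower_pow // /Rpower. Qed.

Lemma exp_le_compat x y : x <= y -> exp x <= exp y.
Proof. by case/Rle_lt_or_eq_dec => [h|->]; [apply: Rlt_le; exact: exp_increasing | exact: Rle_refl]. Qed.


(** The exponent [L] of [inverse_power_bound] is within [1] of [48 k ln (588 q)], so [16^L] is at
    most a constant times a fixed power of [q]. Here [48 = 2 * 24], [588 = 14 * 42], and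
    [9 = 1 / (1 - 8/9)] sums the geometric tail. *)
Lemma inverse_L_truncation k : GRH -> exists C1 B1, 0 <= C1 /\ 0 <= B1 /\
  forall q, (1 < q)%N -> forall chi, is_nonprincipal_char q chi ->
  exists x : C, / Cmod (Lfun chi (RtoC 1)) ^ (2 * k) = Cmod x ^ 2 /\
    forall J, Cmod (x - tot (fun n => RtoC (bcoef k J n) * chi n))%C <= C1 * npow q B1 * (8 / 9) ^ J.
Proof.
move=> grh; pose c := 48 * INR k; have c0 : 0 <= c by have := pos_INR k; rewrite /c; lra.
have l16 : 0 < ln 16 by rewrite -ln_1; apply: ln_increasing; lra.
pose C0 := 4 ^ k * (16 * exp (c * ln 16 * ln 588)).
have C00 : 0 <= C0.
  apply: Rmult_le_pos; first by apply: pow_le; lra.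
  by apply: Rmult_le_pos; [lra | apply: Rlt_le; exact: exp_pos].
exists (9 * C0), (c * ln 16); split; first lra; split; first by apply: Rmult_le_pos; lra.
move=> q q1 chi hchi; have [hc _] := hchi.
have q0 : 0 < INR q by apply: lt_0_INR; apply/ltP; apply: ltnW.
have q2 : 1 <= INR q by apply: (le_INR 1); apply/leP; exact: ltnW.
have cm := char_completely_mult hc; have cu := char_unit q1 hc; have c1 := char_le1 q1 hc.
have cp := nonprincipal_psum q1 hchi.
have cg : forall s : C, 0 < Re s < 1 -> Ccv (dirichlet_partial chi s) (RtoC 0) -> Re s = 1 / 2.
  by case: grh => _ H; apply: (H q chi _ hchi); apply/leP; exact: ltnW.
pose f := dtaylor chi.
(* [42] is twice [twist_const 0 = 21], and [q] bounds the partial sums of [chi]. *)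
have fb j : Cmod (f j) <= 42 * INR q * (4 / 7) ^ j.
  have := dtaylor_chi_bound cu cp 0 j.
  rewrite twisted0 /twist_const Rabs_R0 -/f; move/Rle_trans; apply; apply: Req_le; ring.
have fnz := pser_chi_neq0 cm cu cp cg.
have D0 := dmuk0 cm; have DS i := dmuk_cauchy i cm c1.
have f0 := dtaylor_chi_0 cm cu cp.
have l588 : 0 <= ln (588 * INR q) by rewrite -ln_1; apply: ln_le; lra.
have bnd i L : 48 * INR i * ln (588 * INR q) <= INR L ->
    forall j, Cmod (dmuk chi i j) <= 4 ^ i * 16 ^ L * (8 / 9) ^ j.
  move=> hL; apply: (inverse_power_bound fb fnz D0 DS f0).
  by have -> : 14 * (42 * INR q) = 588 * INR q by [ring]; lra.
have sD i : summ (fun j => dmuk chi i j * RtoC 1 ^ j)%C.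
  have r0 : 0 <= 48 * INR i * ln (588 * INR q) by apply: Rmult_le_pos => //; have := pos_INR i; lra.
  have [L [hL _]] := nat_ceil r0.
  by apply: (summ_geo (bnd i L hL)); rewrite ?Cmod_1; lra.
have sf : summ (fun j => f j * RtoC 1 ^ j)%C by apply: (summ_geo fb); rewrite ?Cmod_1; lra.
(* The recursion [dmuk_cauchy], evaluated at [z = 1], identifies the sum of [dmuk chi i] as the
   inverse of the [i]-th power of [L(1, chi)]. *)
have inv i : (pser f 1 ^ i * pser (dmuk chi i) 1)%C = RtoC 1.
  elim: i => [|i IH]; first by rewrite D0 pser_sone /=; ring.
  rewrite -[RHS]IH -(DS i) (pser_cauchy sf (sD i.+1)) Cpow_S; ring.
exists (pser (dmuk chi k) 1); split.
  rewrite (Lfun_pser cu cp) -/f.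
  have E := f_equal Cmod (inv k); rewrite Cmod_mult Cmod_pow Cmod_1 in E.
  set a := Cmod (pser f 1) in E *; set b := Cmod (pser _ 1) in E *.
  have ak : a ^ k <> 0 by move=> Z; rewrite Z Rmult_0_l in E; lra.
  have -> : a ^ (2 * k) = (a ^ k) ^ 2 by rewrite -pow_mult mulnC.
  have -> : b = / a ^ k by rewrite -(Rmult_1_r (/ a ^ k)) -E; field.
  by rewrite pow_inv.
move=> J.
pose r := c * ln (588 * INR q); have r0 : 0 <= r by apply: Rmult_le_pos.
have [L [hL1 hL2]] := nat_ceil r0.
have b := bnd k L hL1.
rewrite -bcoef_sum //.
have -> : pser (dmuk chi k) 1 = tot (dmuk chi k).
  by apply: tot_ext => j; rewrite Cpow_1_l Cmult_1_r.
apply: Rle_trans (geo_tail J _ b) _; first lra.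
have -> : 4 ^ k * 16 ^ L * (8 / 9) ^ J / (1 - 8 / 9) = 9 * (4 ^ k * 16 ^ L * (8 / 9) ^ J) by field.
have hL : 16 ^ L <= 16 * exp (c * ln 16 * ln 588) * npow q (c * ln 16).
  rewrite pow_exp_ln; last lra.
  have -> : 16 * exp (c * ln 16 * ln 588) * npow q (c * ln 16) = exp ((r + 1) * ln 16).
    rewrite npowE; last exact: ltnW.
    rewrite -{1}(exp_ln 16); last lra.
    rewrite -!exp_plus; congr exp; rewrite /r ln_mult; [ring | lra | lra].
  by apply: exp_le_compat; apply: Rmult_le_compat_r; lra.
have -> : 9 * C0 * npow q (c * ln 16) * (8 / 9) ^ J =
    9 * (4 ^ k * (16 * exp (c * ln 16 * ln 588) * npow q (c * ln 16)) * (8 / 9) ^ J) by rewrite /C0; ring.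
apply: Rmult_le_compat_l; first lra.
apply: Rmult_le_compat_r; first by apply: pow_le; lra.
by apply: Rmult_le_compat_l => //; apply: pow_le; lra.
Qed.

Lemma rsum_dist (T : Type) (l : seq T) (F G : T -> R) M : (forall x, List.In x l -> Rabs (F x - G x) <= M) ->
  Rabs (\rs_(x <- l) F x - \rs_(x <- l) G x) <= INR (size l) * M.
Proof.
elim: l => [|x l IH] h; first by rewrite !big_nil Rminus_0_r Rabs_R0 Rmult_0_l; exact: Rle_refl.
have -> : INR (size (x :: l)) = INR (size l) + 1 by exact: S_INR.
rewrite !big_cons.
have h1 := h x (or_introl erefl); have h2 := IH (fun y hy => h y (or_intror hy)).
set a := F x in h1 *; set b := G x in h1 *; set A := bigop _ _ _ in h2 *; set B := bigop _ _ _ in h2 *.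
by move: h1 h2; rewrite /Rabs; do 3! case: Rcase_abs => ?; lra.
Qed.

Lemma sq_dist (x y : C) e T : Cmod (x - y)%C <= e -> Cmod y <= T ->
  Rabs (Cmod x ^ 2 - Cmod y ^ 2) <= e * (2 * T + e).
Proof.
move=> h1 h2.
have t1 := Cmod_triangle (x - y)%C y; have t2 := Cmod_triangle (- (x - y))%C x.
rewrite Cmod_opp in t2.
have E1 : (x - y + y)%C = x by ring.
have E2 : (- (x - y) + x)%C = y by ring.
rewrite E1 in t1; rewrite E2 in t2.
have a0 := Cmod_ge_0 x; have b0 := Cmod_ge_0 y.
have -> : Cmod x ^ 2 - Cmod y ^ 2 = (Cmod x - Cmod y) * (Cmod x + Cmod y) by ring.
rewrite Rabs_mult (Rabs_pos_eq (_ + _)); last lra.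
apply: Rmult_le_compat; [exact: Rabs_pos | lra | apply: Rabs_le; lra | lra].
Qed.

Lemma phi_le q : (1 < q)%N -> INR (phi q) <= INR q.
Proof.
move=> q1; rewrite -Defs_totient //; apply: le_INR; rewrite /Defs.totient.
by apply: Nat.le_trans (List.filter_length_le _ _) _; rewrite List.length_seq.
Qed.

(** Write [T = Kb * (1 + / d)], a bound for every truncated sum. Replacing [x] by its approximation
    costs [e (2 T + e)] per character; including the principal character, so that [second_moment]
    applies, costs [T^2]; the off-diagonal pairs cost [2 T^2] because [phi(q) <= q]. *)
Lemma truncated_moment q (F : (nat -> C) -> R) (b : nat -> R) Kb d e : (1 < q)%N -> 0 <= Kb -> 0 < d -> 0 <= e ->
  (forall n, Rabs (b n) <= Kb * npow n (-1 - d)) ->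
  (forall chi, is_nonprincipal_char q chi -> exists x : C, F chi = Cmod x ^ 2 /\
     Cmod (x - tot (fun n => RtoC (b n) * chi n))%C <= e) ->
  Rabs (sum_nonprincipal q F - INR (phi q) * cdiag q b) <=
    INR (phi q) * (e * (2 * (Kb * (1 + / d)) + e)) + 3 * (Kb * (1 + / d)) ^ 2.
Proof.
move=> q1 K0 d0 e0 hb hF; set T := Kb * (1 + / d).
have T0 : 0 <= T by apply: Rmult_le_pos => //; have := Rinv_0_lt_compat d d0; lra.
pose S chi := Cmod (tot (fun n => RtoC (b n) * chi n)%C).
have ST chi : is_dirichlet_char q chi -> S chi <= T.
  move=> hc; apply: tot_norm => s us.
  apply: Rle_trans (_ : \rs_(n <- s) (Kb * Cmod (RtoC (npow n (-1 - d)))) <= _); last first.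
    by rewrite -big_distrr; apply: Rmult_le_compat_l => //; exact: summ_by_npow.
  apply: rsum_le => n; rewrite Cmod_mult !Cmod_R (Rabs_pos_eq (npow _ _)); last exact: npow_ge0.
  have := char_le1 q1 hc n; have := hb n; have := Rabs_pos (b n); have := Cmod_ge_0 (chi n); nra.
have M := second_moment q1 K0 d0 hb.
rewrite /all_chars big_cons -/T -/(S _) in M.
have hp : is_dirichlet_char q (principal q) by exact: principal_char.
have p0 : 0 <= S (principal q) by exact: Cmod_ge_0.
have p1 := ST _ hp.
have E : sum_nonprincipal q F = \rs_(chi <- nonprincipal_chars q) F chi.
  rewrite /sum_nonprincipal; elim: (nonprincipal_chars q) => [|x l IH]; first by rewrite big_nil.
  by rewrite big_cons /= IH.
have [_ spec] := nonprincipal_chars_spec q1.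
have N : Rabs (\rs_(chi <- nonprincipal_chars q) F chi - \rs_(chi <- nonprincipal_chars q) S chi ^ 2)
    <= INR (size (nonprincipal_chars q)) * (e * (2 * T + e)).
  apply: rsum_dist => chi /spec hc; have [x [-> hx]] := hF chi hc.
  by apply: sq_dist => //; apply: ST; case: hc.
have sz : INR (size (nonprincipal_chars q)) <= INR (phi q).
  by rewrite -(size_all_chars q1); apply: le_INR; apply/leP; exact: leqnSn.
have w0 : 0 <= e * (2 * T + e) by apply: Rmult_le_pos; lra.
have N1 := Rmult_le_compat_r _ _ _ w0 sz.
have q0 : 0 < INR q by apply: lt_0_INR; apply/ltP; apply: ltnW.
have M1 : INR (phi q) * (2 * (T * (T * / INR q))) <= 2 * T ^ 2.
  have -> : INR (phi q) * (2 * (T * (T * / INR q))) = INR (phi q) * (2 * T ^ 2 / INR q) by field; lra.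
  apply: Rle_trans (Rmult_le_compat_r _ _ _ _ (phi_le q1)) _.
    by apply: Rmult_le_pos; [have := pow2_ge_0 T; lra | apply: Rlt_le; exact: Rinv_0_lt_compat].
  by apply: Req_le; field; lra.
have P2 : S (principal q) ^ 2 <= T ^ 2 by apply: pow_incr.
have P3 := pow2_ge_0 (S (principal q)).
rewrite E; set X := bigop _ _ _ in N *; set Y := bigop _ _ _ in N M.
set Z := _ * cdiag q b in M *.
set W := _ * (e * _) in N N1 *; set W' := _ * (e * _) in N N1 *.
move: N M; rewrite /Rabs; do 3! case: Rcase_abs => ?; lra.
Qed.

Lemma totient_lower_npow d : 0 < d -> exists2 K, 1 <= K &
  forall q, (1 < q)%N -> INR q <= INR (phi q) * (K * npow q d).
Proof.
move=> d0; have [K K1 HK] := @omega_bound 2 d ltac:(lra) d0; exists K => // q q1.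
apply: Rle_trans (totient_lower q1) _; apply: Rmult_le_compat_l; first exact: pos_INR.
by apply: HK; exact: ltnW.
Qed.

(* The choice [J ~ (B1 + 2) ln q / ln (9/8)] makes both truncation errors [O(q^-2)], while
   [z = exp (- eps / (8 A1))] keeps [z^-J] below [q^(eps/8)]. *)
Lemma negative_moment k eps : GRH -> 0 < eps -> exists K, forall q, (1 < q)%N ->
  Rabs (sum_nonprincipal q (fun chi => / Cmod (Lfun chi (RtoC 1)) ^ (2 * k)) - main_term k q)
  <= K * main_term k q * Rpower (INR q) (-1 + eps).
Proof.
move=> grh eps0; have [C1 [B1 [C10 [B10 HT]]]] := inverse_L_truncation k grh.
have l0 : 0 < ln (9 / 8) by rewrite -ln_1; apply: ln_increasing; lra.
pose A1 := (B1 + 2) / ln (9 / 8).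
have A10 : 0 < A1 by apply: Rdiv_lt_0_compat; lra.
pose eta := eps / (8 * A1); have eta0 : 0 < eta by apply: Rdiv_lt_0_compat; lra.
pose z := exp (- eta).
have z01 : 0 < z < 1.
  by split; [exact: exp_pos | rewrite -exp_0; apply: exp_increasing; lra].
pose d := (1 - z) / 4; have d0 : 0 < d by rewrite /d; lra.
have d30 : 0 < 3 * d by lra.
have [Km Km1 HKm] := muk_bound k d0.
have [K' K'1 HK'] := @muk_bound k (1 / 4) ltac:(lra).
have [Ko Ko1 HKo] := @totient_lower_npow (eps / 4) ltac:(lra).
pose U := Km * exp eta * (1 + / (3 * d)).
have W0 : 0 < 1 + / (3 * d) by have := Rinv_0_lt_compat _ d30; lra.
have U0 : 0 <= U.
  apply: Rmult_le_pos; last lra.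
  by apply: Rmult_le_pos; [lra | apply: Rlt_le; exact: exp_pos].
(* In this order: the two parts of the approximation error, the off-diagonal and principal terms,
   the diagonal error. *)
pose C4 := 2 * C1 * U + C1 ^ 2 + 3 * U ^ 2 + 10 * K' ^ 2.
exists (C4 * Ko) => q q1.
have q0 : (0 < q)%N by exact: ltnW.
have q2 : 1 <= INR q by apply: (le_INR 1); apply/leP.
have lq0 : 0 <= ln (INR q) by rewrite -ln_1; apply: ln_le; lra.
have [J [J1 J2]] : exists J, A1 * ln (INR q) <= INR J <= A1 * ln (INR q) + 1.
  by apply: nat_ceil; apply: Rmult_le_pos => //; lra.
have Zv : / z = exp eta by rewrite /z -exp_Ropp Ropp_involutive.
pose G := npow q (eps / 8); have G1 : 1 <= G by apply: npow_ge1 => //; lra.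
(* As [J <= A1 ln q + 1], the exponent contributes [q^(A1 eta) = q^(eps/8)] and the rounding of [J]
   the factor [exp eta]. *)
have ZJ : (/ z) ^ J <= exp eta * G.
  rewrite Zv pow_exp_ln; last exact: exp_pos.
  rewrite ln_exp /G npowE // -exp_plus; apply: exp_le_compat.
  have -> : eps / 8 = A1 * eta by rewrite /eta; field; lra.
  nra.
have EJ : (8 / 9) ^ J <= npow q (- (B1 + 2)).
  rewrite pow_exp_ln; last lra.
  rewrite npowE //; apply: exp_le_compat.
  have -> : 8 / 9 = / (9 / 8) by field.
  rewrite ln_Rinv; last lra.
  have -> : B1 + 2 = A1 * ln (9 / 8) by rewrite /A1; field; lra.
  nra.
have n2 : npow q (- (B1 + 2)) <= npow q (-2) by apply: npow_le; lra.
have n3 : npow q (-2) <= 1 by have := @npow_le q (-2) 0 ltac:(lra); rewrite (npowE 0) // Rmult_0_l exp_0.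
have ph : INR (phi q) * npow q (-2) <= 1.
  apply: Rle_trans (Rmult_le_compat_r _ _ _ (npow_ge0 _ _) (phi_le q1)) _.
  rewrite npow_N2 //.
  have -> : INR q * (/ INR q * / INR q) = / INR q by field; lra.
  by rewrite -Rinv_1; apply: Rinv_le_contravar; lra.
have ph0 := pos_INR (phi q).
pose e := C1 * npow q B1 * (8 / 9) ^ J.
have e0 : 0 <= e.
  apply: Rmult_le_pos; first by apply: Rmult_le_pos => //; exact: npow_ge0.
  by apply: pow_le; lra.
have e1 : e <= C1 * npow q (-2).
  have -> : npow q (-2) = npow q B1 * npow q (- (B1 + 2)) by rewrite -npow_add; congr npow; ring.
  rewrite -Rmult_assoc; apply: Rmult_le_compat_l => //.
  by apply: Rmult_le_pos => //; exact: npow_ge0.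
have e2 : e <= C1 by nra.
have e3 : INR (phi q) * e <= C1 by nra.
pose Kb := Km * (/ z) ^ J.
have Kb0 : 0 <= Kb.
  apply: Rmult_le_pos; first lra.
  by apply: pow_le; apply: Rlt_le; apply: Rinv_0_lt_compat; lra.
have hb n : Rabs (bcoef k J n) <= Kb * npow n (-1 - 3 * d) by exact: bcoef_bound.
pose T := Kb * (1 + / (3 * d)).
have T0 : 0 <= T by apply: Rmult_le_pos; lra.
have TU : T <= U * G.
  rewrite /T /U /Kb; have -> : Km * exp eta * (1 + / (3 * d)) * G = Km * (exp eta * G) * (1 + / (3 * d)) by ring.
  apply: Rmult_le_compat_r; first lra.
  by apply: Rmult_le_compat_l; lra.
have M := @truncated_moment q (fun chi => / Cmod (Lfun chi (RtoC 1)) ^ (2 * k)) (bcoef k J) Kb (3 * d) e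
  q1 Kb0 d30 e0 hb.
have {M} M := M (fun chi hc => let: ex_intro x (conj h1 h2) := HT q q1 chi hc in ex_intro _ x (conj h1 (h2 J))).
rewrite -/T in M.
have D := @diag_error k J q K' q0 HK' (b2_summ q Kb0 d30 hb).
have f45 : (4 / 5) ^ J <= (8 / 9) ^ J by apply: pow_incr; lra.
have D1 : INR (phi q) * Rabs (cdiag q (bcoef k J) - esum k q) <= 10 * K' ^ 2.
  have k0 : 0 <= 10 * K' ^ 2 by have := pow2_ge_0 K'; lra.
  apply: Rle_trans (_ : INR (phi q) * (10 * K' ^ 2 * npow q (-2)) <= _).
    apply: Rmult_le_compat_l => //; apply: Rle_trans D _; apply: Rmult_le_compat_l => //; lra.
  have -> : INR (phi q) * (10 * K' ^ 2 * npow q (-2)) = 10 * K' ^ 2 * (INR (phi q) * npow q (-2)) by ring.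
  by rewrite -[X in _ <= X]Rmult_1_r; apply: Rmult_le_compat_l.
have em := main_termE k q0 q1.
have es := esum_ge1 k q.
have GG : G ^ 2 = npow q (eps / 4).
  by rewrite /G -Rsqr_pow2 /Rsqr -npow_add; congr npow; field.
have C40 : 0 <= C4.
  have := pow2_ge_0 C1; have := pow2_ge_0 U; have := pow2_ge_0 K'.
  have := Rmult_le_pos _ _ C10 U0; rewrite /C4; lra.
(* An absolute error [O(q^(eps/4))] becomes a relative one: the main term is at least [phi(q)],
   hence at least a constant times [q^(1 - eps/4)]. *)
apply: Rle_trans (_ : C4 * npow q (eps / 4) <= _); last first.
  have m0 : INR (phi q) <= main_term k q by rewrite em; nra.
  have qE : INR q = npow q 1 by rewrite npowE // Rmult_1_l exp_ln //; lra.
  have h := HKo q q1; rewrite qE in h.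
  have h2 : npow q 1 <= main_term k q * (Ko * npow q (eps / 4)).
    apply: Rle_trans h _; apply: Rmult_le_compat_r => //.
    by apply: Rmult_le_pos; [lra | exact: npow_ge0].
  have -> : C4 * Ko * main_term k q * Rpower (INR q) (-1 + eps) =
    C4 * (Ko * (main_term k q * Rpower (INR q) (-1 + eps))) by ring.
  apply: Rmult_le_compat_l => //.
  have -> : eps / 4 = 1 + (-1 + eps / 4) by ring.
  rewrite npow_add; apply: Rle_trans (Rmult_le_compat_r _ _ _ (npow_ge0 _ _) h2) _.
  have -> : main_term k q * (Ko * npow q (eps / 4)) * npow q (-1 + eps / 4) =
     Ko * (main_term k q * npow q (-1 + eps / 2)).
    have -> : -1 + eps / 2 = eps / 4 + (-1 + eps / 4) by field.
    by rewrite (npow_add q (eps / 4)); ring.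
  apply: Rmult_le_compat_l; first lra.
  apply: Rmult_le_compat_l; first lra.
  rewrite npowE // /Rpower; apply: exp_le_compat; apply: Rmult_le_compat_r => //; lra.
rewrite -GG em.
have -> : sum_nonprincipal q (fun chi => / Cmod (Lfun chi (RtoC 1)) ^ (2 * k)) - INR (phi q) * esum k q =
  (sum_nonprincipal q (fun chi => / Cmod (Lfun chi (RtoC 1)) ^ (2 * k)) - INR (phi q) * cdiag q (bcoef k J)) +
  INR (phi q) * (cdiag q (bcoef k J) - esum k q) by ring.
apply: Rle_trans (Rabs_triang _ _) _.
rewrite (Rabs_mult (INR _)) (Rabs_pos_eq (INR (phi q))) //.
apply: Rle_trans (Rplus_le_compat _ _ _ _ M D1) _.
have h1 : INR (phi q) * (e * (2 * T + e)) <= C1 * (2 * (U * G) + C1).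
  by rewrite -Rmult_assoc; apply: Rmult_le_compat; [exact: Rmult_le_pos | lra | |  lra].
have h2 : T ^ 2 <= (U * G) ^ 2 by apply: pow_incr.
have g2 : 1 <= G ^ 2 by nra.
have -> : C4 * G ^ 2 = 2 * C1 * U * G ^ 2 + C1 ^ 2 * G ^ 2 + 3 * (U * G) ^ 2 + 10 * K' ^ 2 * G ^ 2 by rewrite /C4; ring.
have a1 : C1 * U * G <= C1 * U * G ^ 2.
  by apply: Rmult_le_compat_l; [exact: Rmult_le_pos | nra].
have a2 : C1 ^ 2 <= C1 ^ 2 * G ^ 2 by have := pow2_ge_0 C1; nra.
have a3 : 10 * K' ^ 2 <= 10 * K' ^ 2 * G ^ 2 by have := pow2_ge_0 K'; nra.
have a4 : C1 * (2 * (U * G) + C1) = 2 * (C1 * U * G) + C1 ^ 2 by ring.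
lra.
Qed.

End Development.

Theorem theorem5p5 :
  GRH ->
  forall k : nat, (1 <= k)%nat ->
  forall eps : R, 0 < eps ->
  exists K : R, forall q : nat, (2 <= q)%nat ->
    Rabs (sum_nonprincipal q (fun chi => / (Cmod (Lfun chi (RtoC 1))) ^ (2 * k))
          - main_term k q)
    <= K * main_term k q * Rpower (INR q) (-1 + eps).
Proof.
intros grh k _ eps eps0; destruct (Development.negative_moment k grh eps0) as [K HK].
exists K; intros q q2; apply HK; exact (ssrbool.introT mathcomp.boot.ssrnat.leP q2).
Qed.
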